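(* Let $P$ be a closed polygonal curve with $n$ line segments embedded in $\mathbb{R}^4$. Then there exists an embedded, locally flat, triangulated PL surface in $\mathbb{R}^4$ that has a PL subdivision of $P$ as its boundary and uses at most $24n^2$ triangles.
   Context: A closed polygonal curve with $n$ line segments embedded in $\mathbb{R}^4$ is a simple closed curve that is a cyclic union of $n$ straight line segments (edges). An embedded triangulated PL surface in $\mathbb{R}^4$ is a compact 2-manifold with boundary (of arbitrary genus) that is given as the union of a finite simplicial complex of (flat) triangles in $\mathbb{R}^4$. Having a PL subdivision of $P$ as boundary means that the boundary of the surface, as a point set, is exactly $P$, where extra vertices of the triangulation are allowed to lie on the edges of $P$. Local flatness: a surface $\Sigma$ embedded in $\mathbb{R}^d$ is locally flat if each point $x \in \Sigma$ has a neighborhood $N$ in $\mathbb{R}^d$ such that the pair $(N, N \cap \Sigma)$ is homeomorphic to $(D \times I^{d-2}, D \times \{0\}^{d-2})$, where $D$ is a 2-disk and $I=[-1,1]$, when $x$ is an interior point of $\Sigma$, with $D \times \{0\}^{d-2}$ replaced by $D^+ \times \{0\}^{d-2}$, where $D^+ \subset D$ is a half-disk with $x$ corresponding to a point of its diameter, when $x$ is a boundary point of $\Sigma$. *)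

(* Defs.v *)
From mathcomp Require Export all_boot all_order all_algebra.
From mathcomp Require Export all_classical all_reals all_analysis.
Export numFieldNormedType.Exports.

Set Implicit Arguments.
Unset Strict Implicit.
Unset Printing Implicit Defensive.
Import Order.TTheory GRing.Theory Num.Theory.
Local Open Scope classical_set_scope.
Local Open Scope ring_scope.

Definition homeomorphism (T U : topologicalType) (A : set T) (B : set U)
    (f : T -> U) (g : U -> T) : Prop :=
  [/\ {within A, continuous f}, {within B, continuous g},
      f @` A = B, (forall x, A x -> g (f x) = x)
    & (forall y, B y -> f (g y) = y)].

Definition edge_point (R : realType) (d n : nat) (v : 'I_n -> 'rV[R]_d)
    (i : 'I_n) (t : R) : 'rV[R]_d :=
  (1 - t) *: v i + t *: v (ordS i).

(* [ordS] is the cyclic successor.  The second condition says that the closed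
   path running through the edges in cyclic order is injective on the circle;
   it excludes n = 1 and n = 2. *)
Definition closed_polygonal_curve (R : realType) (d n : nat)
    (P : set 'rV[R]_d) : Prop :=
  exists v : 'I_n -> 'rV[R]_d,
    [/\ (0 < n)%N,
        (forall i j (s t : R), 0 <= s < 1 -> 0 <= t < 1 ->
           edge_point v i s = edge_point v j t -> i = j /\ s = t)
      & P = [set x | exists i, exists2 t : R, 0 <= t <= 1 &
               x = edge_point v i t]].

Definition affinely_independent (R : realType) (d m : nat)
    (p : 'I_m -> 'rV[R]_d) (s : {set 'I_m}) : Prop :=
  forall c : 'I_m -> R,
    \sum_(i in s) c i = 0 -> \sum_(i in s) c i *: p i = 0 ->
    forall i, i \in s -> c i = 0.

(* The convex hull of the points [p i], [i \in s]; empty when [s] is. *)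
Definition hull (R : realType) (d m : nat) (p : 'I_m -> 'rV[R]_d)
    (s : {set 'I_m}) : set 'rV[R]_d :=
  [set x | exists c : 'I_m -> R,
     [/\ forall i, i \in s -> 0 <= c i, \sum_(i in s) c i = 1
       & x = \sum_(i in s) c i *: p i]].

(* [F] is the set of triangles, each given by its three vertices; the
   simplices of the complex are the triangles of [F] and their faces.  For
   nondegenerate triangles the last condition also forces distinct vertices of
   the complex to have distinct positions. *)
Definition triangle_complex (R : realType) (d m : nat)
    (p : 'I_m -> 'rV[R]_d) (F : {set {set 'I_m}}) : Prop :=
  [/\ (forall s, s \in F -> #|s| = 3%N),
      (forall s, s \in F -> affinely_independent p s)
    & (forall s t, s \in F -> t \in F ->
         hull p s `&` hull p t = hull p (s :&: t))].

Definition carrier (R : realType) (d m : nat) (p : 'I_m -> 'rV[R]_d)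
    (F : {set {set 'I_m}}) : set 'rV[R]_d :=
  \bigcup_(s in [set` F]) hull p s.

Definition half_plane (R : realType) : set 'rV[R]_2 := [set u | 0 <= u 0 1].

(* The manifold interior and boundary of [S], with the subspace topology: the
   charts are defined on [U `&` S] with [U] open in the ambient space. *)
Definition manifold_interior (R : realType) (d : nat) (S : set 'rV[R]_d) :
    set 'rV[R]_d :=
  [set x | S x /\ exists U f g,
     [/\ open U, U x & homeomorphism (U `&` S) [set: 'rV[R]_2] f g]].

Definition manifold_boundary (R : realType) (d : nat) (S : set 'rV[R]_d) :
    set 'rV[R]_d :=
  [set x | S x /\ exists U f g,
     [/\ open U, U x, homeomorphism (U `&` S) (@half_plane R) f g
       & f x 0 1 = 0]].

Definition compact_surface (R : realType) (d : nat) (S : set 'rV[R]_d) :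
    Prop :=
  compact S /\ S `<=` manifold_interior S `|` manifold_boundary S.

Definition disk (R : realType) : set 'rV[R]_2 :=
  [set u | u 0 0 ^+ 2 + u 0 1 ^+ 2 <= 1].

Definition half_disk (R : realType) : set 'rV[R]_2 :=
  @disk R `&` @half_plane R.

Definition cube (R : realType) (k : nat) : set 'rV[R]_k :=
  [set w | forall i, -1 <= w 0 i <= 1].

(* The neighbourhood [N] need not be open.  In both cases [N] is homeomorphic
   to the full polydisk; only the image of [N `&` S] differs. *)
Definition locally_flat (R : realType) (d : nat) (S : set 'rV[R]_d) : Prop :=
  (forall x, manifold_interior S x ->
     exists N (f : 'rV[R]_d -> 'rV[R]_2 * 'rV[R]_(d - 2)) g,
     [/\ nbhs x N, homeomorphism N (@disk R `*` @cube R (d - 2)) f g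
       & f @` (N `&` S) = @disk R `*` [set 0]])
  /\
  (forall x, manifold_boundary S x ->
     exists N (f : 'rV[R]_d -> 'rV[R]_2 * 'rV[R]_(d - 2)) g,
     [/\ nbhs x N, homeomorphism N (@disk R `*` @cube R (d - 2)) f g,
         f @` (N `&` S) = @half_disk R `*` [set 0]
       & (f x).1 0 1 = 0]).

(* Main.v *)
Require Import Defs.
From mathcomp Require Import ring lra zify.
Set Implicit Arguments.
Unset Strict Implicit.
Unset Printing Implicit Defensive.
Import Order.TTheory GRing.Theory Num.Theory.
Local Open Scope classical_set_scope.
Local Open Scope ring_scope.

(* Project P generically to a plane and shade the points about which a ray
   casting parity is odd.  The shaded region is a surface bounded by the
   projected curve except at a crossing, where two opposite corners touch.
   Marking each edge line at its meeting points with the other lines and a small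
   distance to either side, and coning off every shaded cell from an inner point,
   yields at most 6 n^2 plane triangles.  Lift them to the graph of the piecewise
   linear function phi into R^2 whose values on the projected curve are the
   heights of P, taking at a crossing the height of one chosen strand.  The graph
   then contains P except for a short arc of the other strand at each crossing;
   one more triangle, the tent, is glued in between this arc and the graph.  The
   two touching corners together with the tent form a disk, and since there are
   two spare dimensions it is flattened by shears of R^4, so the surface is
   locally flat with boundary P and has at most 7 n^2 triangles.  That no other
   point is a boundary point is the invariance of the boundary in dimension two,
   which follows from the Poincare-Miranda theorem. *)

(** The cells are those of the arrangement of all edge lines, not of the edges alone: they are
    convex, a sign vector names each of them, and the parity is constant on them, which takes the
    place of the Jordan curve theorem. A triangle is named by the left end of its outer side and by
    the side of the line on which it lies; a left end is one of three marks of an ordered pair of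
    lines, whence 6 n^2 = 3 * 2 * n^2, and at most one tent for each ordered pair gives the seventh
    n^2. The two extra marks are the feet of the tents: the two upper sides of a tent thereby become
    edges of the lifted triangulation, so that tent and graph meet in common faces. The function
    [phi] is extended to the whole plane by Tietze's theorem, because subtracting it has to be a
    homeomorphism of all of R^4: every flat chart is a composition of global homeomorphisms.
    Genericity of the projection is a finite list of non-vanishing conditions, each polynomial along
    lines, so that one-variable polynomials suffice to meet all of them at once. *)

(** * Sperner's lemma on a square grid *)

Section SpernerGrid.
Local Open Scope nat_scope.

Definition edge01 (a b : nat) : bool :=
  (a == 0) && (b == 1) || (a == 1) && (b == 0).

Definition has012 (s : seq nat) : bool := all (fun k => k \in s) [:: 0; 1; 2].

(** If only 0 and 1 occur, the colour changes an even number of times around the square; if 0 or 1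
    is missing, there is no 01-edge at all. *)
Lemma cell_parity (a b d f : nat) : a < 3 -> b < 3 -> d < 3 -> f < 3 ->
  ~~ has012 [:: a; b; d; f] ->
  edge01 a b (+) edge01 b f = edge01 d f (+) edge01 a d.
Proof.
have /allP all3 : all (fun a => all (fun b => all (fun d => all (fun f =>
    ~~ has012 [:: a; b; d; f] ==>
    (edge01 a b (+) edge01 b f == edge01 d f (+) edge01 a d))
    (iota 0 3)) (iota 0 3)) (iota 0 3)) (iota 0 3) by vm_compute.
have mem3 k : k < 3 -> k \in iota 0 3 by rewrite mem_iota.
move=> /mem3 /all3 /allP all2 /mem3 /all2 /allP all1 /mem3 /all1 /allP all0.
by move=> /mem3 /all0 /implyP h /h /eqP.
Qed.

(* Modulo 2, the number of 01-edges in a row of the grid does not depend on the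
   row unless some cell carries all three colours. *)
Lemma sperner_grid (N : nat) (c : nat -> nat -> nat) :
  (forall i j, c i j < 3) ->
  (forall j, j <= N -> c 0 j != 1) -> (forall j, j <= N -> c N j != 0) ->
  (forall i, i <= N -> c i 0 != 2) -> (forall i, i <= N -> c i N = 2) ->
  exists i j, [/\ i < N, j < N &
    has012 [:: c i j; c i.+1 j; c i j.+1; c i.+1 j.+1]].
Proof.
move=> c3 cl cr cb ct; apply: contrapT => none.
have cell i j : i < N -> j < N ->
  edge01 (c i j) (c i.+1 j) (+) edge01 (c i.+1 j) (c i.+1 j.+1) =
  edge01 (c i j.+1) (c i.+1 j.+1) (+) edge01 (c i j) (c i j.+1).
  move=> iN jN; apply: cell_parity; rewrite ?c3 //.
  by apply/negP => h; apply: none; exists i, j.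
pose row j k := \big[addb/false]_(i < k) edge01 (c i j) (c i.+1 j).
(* Adding the parities of the first [k] cells between two rows cancels the inner vertical edges. *)
have step j k : j < N -> k <= N ->
  row j k (+) edge01 (c k j) (c k j.+1) = row j.+1 k (+) edge01 (c 0 j) (c 0 j.+1).
  move=> jN; elim: k => [|k IH] kN; first by rewrite /row !big_ord0.
  have := IH (ltnW kN); have := cell k j kN jN.
  rewrite /row !big_ord_recr /=.
  move: (\big[addb/false]_(i < k) _) (\big[addb/false]_(i < k) _) => u v.
  move: (edge01 (c k j) _) (edge01 (c k.+1 j) _) (edge01 (c k j.+1) _)
        (edge01 (c k j) _) (edge01 (c 0 j) _).
  by case: u; case: v; do 5!case.
have rowS j : j < N -> row j N = row j.+1 N.
  move=> jN; have := step j N jN (leqnn N).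
  have -> : edge01 (c 0 j) (c 0 j.+1) = false.
    have := cl j (ltnW jN); have := cl j.+1 jN; rewrite /edge01.
    by move=> /negbTE -> /negbTE ->; rewrite andbF.
  have -> : edge01 (c N j) (c N j.+1) = false.
    have := cr j (ltnW jN); have := cr j.+1 jN; rewrite /edge01.
    by move=> /negbTE -> /negbTE ->; rewrite andbF.
  by rewrite !addbF.
have row0 j : j <= N -> row 0 N = row j N.
  elim: j => [//|j IH] jN.
  by rewrite -(rowS j jN); exact: IH (ltnW jN).
have top : row N N = false.
  by rewrite /row big1 // => i _; rewrite !ct // ltnW.
have bin k : k <= N -> c k 0 = (c k 0 == 1).
  move=> kN; have := cb k kN; have := c3 k 0.
  by case: (c k 0) => [|[|[|?]]].
(* The bottom row uses only 0 and 1 and starts with 0, so the parity of its changes is the current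
   colour. *)
have bot k : k <= N -> row 0 k = (c k 0 == 1).
  elim: k => [|k IH] kN.
    by rewrite /row big_ord0; apply/esym/negbTE/cl.
  rewrite /row big_ord_recr /= -/(row 0 k) IH ?(ltnW kN) //.
  rewrite (bin k (ltnW kN)) (bin _ kN) /edge01.
  by case: (c k 0 == 1); case: (c k.+1 0 == 1).
have := row0 N (leqnn N); rewrite top bot // => cN.
by have := cr 0 (leq0n N); rewrite (bin N (leqnn N)) cN.
Qed.

End SpernerGrid.

(** * Rules for continuity *)

Section ContinuityRules.
Variables (R : realType) (T : topologicalType).
Implicit Types f g : T -> R.

Lemma cts_id : continuous (fun x : T => x).
Proof. by move=> x; exact: cvg_id. Qed.

Lemma ctsD f g : continuous f -> continuous g -> continuous (fun x => f x + g x).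
Proof. by move=> cf cg x; apply: continuousD; [exact: cf|exact: cg]. Qed.

Lemma ctsN f : continuous f -> continuous (fun x => - f x).
Proof. by move=> cf x; apply: continuousN; exact: cf. Qed.

Lemma ctsM f g : continuous f -> continuous g -> continuous (fun x => f x * g x).
Proof. by move=> cf cg x; apply: continuousM; [exact: cf|exact: cg]. Qed.

Lemma ctsV f : (forall x, f x != 0) -> continuous f -> continuous (fun x => (f x)^-1).
Proof. by move=> f0 cf x; apply: continuousV; [exact: f0|exact: cf]. Qed.

Lemma ctsX f n : continuous f -> continuous (fun x => f x ^+ n).
Proof.
move=> cf; elim: n => [|n IH].
  by under [X in continuous X]eq_fun do rewrite expr0; exact: cst_continuous.
by under [X in continuous X]eq_fun do rewrite exprS; exact: ctsM.
Qed.

Lemma cts_norm f : continuous f -> continuous (fun x => `|f x|).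
Proof.
move=> cf x; apply: (@continuous_comp _ _ _ f Num.norm); first exact: cf.
exact: norm_continuous.
Qed.

Lemma cts_max f g : continuous f -> continuous g ->
  continuous (fun x => Num.max (f x) (g x)).
Proof. by move=> cf cg x; apply: continuous_max; [exact: cf|exact: cg]. Qed.

Lemma cts_min f g : continuous f -> continuous g ->
  continuous (fun x => Num.min (f x) (g x)).
Proof. by move=> cf cg x; apply: continuous_min; [exact: cf|exact: cg]. Qed.

Lemma cts_comp (U V : topologicalType) (f : U -> V) (g : T -> U) :
  continuous f -> continuous g -> continuous (fun x => f (g x)).
Proof. by move=> cf cg x; apply: continuous_comp; [exact: cg|exact: cf]. Qed.

Lemma cts_fst (U V : topologicalType) (g : T -> U * V) :
  continuous g -> continuous (fun x => (g x).1).
Proof. by move=> cg; apply: cts_comp cg => x; exact: cvg_fst. Qed.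

Lemma cts_snd (U V : topologicalType) (g : T -> U * V) :
  continuous g -> continuous (fun x => (g x).2).
Proof. by move=> cg; apply: cts_comp cg => x; exact: cvg_snd. Qed.

Lemma cts_pair (U V : topologicalType) (f : T -> U) (g : T -> V) :
  continuous f -> continuous g -> continuous (fun x => (f x, g x)).
Proof. by move=> cf cg x; apply: cvg_pair; [exact: cf|exact: cg]. Qed.

Lemma cts_coord m n (g : T -> 'M[R]_(m, n)) i j :
  continuous g -> continuous (fun x => g x i j).
Proof. by apply: (@cts_comp _ _ (fun M : 'M[R]_(m, n) => M i j)); exact: coord_continuous. Qed.

Lemma cts_mx_at m n (F : 'I_m -> 'I_n -> T -> R) x :
  (forall i j, {for x, continuous (F i j)}) ->
  {for x, continuous (fun x => \matrix_(i, j) F i j x)}.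
Proof.
move=> cF; apply/cvg_ballP => e e0.
have : \forall y \near x, forall ij : 'I_m * 'I_n,
    ball (F ij.1 ij.2 x) e (F ij.1 ij.2 y).
  apply: filter_forall => -[i j].
  by have /cvg_ballP := cF i j; exact.
by apply: filterS => y h; split=> // i j; rewrite !mxE; exact: (h (i, j)).
Qed.

Lemma cts_mx m n (F : 'I_m -> 'I_n -> T -> R) :
  (forall i j, continuous (F i j)) -> continuous (fun x => \matrix_(i, j) F i j x).
Proof. by move=> cF x; apply: cts_mx_at => i j; exact: cF. Qed.

End ContinuityRules.

(* Syntax-directed, so as not to let unification unfold the ring structure. *)
Ltac cts :=
  try assumption;
  lazymatch goal with
  | |- forall z, continuous_at z ?F =>
    lazymatch F with
    | (fun _ => ?c) => exact: cst_continuous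
    | (fun x => x) => exact: cts_id
    | (fun x => (@?a x + @?b x)%R) => apply: (@ctsD _ _ a b); cts
    | (fun x => (- @?a x)%R) => apply: (@ctsN _ _ a); cts
    | (fun x => (@?a x * @?b x)%R) => apply: (@ctsM _ _ a b); cts
    | (fun x => (@?a x ^+ ?n)%R) => apply: (@ctsX _ _ a n); cts
    | (fun x => `|@?a x|%R) => apply: (@cts_norm _ _ a); cts
    | (fun x => Num.max (@?a x) (@?b x)) => apply: (@cts_max _ _ a b); cts
    | (fun x => Num.min (@?a x) (@?b x)) => apply: (@cts_min _ _ a b); cts
    | (fun x => (@?a x, @?b x)) => apply: (@cts_pair _ _ _ a b); cts
    | (fun x => (@?a x).1) => apply: (@cts_fst _ _ _ a); cts
    | (fun x => (@?a x).2) => apply: (@cts_snd _ _ _ a); cts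
    | (fun x => fun_of_matrix (@?a x) ?i ?j) => apply: (@cts_coord _ _ _ _ a i j); cts
    | _ => idtac
    end
  | _ => idtac
  end.

Section ContinuityFacts.
Variables (R : realType) (T : topologicalType).

Lemma cts_within (U V : topologicalType) (A : set U) (f : U -> V) (g : T -> U) :
  {within A, continuous f} -> continuous g -> (forall x, A (g x)) ->
  continuous (fun x => f (g x)).
Proof.
move=> /subspace_continuousP cf cg Ag x.
have fg := cf (g x) (Ag x).
apply: cvg_trans fg => B /= hB.
have hB' : nbhs (g x) [set y | A y -> B (f y)] by [].

move: (cg x _ hB'); apply: (@filterS _ (nbhs x)) => y /= h; exact: h (Ag _).
Qed.

Lemma near_gt0 (f : T -> R) x : continuous f -> 0 < f x -> \forall y \near x, 0 < f y.
Proof. by move=> cf f0; exact: (cf x _ (lt_nbhsr f0)). Qed.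

Lemma near_lt0 (f : T -> R) x : continuous f -> f x < 0 -> \forall y \near x, f y < 0.
Proof.
move=> cf f0; have cNf := ctsN cf.
have := @near_gt0 _ x cNf; rewrite oppr_gt0 => /(_ f0).
by apply: filterS => y; rewrite oppr_gt0.
Qed.

End ContinuityFacts.

(** * The Poincare-Miranda theorem *)

Section PoincareMiranda.
Variable R : realType.

Definition square1 : set (R * R) := [set p | -1 <= p.1 <= 1 /\ -1 <= p.2 <= 1].

Lemma square1_compact : compact square1.
Proof.
have -> : square1 = (`[-1, 1]%classic `*` `[-1, 1]%classic : set (R * R)).
  by apply/seteqP; split=> p /=; rewrite !in_itv.
by apply: compact_setX; exact: segment_compact.
Qed.

Definition const_sign (F : R * R -> R) (Z : set (R * R)) :=
  (forall p, Z p -> 0 < F p) \/ (forall p, Z p -> F p < 0).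

Lemma const_sign_near (F : R * R -> R) p : continuous F -> F p != 0 ->
  exists2 e : R, 0 < e & const_sign F (ball p e).
Proof.
move=> cF Fp; have [Fp0|Fp0|Fp0] := ltgtP (F p) 0; last by rewrite Fp0 eqxx in Fp.
  by have /nbhs_ballP[e e0 he] := near_lt0 cF Fp0; exists e => //; right.
by have /nbhs_ballP[e e0 he] := near_gt0 cF Fp0; exists e => //; left.
Qed.

Lemma const_sign_sub F (Y Z : set (R * R)) : Y `<=` Z -> const_sign F Z -> const_sign F Y.
Proof. by move=> YZ [h|h]; [left|right] => p /YZ; exact: h. Qed.

Lemma poincare_miranda (F1 F2 : R * R -> R) :
  continuous F1 -> continuous F2 ->
  (forall y, -1 <= y <= 1 -> F1 (-1, y) < 0 /\ 0 < F1 (1, y)) ->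
  (forall x, -1 <= x <= 1 -> F2 (x, -1) < 0 /\ 0 < F2 (x, 1)) ->
  exists p, F1 p = 0 /\ F2 p = 0.
Proof.
move=> c1 c2 b1 b2; apply: contrapT => none.
have good p : exists2 e : R, 0 < e &
    const_sign F1 (ball p e) \/ const_sign F2 (ball p e).
  have [F1p|] := eqVneq (F1 p) 0.
    have [F2p|] := eqVneq (F2 p) 0; first by exfalso; apply: none; exists p.
    by move=> /(const_sign_near c2)[e e0 h]; exists e => //; right.
  by move=> /(const_sign_near c1)[e e0 h]; exists e => //; left.
(* A Lebesgue number: by compactness one radius serves all points of the square. *)
have cover : \forall e \near (0 : R)^'+, square1 `<=`
    (fun p => const_sign F1 (ball p e) \/ const_sign F2 (ball p e)).
  have /compact_near_coveringP nc := square1_compact.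
  apply: (nc R (0 : R)^'+) => p _; have [e e0 h] := good p.
  have e20 : 0 < e / 2 by rewrite divr_gt0.
  near=> q d => /=.
  have sub : ball q d `<=` ball p e.
    move=> z qz; apply: (@ball_split _ _ q).
      by near: q; exact: (@nbhsx_ballx _ _ p (e / 2)).
    apply: le_ball qz; near: d; exact: nbhs_right_le.
  by case: h => h; [left|right]; exact: const_sign_sub sub h.
have [d [d0 hd]] := filter_ex (filterI (nbhs_right_gt (0 : R)) cover).
pose N := (Num.bound (2 / d)).
have N2 : 2 / d < N%:R by apply: archi_boundP; rewrite divr_ge0 // ltW.
have N0 : (0 : R) < N%:R by apply: le_lt_trans N2; rewrite divr_ge0 // ltW.
have dN : 2 / N%:R < d by rewrite ltr_pdivrMr // mulrC -ltr_pdivrMr.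
pose g (i : nat) : R := -1 + 2 * i%:R / N%:R.
have gI i : (i <= N)%N -> -1 <= g i <= 1.
  move=> iN; have t0 : 0 <= i%:R / N%:R :> R by rewrite divr_ge0 // ltW.
  have t1 : i%:R / N%:R <= 1 :> R by rewrite ler_pdivrMr // mul1r ler_nat.
  rewrite /g -mulrA; apply/andP; split; lra.
have g0 : g 0%N = -1 by rewrite /g mulr0 mul0r addr0.
have gN : g N = 1 by rewrite /g mulfK ?gt_eqF //; lra.
have gS i : `|g i - g i.+1| < d.
  rewrite /g -natr1 (_ : _ - _ = - (2 / N%:R)); last by field; rewrite gt_eqF.
  by rewrite normrN ger0_norm // divr_ge0 // ltW.
(* Colour 2 records [F2 >= 0]; the colours 1 and 0 split the rest by the sign of [F1]. A constant
   sign of either function on a cell therefore excludes at least one colour there. *)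
pose c i j := if 0 <= F2 (g i, g j) then 2%N else if 0 < F1 (g i, g j) then 1%N else 0%N.
have [|||||i [j [iN jN]]] := @sperner_grid N c.
- by move=> i j; rewrite /c; case: ifP => // _; case: ifP.
- move=> j jN; have [b _] := b1 _ (gI _ jN).
  by rewrite /c g0; case: ifP => // _; rewrite ltNge ltW.
- move=> j jN; have [_ b] := b1 _ (gI _ jN).
  by rewrite /c gN; case: ifP => // _; rewrite b.
- move=> i iN; have [b _] := b2 _ (gI _ iN).
  by rewrite /c g0 leNgt b /=; case: ifP.
- move=> i iN; have [_ b] := b2 _ (gI _ iN).
  by rewrite /c gN ltW.
have pS : square1 (g i, g j) by split; apply: gI; exact: ltnW.
have bN (k l : bool) : ball (g i, g j) d (g (i + k)%N, g (j + l)%N).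
  have h m (b : bool) : `|g m - g (m + b)%N| < d.
    by case: b; rewrite ?addn1 // addn0 subrr normr0.
  by split; rewrite /= -ball_normE; exact: h.
have := hd _ pS.
rewrite /has012 /= !andbT !inE.
have := bN true true; have := bN true false; have := bN false true; have := bN false false.
rewrite !addn1 !addn0 => n0 n1 n2 n3 [[]h|[]h].
- by rewrite /c !h //; do 4!case: (_ <= _).
- have h' q : ball (g i, g j) d q -> (0 < F1 q) = false.
    by move=> /h /ltW; rewrite leNgt => /negbTE.
  by rewrite /c !h' //; do 4!case: (_ <= _).
- have h' q : ball (g i, g j) d q -> 0 <= F2 q by move=> /h /ltW.
  by rewrite /c !h'.
- have h' q : ball (g i, g j) d q -> (0 <= F2 q) = false.
    by move=> /h; rewrite ltNge => /negbTE.
  by rewrite /c !h' //; do 4!case: (_ < _).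
Unshelve. all: by end_near.
Qed.
End PoincareMiranda.

(** * Row vectors of length two *)

Section Row2.
Variable R : realType.

Definition row2 (a b : R) : 'rV[R]_2 := \row_j (if j == 0 then a else b).

Lemma row2_0 a b : row2 a b 0 0 = a. Proof. by rewrite mxE. Qed.
Lemma row2_1 a b : row2 a b 0 1 = b. Proof. by rewrite mxE. Qed.

Lemma row2_ext (u v : 'rV[R]_2) : u 0 0 = v 0 0 -> u 0 1 = v 0 1 -> u = v.
Proof.
move=> e0 e1; apply/rowP => j.
have [->|->] : j = 0 \/ j = 1 by case: j => [[|[|//]] ?]; [left|right]; exact/val_inj.
  exact: e0.
exact: e1.
Qed.

Lemma cts_row2_at (T : topologicalType) (f g : T -> R) x :
  {for x, continuous f} -> {for x, continuous g} ->
  {for x, continuous (fun x => row2 (f x) (g x))}.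
Proof.
move=> cf cg.
apply: (@cts_mx_at _ _ 1 2 (fun _ j x => if j == 0 then f x else g x)).
by move=> _ j; case: (j == 0).
Qed.

Lemma cts_row2 (T : topologicalType) (f g : T -> R) :
  continuous f -> continuous g -> continuous (fun x => row2 (f x) (g x)).
Proof. by move=> cf cg x; apply: cts_row2_at; [exact: cf|exact: cg]. Qed.

Lemma ball_row2 (u v : 'rV[R]_2) (e : R) : 0 < e ->
  ball u e v <-> `|u 0 0 - v 0 0| < e /\ `|u 0 1 - v 0 1| < e.
Proof.
move=> e0; split=> [[_ h]|[h0 h1]].
  by split; have := h 0 _; rewrite -ball_normE; exact.
split=> // i j; rewrite ord1 -ball_normE /=.
by have [->|->] : j = 0 \/ j = 1 by case: j => [[|[|//]] ?]; [left|right]; exact/val_inj.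
Qed.

End Row2.

(** * Invariance of the boundary in dimension two *)

Section InvarianceOfBoundary.
Variables (R : realType) (d : nat) (S : set 'rV[R]_d).

(* If [x] were both an interior and a boundary point, a small square loop around
   it could be contracted, through the star-shaped half disc, in the punctured
   plane; this contradicts the Poincare-Miranda theorem. *)
Lemma interior_boundary_disjoint x :
  manifold_interior S x -> manifold_boundary S x -> False.
Proof.
move=> [Sx [U [f [g [Uo Ux [fc gc fi gf fg]]]]]].
move=> [_ [V [f' [g' [Vo Vx [fc' gc' fi' gf' fg']] f'x]]]].
have USx : (U `&` S) x by [].
have VSx : (V `&` S) x by [].
have {}gc : continuous g.
  by apply: (cts_within gc (@cts_id _)).
have gUS a : (U `&` S) (g a).
  have : [set: 'rV[R]_2] a by []; rewrite -fi => -[y Uy <-]; by rewrite gf.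
have gVS b : half_plane b -> (V `&` S) (g' b).
  by rewrite -fi' => -[y Vy <-]; rewrite gf'.
have fH y : (V `&` S) y -> half_plane (f' y) by move=> Vy; rewrite -fi'; exists y.
set a0 := f x; set b0 := f' x.
have ga0 : g a0 = x by rewrite gf.
have gb0 : g' b0 = x by rewrite gf'.
have Hb0 : half_plane b0 by exact: fH.
have [r r0 hr] : exists2 r : R, 0 < r & forall b : 'rV[R]_2, half_plane b ->
    `|b0 0 0 - b 0 0| < r -> `|b0 0 1 - b 0 1| < r -> U (g' b).
  have /subspace_continuousP/(_ _ Hb0) cg' := gc'.
  have Ub0 : nbhs (g' b0) U by rewrite gb0; exact: open_nbhs_nbhs.
  have /nbhs_ballP[r r0 hr] := cg' _ Ub0.
  by exists r => // b Hb h0 h1; apply: hr => //; apply/ball_row2.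
have [e e0 he] : exists2 e : R, 0 < e & forall a : 'rV[R]_2,
    `|a0 0 0 - a 0 0| < e -> `|a0 0 1 - a 0 1| < e -> V (g a) /\
    (`|b0 0 0 - f' (g a) 0 0| < r /\ `|b0 0 1 - f' (g a) 0 1| < r).
  have Vg : nbhs (g a0) V by rewrite ga0; exact: open_nbhs_nbhs.
  have /subspace_continuousP/(_ _ VSx) cf' := fc'.
  have Bg : nbhs (g a0) [set y | (V `&` S) y -> ball b0 r (f' y)].
    by rewrite ga0; exact: (cf' _ (nbhsx_ballx b0 r r0)).
  have : nbhs a0 [set a | V (g a) /\ ((V `&` S) (g a) -> ball b0 r (f' (g a)))].
    have n1 : nbhs a0 (g @^-1` V) by exact: (gc a0 _ Vg).
    have := gc a0 _ Bg; move: n1; exact: (@filterI _ (nbhs a0)).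
  move=> /nbhs_ballP[e e0 he].
  exists e => // a h0 h1; have [] := he a; first exact/ball_row2.
  move=> Va Ba; split=> //; apply/ball_row2 => //; apply: Ba.
  by split=> //; have [] := gUS a.
pose rho := e / 2; have rho0 : 0 < rho by rewrite divr_gt0.
have rhoe : rho < e by rewrite /rho; lra.
pose nrm (u : R * R) := Num.max `|u.1| `|u.2|.
(* For [nrm u >= 1/2] the point [psi u] runs on the boundary of the square of half side [rho] about
   [a0]; the cut-off at 1/2 fills this square in continuously. *)
pose M u := Num.max (nrm u) (1 / 2).
have M0 u : 0 < M u by rewrite lt_max divr_gt0 ?orbT.
have cM : continuous M by rewrite /M /nrm; cts.
have cMV : continuous (fun u => (M u)^-1) by apply: ctsV => // u; rewrite gt_eqF.
have uM u : `|u.1 / M u| <= 1 /\ `|u.2 / M u| <= 1.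
  rewrite !normrM !normfV !(gtr0_norm (M0 u)) !ler_pdivrMr // !mul1r.
  by rewrite /M /nrm !le_max !lexx !orbT.
pose psi u := row2 (a0 0 0 + rho * (u.1 / M u)) (a0 0 1 + rho * (u.2 / M u)).
have cpsi : continuous psi by apply: cts_row2; cts.
have hpsi u : V (g (psi u)) /\
    (`|b0 0 0 - f' (g (psi u)) 0 0| < r /\ `|b0 0 1 - f' (g (psi u)) 0 1| < r).
  have small t : `|t| <= 1 -> `|rho * t| < e.
    move=> t1; rewrite normrM gtr0_norm //; apply: le_lt_trans rhoe.
    by rewrite ler_piMr // ltW.
  have [u1 u2] := uM u.
  by apply: he; rewrite ?row2_0 ?row2_1 opprD addNKr normrN small.
have VSpsi u : (V `&` S) (g (psi u)).
  by split; [have [] := hpsi u|have [] := gUS (psi u)].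
pose h u := f' (g (psi u)).
have ch : continuous h.
  apply: (cts_within fc') => //; exact: (cts_comp gc).
(* The time of the contraction: 0 from [nrm u = 1] outwards, 1 for [nrm u <= 1/2]. *)
pose s u := Num.max 0 (Num.min 1 (2 * (1 - nrm u))).
have cs : continuous s by rewrite /s /nrm; cts.
have s01 u : 0 <= s u <= 1.
  by rewrite le_max lexx /= ge_max ler01 ge_min lexx.
(* The straight contraction of [h u] to a point of height [r / 2] strictly inside the half plane; as
   soon as [s u > 0] the height is positive, so [b0] is avoided. *)
pose b u := row2 ((1 - s u) * h u 0 0 + s u * b0 0 0)
                 ((1 - s u) * h u 0 1 + s u * (r / 2)).
have cb : continuous b by apply: cts_row2; cts.
have h1 u : 0 <= h u 0 1 by exact: fH.
have Hb u : half_plane (b u).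
  rewrite /half_plane /= row2_1; have /andP[s0 s1] := s01 u.
  by rewrite addr_ge0 // mulr_ge0 ?subr_ge0 // divr_ge0 // ltW.
have Ub u : U (g' (b u)).
  have [_ [h0 h1']] := hpsi u; have /andP[s0 s1] := s01 u.
  apply: hr => //; rewrite ?row2_0 ?row2_1.
    rewrite (_ : _ - _ = (1 - s u) * (b0 0 0 - h u 0 0)); last ring.
    rewrite normrM ger0_norm ?subr_ge0 //; apply: le_lt_trans h0.
    by rewrite ler_piMl // lerBlDr lerDl.
  move: h1'; rewrite -/(h u) /b0 f'x !sub0r !normrN.
  have := h1 u; move: (h u 0 1) => t t0.
  rewrite !ger0_norm ?addr_ge0 ?mulr_ge0 ?subr_ge0 ?divr_ge0 ?(ltW r0) // => tr.
  have : (1 - s u) * t <= (1 - s u) * r by rewrite ler_wpM2l ?subr_ge0 // ltW.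
  have [s00|s00] := eqVneq (s u) 0; first by rewrite s00; lra.
  have : 0 < s u * r by rewrite mulr_gt0 // lt_neqAle eq_sym s00.
  lra.
have USb u : (U `&` S) (g' (b u)) by split=> //; have [] := gVS _ (Hb u).
pose k u := f (g' (b u)).
have ck : continuous k.
  apply: (cts_within fc) => //; exact: (cts_within gc').
have := @poincare_miranda R (fun u => k u 0 0 - a0 0 0) (fun u => k u 0 1 - a0 0 1).
have kedge u : nrm u = 1 -> k u = row2 (a0 0 0 + rho * u.1) (a0 0 1 + rho * u.2).
  move=> u1; have M1 : M u = 1 by rewrite /M u1 max_l //; lra.
  have s0 : s u = 0 by rewrite /s u1 subrr mulr0 min_r // maxxx.
  have bu : b u = h u.
    by apply: row2_ext; rewrite ?row2_0 ?row2_1 s0; ring.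
  rewrite /k bu /h gf' // fg // /psi M1 !divr1 //.
case.
- by cts.
- by cts.
- move=> y /andP[y0 y1].
  have yn : `|y| <= 1 by rewrite ler_norml y0.
  rewrite !kedge /nrm /= ?normrN ?normr1 ?max_l // !row2_0.
  by split; lra.
- move=> y /andP[y0 y1].
  have yn : `|y| <= 1 by rewrite ler_norml y0.
  rewrite !kedge /nrm /= ?normrN ?normr1 ?max_r // !row2_1.
  by split; lra.
move=> u [/eqP k0 /eqP k1]; rewrite !subr_eq0 in k0 k1.
have ka : k u = a0 by apply: row2_ext; exact/eqP.
have gbx : g' (b u) = x by rewrite -(gf _ (USb u)) -/(k u) ka.
have bb : b u = b0 by rewrite -(fg' _ (Hb u)) gbx.
have /andP[sge0 sle1] := s01 u.
(* Height 0 forces [s u = 0], hence [h u = b0] and [psi u = a0]. The latter gives [u = 0], where [s]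
   is 1. *)
have : b u 0 1 = 0 by rewrite bb.
rewrite row2_1 => /eqP.
rewrite paddr_eq0 ?mulr_ge0 ?subr_ge0 ?divr_ge0 ?(ltW r0) // => /andP[_].
have r2 : r / 2 != 0 by rewrite gt_eqF // divr_gt0.
rewrite mulf_eq0 (negbTE r2) orbF => /eqP s0.
have hb : h u = b0.
  by rewrite -bb; apply: row2_ext; rewrite ?row2_0 ?row2_1 s0; ring.
have pa : psi u = a0.
  by rewrite -(fg (psi u)) // -(gf' _ (VSpsi u)) -/(h u) hb gb0.
have z (t : R) : rho * (t / M u) = 0 -> t = 0.
  have Mu := M0 u; move=> zt; apply/eqP; apply: contraT => tn.
  suff : rho * (t / M u) != 0 by rewrite zt eqxx.
  by rewrite !mulf_neq0 ?invr_eq0 // gt_eqF.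
have z1 : u.1 = 0.
  by apply: z; have := congr1 (fun v : 'rV_2 => v 0 0) pa; rewrite row2_0; lra.
have z2 : u.2 = 0.
  by apply: z; have := congr1 (fun v : 'rV_2 => v 0 1) pa; rewrite row2_1; lra.
by move: s0; rewrite /s /nrm z1 z2 !normr0 maxxx subr0 mulr1 min_l ?max_r //; lra.
Qed.

End InvarianceOfBoundary.

(** * Locally flat charts *)

Section FlatCharts.
Variable R : realType.

Definition homeo (T U : topologicalType) (f : T -> U) (g : U -> T) :=
  [/\ continuous f, continuous g, cancel f g & cancel g f].

Lemma homeo_comp (T U V : topologicalType) (f : T -> U) g (h : U -> V) k :
  homeo f g -> homeo h k -> homeo (fun x => h (f x)) (fun y => g (k y)).
Proof.
move=> [cf cg fg gf] [ch ck hk kh]; split.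
- exact: (cts_comp ch cf).
- exact: (cts_comp cg ck).
- by move=> x; rewrite hk fg.
- by move=> y; rewrite gf kh.
Qed.

(* Locally at [x], up to a homeomorphism of the whole space, [S] is the
   coordinate plane ([b = false]) or the coordinate half plane ([b = true]). *)
Definition flat_at (T : topologicalType) (b : bool) (S : set T) (x : T) :=
  exists (f : T -> (R * R) * (R * R)) (g : (R * R) * (R * R) -> T),
  [/\ homeo f g, f x = ((0, 0), (0, 0)) &
    \forall y \near x, S y <-> (f y).2 = (0, 0) /\ (b -> 0 <= (f y).1.2)].

Lemma flat_at_homeo (T U : topologicalType) (h : T -> U) k b (S : set U) x :
  homeo h k -> flat_at b S (h x) -> flat_at b (h @^-1` S) x.
Proof.
move=> hk [f [g [fg fx nx]]]; exists (fun y => f (h y)), (fun y => k (g y)).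
split=> //; first exact: homeo_comp hk fg.
by case: hk => ch _ _ _; exact: (ch x _ nx).
Qed.

Definition box4 (p : (R * R) * (R * R)) : R :=
  Num.max (Num.max `|p.1.1| `|p.1.2|) (Num.max `|p.2.1| `|p.2.2|).

Lemma box4_lt p e : box4 p < e <->
  [/\ `|p.1.1| < e, `|p.1.2| < e, `|p.2.1| < e & `|p.2.2| < e].
Proof.
rewrite /box4 !gt_max; split; first by move=> /andP[/andP[? ?] /andP[? ?]].
by case=> -> -> -> ->.
Qed.

Lemma cts_box4 : continuous box4.
Proof. by rewrite /box4; cts. Qed.

(** Continuity of [g] at the origin turns the neighbourhood of [x] into the preimage of an explicit
    box, out of which both kinds of chart are cut. *)
Lemma flat_at_box (T : topologicalType) b (S : set T) x
    (f : T -> (R * R) * (R * R)) g :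
  homeo f g -> f x = ((0, 0), (0, 0)) ->
  (\forall y \near x, S y <-> (f y).2 = (0, 0) /\ (b -> 0 <= (f y).1.2)) ->
  exists2 e : R, 0 < e & forall y, box4 (f y) < e ->
    (S y <-> (f y).2 = (0, 0) /\ (b -> 0 <= (f y).1.2)).
Proof.
move=> [cf cg fg gf] fx nx.
have : nbhs (f x) (g @^-1` [set y | S y <-> (f y).2 = (0, 0) /\ (b -> 0 <= (f y).1.2)]).
  by apply: cg; rewrite fg.
rewrite fx => /nbhs_ballP[e e0 he].
exists e => // y /box4_lt[h1 h2 h3 h4].
rewrite -{1}(fg y); have := he (f y); rewrite /= gf fg; apply.
by split; split; rewrite /= -ball_normE /= sub0r normrN.
Qed.

Variables (S : set 'rV[R]_4).

Lemma open_box4 (f : 'rV[R]_4 -> (R * R) * (R * R)) e :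
  continuous f -> open [set y | box4 (f y) < e].
Proof.
move=> cf; rewrite openE => y /= ye; rewrite /interior.
have cF : continuous (fun y => e - box4 (f y)).
  have cb : continuous (fun y => box4 (f y)) := cts_comp cts_box4 cf.
  by cts.
have := @near_gt0 _ _ _ y cF; rewrite subr_gt0 => /(_ ye).
by apply: filterS => z; rewrite subr_gt0.
Qed.

Section Unbounded.
Variable e : R.
Hypothesis e0 : 0 < e.

(** Inverse to [shrink]: a sign-preserving homeomorphism from the interval (-e, e) onto the line,
    since manifold charts must be onto the plane or the half plane. *)
Definition stretch (t : R) := t / (e - `|t|).
Definition shrink (t : R) := e * t / (1 + `|t|).

Lemma cts_shrink (T : topologicalType) (f : T -> R) :
  continuous f -> continuous (fun x => shrink (f x)).
Proof.
move=> cf; rewrite /shrink; apply: ctsM; first by cts.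
apply: ctsV; last by cts.
by move=> x; rewrite gt_eqF // ltr_pwDl.
Qed.

Lemma cts_stretch (T : topologicalType) (f : T -> R) x :
  continuous f -> `|f x| < e -> {for x, continuous (fun x => stretch (f x))}.
Proof.
move=> cf fx; rewrite /stretch; apply: continuousM; first exact: cf.
apply: continuousV; first by rewrite gt_eqF // subr_gt0.
have c : continuous (fun x => e - `|f x|) by cts.
exact: c.
Qed.

Lemma shrink_lt t : `|shrink t| < e.
Proof.
have t0 : 0 < 1 + `|t| by rewrite ltr_pwDl.
rewrite /shrink normrM normfV normrM !(gtr0_norm e0) (gtr0_norm t0).
by rewrite ltr_pdivrMr // mulrDr mulr1 ltrDr.
Qed.

Lemma shrinkK t : stretch (shrink t) = t.
Proof.
have t0 : 0 < 1 + `|t| by rewrite ltr_pwDl.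
rewrite /stretch {2}/shrink normrM normfV normrM !(gtr0_norm e0) (gtr0_norm t0).
rewrite /shrink; move: (`|t|) t0 => a t0; field.
by rewrite mulrDr mulr1 addrK !gt_eqF.
Qed.

Lemma stretchK t : `|t| < e -> shrink (stretch t) = t.
Proof.
move=> te; have t0 : 0 < e - `|t| by rewrite subr_gt0.
rewrite /shrink {2}/stretch normrM normfV (gtr0_norm t0).
rewrite /stretch; move: (`|t|) t0 => a t0; field.
by rewrite subrK !gt_eqF.
Qed.

Lemma stretch_ge0 t : `|t| < e -> (0 <= stretch t) = (0 <= t).
Proof. by move=> te; rewrite /stretch pmulr_lge0 // invr_gt0 subr_gt0. Qed.

Lemma shrink_ge0 t : (0 <= shrink t) = (0 <= t).
Proof.
have t0 : 0 < 1 + `|t| by rewrite ltr_pwDl.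
by rewrite /shrink pmulr_lge0 ?invr_gt0 // pmulr_rge0.
Qed.

End Unbounded.

Lemma flat_at_mem b x : flat_at b S x -> S x.
Proof.
move=> [f [g [fg fx nx]]]; have [e e0 he] := flat_at_box fg fx nx.
apply/he; first by rewrite fx /box4 /= !normr0 !maxxx.
by rewrite fx.
Qed.

(** The two plane coordinates of the flat chart, stretched from an open box to the plane. The
    condition [b -> ...] treats interior and boundary charts together. *)
Lemma flat_at_chart (b : bool) x : flat_at b S x ->
  exists (U : set 'rV[R]_4) f g,
    [/\ open U, U x, homeomorphism (U `&` S)
        [set u : 'rV[R]_2 | b -> 0 <= u 0 1] f g & f x 0 1 = 0].
Proof.
move=> [f [g [fg fx nx]]]; have [e e0 he] := flat_at_box fg fx nx.
have [cf cg fK gK] := fg.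
pose F y := row2 (stretch e (f y).1.1) (stretch e (f y).1.2).
pose G (u : 'rV[R]_2) := g ((shrink e (u 0 0), shrink e (u 0 1)), (0, 0)).
have Gbox u : box4 (f (G u)) < e.
  by rewrite gK; apply/box4_lt; rewrite /= !normr0; split=> //; exact: shrink_lt.
exists [set y | box4 (f y) < e], F, G; split.
- exact: open_box4.
- by rewrite /= fx /box4 /= !normr0 !maxxx.
- split.
  + apply: continuous_in_subspaceT => y; rewrite inE => -[/= /box4_lt[h1 h2 _ _] _].
    have c1 : continuous (fun y => (f y).1.1) by cts.
    have c2 : continuous (fun y => (f y).1.2) by cts.
    have := cts_row2_at (cts_stretch c1 h1) (cts_stretch c2 h2).
    exact.
  + apply: continuous_subspaceT; apply: (cts_comp cg); apply: cts_pair; last by cts.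
    have cc i : continuous (fun u : 'rV[R]_2 => u 0 i) by exact: coord_continuous.
    by apply: cts_pair; apply: cts_shrink.
  + apply/seteqP; split=> [_ [y [/= ye /(he _ ye)[y2 yb]] <-]|u /= ub] /=.
      move=> /yb; rewrite row2_1 stretch_ge0 //.
      by move/box4_lt : ye => [].
    exists (G u); last first.
      by apply: row2_ext; rewrite ?row2_0 ?row2_1 gK /= shrinkK.
    split; first exact: Gbox.
    apply/he => //; rewrite gK /=; split=> // /ub; by rewrite shrink_ge0.
  + move=> y [/= ye /(he _ ye)[y2 yb]]; rewrite /G row2_0 row2_1.
    move/box4_lt : ye => [h1 h2 _ _].
    by rewrite !stretchK // -y2 -!surjective_pairing fK.
  + by move=> u ub; apply: row2_ext; rewrite ?row2_0 ?row2_1 gK /= shrinkK.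
- by rewrite /F fx row2_1 /stretch mul0r.
Qed.

Lemma flat_at_interior x : flat_at false S x -> manifold_interior S x.
Proof.
move=> Sx; split; first exact: flat_at_mem Sx.
have [U [f [g [Uo Ux h _]]]] := flat_at_chart Sx; exists U, f, g; split=> //.
by rewrite (_ : [set: _] = [set u : 'rV[R]_2 | false -> 0 <= u 0 1]) //; apply/seteqP; split.
Qed.

Lemma flat_at_boundary x : flat_at true S x -> manifold_boundary S x.
Proof.
move=> Sx; split; first exact: flat_at_mem Sx.
have [U [f [g [Uo Ux h fx]]]] := flat_at_chart Sx; exists U, f, g; split=> //.
rewrite (_ : half_plane (R:=R) = [set u : 'rV[R]_2 | true -> 0 <= u 0 1]) //.
by apply/seteqP; split=> u /=; [move=> h0 _|exact].
Qed.

Lemma flat_at_polydisk (b : bool) x : flat_at b S x ->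
  exists N (f : 'rV[R]_4 -> 'rV[R]_2 * 'rV[R]_2) g,
     [/\ nbhs x N, homeomorphism N (@disk R `*` @cube R 2) f g,
         f @` (N `&` S) =
           (@disk R `&` [set u : 'rV[R]_2 | b -> 0 <= u 0 1]) `*` [set 0]
       & (f x).1 0 1 = 0].
Proof.
move=> [f [g [fg fx nx]]]; have [e e0 he] := flat_at_box fg fx nx.
have [cf cg fK gK] := fg.
(* Half the size of the box: the closed disk and cube, scaled by [r], stay strictly inside the
   region where [S] is known. *)
pose r := e / 2; have r0 : 0 < r by rewrite divr_gt0.
have rne : r != 0 by rewrite gt_eqF.
have re : r < e by rewrite /r; lra.
pose F y := (row2 ((f y).1.1 / r) ((f y).1.2 / r), row2 ((f y).2.1 / r) ((f y).2.2 / r)).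
pose G (u : 'rV[R]_2 * 'rV[R]_2) :=
  g ((r * u.1 0 0, r * u.1 0 1), (r * u.2 0 0, r * u.2 0 1)).
have FG u : F (G u) = u.
  rewrite /F /G gK /= !(mulrC r) !mulfK //.
  by case: u => u v /=; congr pair; apply: row2_ext; rewrite ?row2_0 ?row2_1.
have GF y : G (F y) = y.
  rewrite /G /F /= !row2_0 !row2_1 !(mulrC r) !divfK //.
  by rewrite -!surjective_pairing fK.
pose D := @disk R `*` @cube R 2.
have cF : continuous F by apply: cts_pair; apply: cts_row2; cts.
have cG : continuous G.
  apply: (cts_comp cg).
  have cc i : continuous (fun u : 'rV[R]_2 * 'rV[R]_2 => u.1 0 i) by cts.
  have cd i : continuous (fun u : 'rV[R]_2 * 'rV[R]_2 => u.2 0 i) by cts.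
  by cts.
have Dsmall u : D u -> box4 (f (G u)) < e.
  case: u => u v [/= uD vC]; rewrite gK; apply/box4_lt; rewrite /=.
  have s t : `|t| <= 1 -> `|r * t| < e.
    move=> t1; rewrite normrM (gtr0_norm r0); apply: le_lt_trans re.
    by rewrite ler_piMr // ltW.
  have sqr1 (t : R) : t ^+ 2 <= 1 -> `|t| <= 1.
    by move=> t2; rewrite ler_norml; apply/andP; split; nra.
  split; apply: s.
  - by apply: sqr1; move: uD; rewrite /disk /=; have := sqr_ge0 (u 0 1); lra.
  - by apply: sqr1; move: uD; rewrite /disk /=; have := sqr_ge0 (u 0 0); lra.
  - by rewrite ler_norml; exact: vC.
  - by rewrite ler_norml; exact: vC.
exists (F @^-1` D), F, G; split.
- have : \forall y \near x, box4 (f y) < r / 2.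
    have o : open [set y | box4 (f y) < r / 2] by exact: open_box4.
    apply: (open_nbhs_nbhs (conj o _)).
    by rewrite /= fx /box4 /= !normr0 !maxxx divr_gt0.
  apply: filterS => y /box4_lt[h1 h2 h3 h4].
  have s t : `|t| < r / 2 -> `|t / r| <= 1 / 2.
    move=> t1; rewrite normrM normfV (gtr0_norm r0) ler_pdivrMr //.
    by rewrite mulrC mulrA mulr1 ltW.
  split=> /=.
    rewrite /disk /= row2_0 row2_1.
    have := s _ h1; have := s _ h2; rewrite !ler_norml => /andP[? ?] /andP[? ?].
    by nra.
  move=> j; have [->|->] : j = 0 \/ j = 1.
      by case: j => [[|[|//]] ?]; [left|right]; exact/val_inj.
    by rewrite row2_0 -ler_norml; apply: le_trans (s _ h3) _; lra.
  by rewrite row2_1 -ler_norml; apply: le_trans (s _ h4) _; lra.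
- split.
  + exact: continuous_subspaceT.
  + exact: continuous_subspaceT.
  + by apply/seteqP; split=> [_ [y yD <-] //|u uD]; exists (G u); rewrite /= FG.
  + by move=> y _; rewrite GF.
  + by move=> u _; rewrite FG.
- apply/seteqP; split=> [_ [y [yD Sy] <-]|[u v] [/= [uD ub] v0]].
    have /he : box4 (f y) < e by rewrite -(GF y); exact: Dsmall.
    move=> /iffLR/(_ Sy)[y2 yb]; move: yD; rewrite /D /F /= => -[yD _].
    split; rewrite /= ?y2 /= ?mul0r.
      split=> // /yb h; by rewrite row2_1 divr_ge0 // ltW.
    by apply: row2_ext; rewrite ?row2_0 ?row2_1 mxE.
  have uvD : D (u, v).
    by split=> //= j; rewrite v0 mxE; apply/andP; split; lra.
  exists (G (u, v)); last by rewrite FG.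
  split; first by rewrite /= FG.
  apply/he; first exact: Dsmall.
  rewrite gK /= v0 !mxE mulr0; split=> // /ub h; by rewrite mulr_ge0 // ltW.
- by rewrite /F fx /= row2_1 mul0r.
Qed.

(** Flat charts show which points are interior or boundary points; that no point is both, which
    makes the boundary equal to [P] and local flatness checkable pointwise, is
    [interior_boundary_disjoint]. *)
Lemma surface_of_charts (P : set 'rV[R]_4) : compact S ->
  (forall x, P x -> flat_at true S x) ->
  (forall x, S x -> ~ P x -> flat_at false S x) ->
  [/\ compact_surface S, manifold_boundary S = P & locally_flat S].
Proof.
move=> cS fP fS.
have bP : manifold_boundary S = P.
  apply/seteqP; split=> x; last by move=> /fP/flat_at_boundary.
  move=> bx; apply: contrapT => nPx; have Sx : S x by case: bx.
  exact: interior_boundary_disjoint (flat_at_interior (fS _ Sx nPx)) bx.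
split=> //; first split=> // x Sx.
  have [Px|nPx] := pselect (P x); first by right; exact/flat_at_boundary/fP.
  by left; exact/flat_at_interior/fS.
split=> x.
  move=> ix; have Sx : S x by case: ix.
  have nPx : ~ P x.
    by rewrite -bP => bx; exact: interior_boundary_disjoint ix bx.
  have [N [f [g [nN h e _]]]] := flat_at_polydisk (fS _ Sx nPx).
  exists N, f, g; split=> //; rewrite e; congr (_ `*` _).
  by apply/seteqP; split=> u //= [].
rewrite bP => /fP/flat_at_polydisk[N [f [g [nN h e fx]]]].
exists N, f, g; split=> //; rewrite e; congr (_ `*` _).
by apply/seteqP; split=> u /= [uD uH]; split=> //; exact: uH.
Qed.

End FlatCharts.

(** * Simplicial complexes from lists of triangles *)

Section TriangleLists.
Variables (R : realType) (d : nat).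
Local Notation V := 'rV[R]_d.
Implicit Types (t : V * V * V) (v : V).

Definition vertices3 t : seq V := [:: t.1.1; t.1.2; t.2].

Definition combination t (a b c : R) : V := a *: t.1.1 + b *: t.1.2 + c *: t.2.

Definition tri_hull t : set V := [set x | exists a b c,
  [/\ 0 <= a, 0 <= b, 0 <= c, a + b + c = 1 & x = combination t a b c]].

Definition weight t (a b c : R) v : R :=
  a * (v == t.1.1)%:R + b * (v == t.1.2)%:R + c * (v == t.2)%:R.

Lemma weight_vertices t a b c : uniq (vertices3 t) ->
  [/\ weight t a b c t.1.1 = a, weight t a b c t.1.2 = b & weight t a b c t.2 = c].
Proof.
rewrite /= !inE !andbT negb_or => /andP[/andP[n12 n13] n23].
rewrite /weight !eqxx (eq_sym t.1.2) (eq_sym t.2) (eq_sym t.2 t.1.2).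
by rewrite (negbTE n12) (negbTE n13) (negbTE n23) /= !mulr0 !mulr1 !addr0 !add0r.
Qed.

Lemma weight_out t a b c v : v \notin vertices3 t -> weight t a b c v = 0.
Proof.
rewrite !inE !negb_or /weight => /and3P[/negbTE-> /negbTE-> /negbTE->].
by rewrite !mulr0 !addr0.
Qed.

Lemma weight_ge0 t a b c v : 0 <= a -> 0 <= b -> 0 <= c -> 0 <= weight t a b c v.
Proof. by move=> *; rewrite !addr_ge0 ?mulr_ge0. Qed.

Lemma cts_combination (T : topologicalType) t (f g h : T -> R) :
  continuous f -> continuous g -> continuous h ->
  continuous (fun q => combination t (f q) (g q) (h q)).
Proof.
move=> cf cg ch.
have e : (fun q => combination t (f q) (g q) (h q)) = (fun q => \matrix_(i, j)
    (f q * t.1.1 i j + g q * t.1.2 i j + h q * t.2 i j)).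
  by apply/funext => x; apply/matrixP => i j; rewrite !mxE.
by rewrite e; apply: cts_mx => i j; cts.
Qed.

(** The triangle is the image of the unit square under a map that collapses one side to the first
    vertex. *)
Lemma compact_tri_hull t : compact (tri_hull t).
Proof.
have -> : tri_hull t = (fun q : R * R =>
    combination t (1 - q.1) (q.1 * (1 - q.2)) (q.1 * q.2)) @`
    (`[0, 1]%classic `*` `[0, 1]%classic).
  apply/seteqP; split=> x /=.
    move=> [a [b [c [a0 b0 c0 s ->]]]].
    have [bc|bc] := eqVneq (b + c) 0.
      exists (0, 0); rewrite /= ?in_itv /= ?lexx ?ler01 //.
      by congr combination; lra.
    exists (b + c, c / (b + c)); rewrite /= ?in_itv /=.
      have bc0 : 0 < b + c by rewrite lt_neqAle eq_sym bc addr_ge0.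
      split; apply/andP; split; rewrite ?divr_ge0 ?ler_pdivrMr //; lra.
    by congr combination; [lra|field|field].
  move=> [[u v] /= []]; rewrite !in_itv /= => /andP[u0 u1] /andP[v0 v1] <-.
  exists (1 - u), (u * (1 - v)), (u * v); split=> //; try ring.
  - lra.
  - by rewrite mulr_ge0 // subr_ge0.
  - by rewrite mulr_ge0.
apply: continuous_compact; last by apply: compact_setX; exact: segment_compact.
apply: continuous_subspaceT.
by apply: cts_combination; cts.
Qed.

Definition tri_union (T : seq (V * V * V)) : set V :=
  [set x | exists2 t, t \in T & tri_hull t x].

Lemma compact_tri_union T : compact (tri_union T).
Proof.
elim: T => [|t T IH].
  rewrite (_ : tri_union _ = set0); first exact: compact0.
  by apply/seteqP; split=> x // -[].
rewrite (_ : tri_union _ = tri_hull t `|` tri_union T).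
  by apply: compactU => //; exact: compact_tri_hull.
apply/seteqP; split=> x.
  move=> [s]; rewrite inE => /orP[/eqP->|sT] h; first by left.
  by right; exists s.
case=> [h|[s sT h]]; first by exists t; rewrite ?mem_head.
by exists s; rewrite // inE sT orbT.
Qed.

Lemma hull_sub m (p : 'I_m -> V) (A B : {set 'I_m}) : A \subset B ->
  hull p A `<=` hull p B.
Proof.
move=> AB x [c [c0 c1 ->]].
have ext (W : zmodType) (F : 'I_m -> R -> W) : (forall i, F i 0 = 0) ->
    \sum_(i in B) F i (if i \in A then c i else 0) = \sum_(i in A) F i (c i).
  move=> F0; rewrite (big_setID A) /= [X in _ + X]big1 ?addr0.
    by rewrite (finset.setIidPr AB); apply: eq_bigr => i ->.
  by move=> i; rewrite inE => /andP[/negbTE-> _].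
exists (fun i => if i \in A then c i else 0); split=> [i _||].
- by case: ifP => // /c0.
- by rewrite -c1; exact: (ext _ (fun _ r => r)).
- by rewrite (ext _ (fun i r => r *: p i)) // => i; rewrite scale0r.
Qed.

(* The second hypothesis says that the geometric realization is injective. *)
Lemma complex_of_list (T : seq (V * V * V)) :
  (forall t, t \in T -> uniq (vertices3 t)) ->
  (forall t t' a b c a' b' c', t \in T -> t' \in T ->
    0 <= a -> 0 <= b -> 0 <= c -> a + b + c = 1 ->
    0 <= a' -> 0 <= b' -> 0 <= c' -> a' + b' + c' = 1 ->
    combination t a b c = combination t' a' b' c' ->
    weight t a b c =1 weight t' a' b' c') ->
  exists m (p : 'I_m -> V) (F : {set {set 'I_m}}),
    [/\ triangle_complex p F, carrier p F = tri_union T & (#|F| <= size T)%N].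
Proof.
move=> Tuniq Tinj.
pose L := undup (flatten [seq vertices3 t | t <- T]).
have Lmem t v : t \in T -> v \in vertices3 t -> v \in L.
  by move=> tT vt; rewrite mem_undup; apply/flatten_mapP; exists t.
pose p (i : 'I_(size L)) := nth 0 L i.
have pinj : injective p.
  move=> i j /eqP; rewrite nth_uniq ?undup_uniq // => /eqP; exact: val_inj.
have pidx v : v \in L -> exists i, p i = v.
  by move=> vL; rewrite -index_mem in vL; exists (Ordinal vL); rewrite /p nth_index // -index_mem.
pose S t : {set 'I_(size L)} := [set i | p i \in vertices3 t]%SET.
have Ssum t : t \in T -> exists i j k,
    [/\ p i = t.1.1, p j = t.1.2, p k = t.2, S t = [set i; j; k]%SET &
      forall (W : zmodType) (f : 'I_(size L) -> W),
        \sum_(l in S t) f l = f i + f j + f k].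
  move=> tT.
  have [i pi] : exists i, p i = t.1.1 by apply: pidx; apply: (Lmem t); rewrite ?inE ?eqxx.
  have [j pj] : exists i, p i = t.1.2 by apply: pidx; apply: (Lmem t); rewrite ?inE ?eqxx ?orbT.
  have [k pk] : exists i, p i = t.2 by apply: pidx; apply: (Lmem t); rewrite ?inE ?eqxx ?orbT.
  exists i, j, k.
  have e : S t = [set i; j; k]%SET.
    apply/setP => l; rewrite !inE -pi -pj -pk !(inj_eq pinj).
    by rewrite orbA.
  have := Tuniq _ tT; rewrite /= !inE !andbT negb_or -pi -pj -pk !(inj_eq pinj).
  move=> /andP[/andP[ij ik] jk].
  split=> // W f; rewrite e finset.setUC big_setU1 /=.
    by rewrite big_setU1 /= ?big_set1 1?addrC // inE.
  by rewrite !inE negb_or eq_sym ik eq_sym.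
pose F : {set {set 'I_(size L)}} := [set s | s \in [seq S t | t <- T]]%SET.
have FP s : s \in F -> exists2 t, t \in T & s = S t.
  by rewrite inE => /mapP.
have SF t : t \in T -> S t \in F by move=> tT; rewrite inE map_f.
have hullS t : t \in T -> hull p (S t) = tri_hull t.
  move=> tT; have [i [j [k [pi pj pk Se sum]]]] := Ssum _ tT.
  apply/seteqP; split=> x.
    move=> [c [c0]]; rewrite !sum => c1 ->.
    exists (c i), (c j), (c k); rewrite /combination -pi -pj -pk.
    by split=> //; apply: c0; rewrite Se !inE eqxx ?orbT.
  move=> [a [b [c [a0 b0 c0 s ->]]]].
  have [wa wb wc] := weight_vertices a b c (Tuniq _ tT).
  exists (fun l => weight t a b c (p l)); split=> [l _||].
  - exact: weight_ge0.
  - by rewrite sum pi pj pk wa wb wc.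
  - by rewrite sum pi pj pk wa wb wc.
exists (size L), p, F; split.
- split=> [s /FP[t tT ->]|s /FP[t tT ->]|s s' /FP[t tT ->] /FP[t' tT' ->]].
  + have [i [j [k [pi pj pk Se sum]]]] := Ssum _ tT.
    have := sum int (fun=> 1); rewrite sumr_const (_ : 1 + 1 + 1 = 3%:R) //.
    by move=> /eqP; rewrite eqr_nat => /eqP.
  + have [i [j [k [pi pj pk Se sum]]]] := Ssum _ tT.
    move=> c; rewrite !sum pi pj pk => c0 cp.
    (* A linear dependency, divided by [3 * K], moves the barycentre with all coordinates still
       non-negative. The moved coordinates give the same point, so by injectivity the dependency is
       trivial. *)
    pose K := `|c i| + `|c j| + `|c k| + 1.
    have K0 : 0 < K by rewrite ltr_wpDl // !addr_ge0.
    have K0' : K != 0 by rewrite gt_eqF.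
    have third l : `|c l| <= K -> 0 <= 3^-1 + c l / (3 * K).
      move=> cK; have : `|c l / (3 * K)| <= 3^-1.
        have K3 : 0 < 3 * K by rewrite mulr_gt0.
        by rewrite normrM normfV (gtr0_norm K3) ler_pdivrMr // mulKf.
      by rewrite ler_norml => /andP[h _]; lra.
    have w : weight t (3^-1 + c i / (3 * K)) (3^-1 + c j / (3 * K)) (3^-1 + c k / (3 * K))
         =1 weight t 3^-1 3^-1 3^-1.
      apply: Tinj => //; rewrite ?invr_ge0 //.
      * apply: third; rewrite /K; have := normr_ge0 (c j); have := normr_ge0 (c k); lra.
      * apply: third; rewrite /K; have := normr_ge0 (c i); have := normr_ge0 (c k); lra.
      * apply: third; rewrite /K; have := normr_ge0 (c j); have := normr_ge0 (c i); lra.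
      * transitivity (1 + (c i + c j + c k) / (3 * K)); first by field.
        by rewrite c0 mul0r addr0.
      * by field.
      * transitivity (3^-1 *: t.1.1 + 3^-1 *: t.1.2 + 3^-1 *: t.2 +
           (3 * K)^-1 *: (c i *: t.1.1 + c j *: t.1.2 + c k *: t.2)).
          by apply/rowP => l; rewrite !mxE; field.
        by rewrite cp scaler0 addr0.
    have [wa wb wc] := weight_vertices (3^-1 + c i / (3 * K)) (3^-1 + c j / (3 * K))
       (3^-1 + c k / (3 * K)) (Tuniq _ tT).
    have [va vb vc] := weight_vertices 3^-1 3^-1 3^-1 (Tuniq _ tT).
    have z l : 3^-1 + c l / (3 * K) = 3^-1 -> c l = 0.
      move=> e; have : c l / (3 * K) = 0 by lra.
      by move=> h; rewrite -(divfK (_ : 3 * K != 0) (c l)) ?h ?mul0r // mulf_neq0.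
    move=> l; rewrite Se !inE => /orP[/orP[]|] /eqP ->; apply: z.
    * by rewrite -wa w va.
    * by rewrite -wb w vb.
    * by rewrite -wc w vc.
  + apply/seteqP; split=> x; last first.
      by move=> h; split; apply: hull_sub h; rewrite ?subsetIl ?subsetIr.
    rewrite !hullS // => -[[a [b [c [a0 b0 c0 abc xe]]]] [a' [b' [c' [a0' b0' c0' abc' xe']]]]].
    (* A common point has the same masses in both triangles, so vertices of [t] outside [t'] carry
       none and the common vertices suffice. *)
    have w : weight t a b c =1 weight t' a' b' c'.
      by apply: Tinj => //; rewrite -xe -xe'.
    have [i [j [k [pi pj pk Se sum]]]] := Ssum _ tT.
    have [wa wb wc] := weight_vertices a b c (Tuniq _ tT).
    pose f l := weight t a b c (p l).
    have sumI (W : zmodType) (F0 : 'I_(size L) -> R -> W) : (forall i, F0 i 0 = 0) ->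
        \sum_(l in S t :&: S t') F0 l (f l) = \sum_(l in S t) F0 l (f l).
      move=> F00; rewrite [RHS](big_setID (S t')) /= [X in _ + X]big1 ?addr0 //.
      move=> l; rewrite inE => /andP[lt' _].
      by rewrite /f w weight_out //; move: lt'; rewrite inE.
    exists f; split.
    * by move=> l _; exact: weight_ge0.
    * rewrite (sumI _ (fun _ r => r)) //.
      by rewrite sum /f pi pj pk wa wb wc.
    * rewrite (sumI _ (fun l r => r *: p l)); last by move=> l; rewrite scale0r.
      by rewrite sum /f pi pj pk wa wb wc.
- apply/seteqP; split=> x.
    by move=> [s /= /FP[t tT ->]]; rewrite hullS // => h; exists t.
  by move=> [t tT h]; exists (S t); rewrite /= ?SF // hullS.
- by rewrite cardsE (leq_trans (card_size _)) // size_map.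
Qed.

End TriangleLists.

(** * Generic projections to the plane *)

Section Genericity.
Variable R : realType.

(** Polynomiality along lines stands in for multivariate polynomials: it is closed under the ring
    operations and is all that avoiding finitely many zero sets takes. *)
Definition poly_on_lines (V : lmodType R) (F : V -> R) :=
  forall x y, exists p : {poly R}, forall t, F (x + t *: y) = p.[t].

Lemma poly_on_linesD (V : lmodType R) (F G : V -> R) :
  poly_on_lines F -> poly_on_lines G -> poly_on_lines (fun x => F x + G x).
Proof.
move=> hF hG x y; have [p hp] := hF x y; have [q hq] := hG x y.
by exists (p + q) => t; rewrite hornerD hp hq.
Qed.

Lemma poly_on_linesN (V : lmodType R) (F : V -> R) :
  poly_on_lines F -> poly_on_lines (fun x => - F x).
Proof.
by move=> hF x y; have [p hp] := hF x y; exists (- p) => t; rewrite hornerN hp.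
Qed.

Lemma poly_on_linesM (V : lmodType R) (F G : V -> R) :
  poly_on_lines F -> poly_on_lines G -> poly_on_lines (fun x => F x * G x).
Proof.
move=> hF hG x y; have [p hp] := hF x y; have [q hq] := hG x y.
by exists (p * q) => t; rewrite hornerM hp hq.
Qed.

Lemma poly_nonroot (p : {poly R}) : p != 0 -> exists t, p.[t] != 0.
Proof.
move=> p0; apply: contrapT => none.
pose rs : seq R := [seq i%:R | i <- iota 0 (size p)].
have h1 : all (root p) rs.
  by apply/allP => t _; rewrite /root; apply: contrapT => /negP nt; apply: none; exists t.
have h2 : uniq rs.
  by rewrite map_inj_uniq ?iota_uniq // => i j /eqP; rewrite eqr_nat => /eqP.
by have := max_poly_roots p0 h1 h2; rewrite size_map size_iota ltnn.
Qed.

(** Induction on the conditions: on the line from a point good for the old ones to a point good for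
    the new one, each condition is a non-zero polynomial, and so is their product. *)
Lemma generic_point (V : lmodType R) (I : finType) (F : I -> V -> R) :
  (forall i, poly_on_lines (F i)) -> (forall i, exists x, F i x != 0) ->
  exists x, forall i, F i x != 0.
Proof.
move=> Fp F0; suff : exists x, forall i, i \in enum I -> F i x != 0.
  by move=> [x hx]; exists x => i; apply: hx; rewrite mem_enum.
elim: (enum I) => [|j s [x hx]]; first by exists 0.
have [y hy] := F0 j.
have : exists2 p : {poly R}, p != 0 &
    forall t, p.[t] != 0 -> forall i, i \in s -> F i (x + t *: (y - x)) != 0.
  elim: s hx => [|k s IH] hx; first by exists 1; rewrite ?oner_neq0.
  have [p p0 hp] := IH (fun i si => hx i (mem_behead (s := k :: s) si)).
  have [q hq] := Fp k x (y - x).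
  exists (p * q).
    rewrite mulf_neq0 //; apply/eqP => q0.
    have := hx k (mem_head _ _).
    by have := hq 0; rewrite scale0r addr0 => ->; rewrite q0 horner0 eqxx.
  move=> t; rewrite hornerM mulf_eq0 negb_or => /andP[pt qt] i.
  by rewrite inE => /orP[/eqP->|]; [rewrite hq|exact: hp].
move=> [p p0 hp]; have [q hq] := Fp j x (y - x).
have q0 : q != 0.
  apply/eqP => q0; move: hy; have := hq 1.
  by rewrite scale1r subrKC => ->; rewrite q0 horner0 eqxx.
have [t] := poly_nonroot (mulf_neq0 p0 q0).
rewrite hornerM mulf_eq0 negb_or => /andP[pt qt].
exists (x + t *: (y - x)) => i; rewrite inE => /orP[/eqP->|]; last exact: hp.
by rewrite hq.
Qed.

Local Notation V4 := 'rV[R]_4.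

Definition pr (u : V4) (c : 'cV[R]_4) : R := (u *m c) 0 0.

Lemma prD u w c : pr (u + w) c = pr u c + pr w c.
Proof. by rewrite /pr mulmxDl mxE. Qed.
Lemma prN u c : pr (- u) c = - pr u c.
Proof. by rewrite /pr mulNmx mxE. Qed.
Lemma prZ a u c : pr (a *: u) c = a * pr u c.
Proof. by rewrite /pr -scalemxAl mxE. Qed.
Lemma prDr u c d : pr u (c + d) = pr u c + pr u d.
Proof. by rewrite /pr mulmxDr mxE. Qed.
Lemma prZr a u c : pr u (a *: c) = a * pr u c.
Proof. by rewrite /pr -scalemxAr mxE. Qed.

Lemma pr_delta l c : pr (delta_mx 0 l) c = c l 0.
Proof. by rewrite /pr -rowE mxE. Qed.

Definition indep2 (u w : V4) := forall a b, a *: u + b *: w = 0 -> a = 0 /\ b = 0.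
Definition indep3 (u v w : V4) :=
  forall a b c, a *: u + b *: v + c *: w = 0 -> [/\ a = 0, b = 0 & c = 0].

Lemma functional_of_rows k (B : 'M[R]_(k, 4)) : row_free B ->
  forall T : 'cV[R]_k, exists c, forall i, pr (row i B) c = T i 0.
Proof.
move=> /row_freeP[C BC] T; exists (C *m T) => i.
by rewrite /pr -row_mul mulmxA BC mul1mx mxE.
Qed.

Lemma functional2 u w : indep2 u w -> forall a b, exists c, pr u c = a /\ pr w c = b.
Proof.
move=> uw a b; pose B : 'M[R]_(2, 4) := \matrix_i (nth 0 [:: u; w] i).
have Bf : row_free B.
  apply: inj_row_free => x; rewrite mulmx_sum_row !big_ord_recl big_ord0 addr0 !rowK /=.
  move=> /uw[x0 x1]; apply/rowP => i; rewrite mxE.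
  by case: i => [[|[|//]] h]; [rewrite -x0|rewrite -x1]; congr (x _ _); exact/val_inj.
have [c hc] := functional_of_rows Bf (\col_i (nth 0 [:: a; b] i)).
exists c; have := hc 0; have := hc 1; rewrite !rowK !mxE /=.
by move=> -> ->.
Qed.

Lemma functional3 u v w : indep3 u v w ->
  forall a b d, exists c, [/\ pr u c = a, pr v c = b & pr w c = d].
Proof.
move=> uvw a b d; pose B : 'M[R]_(3, 4) := \matrix_i (nth 0 [:: u; v; w] i).
have Bf : row_free B.
  apply: inj_row_free => x; rewrite mulmx_sum_row !big_ord_recl big_ord0 addr0 !rowK /=.
  rewrite addrA => /uvw[x0 x1 x2]; apply/rowP => i; rewrite mxE.
  by case: i => [[|[|[|//]]] h]; [rewrite -x0|rewrite -x1|rewrite -x2]; congr (x _ _); exact/val_inj.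
have [c hc] := functional_of_rows Bf (\col_i (nth 0 [:: a; b; d] i)).
exists c; have := hc 0; have := hc 1; have := hc (inord 2).
by rewrite !rowK !mxE /= inordK //= => -> -> ->.
Qed.

Local Notation C4 := ('cV[R]_4 * 'cV[R]_4)%type.

Definition det2 (u w : V4) (q : C4) : R := pr u q.1 * pr w q.2 - pr u q.2 * pr w q.1.

(** In the plane det(f,g) e + det(g,e) f + det(e,f) g = 0, and a point u of the projected line a + R
    e satisfies det(e,u) = det(e,a). Hence this expression vanishes whenever the three projected
    lines have a common point. *)
Definition concur (a e b f c g : V4) (q : C4) : R :=
  det2 f g q * det2 e a q + det2 g e q * det2 f b q + det2 e f q * det2 g c q.

Lemma poly_on_lines_pr1 u : poly_on_lines (fun q : C4 => pr u q.1).
Proof.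
move=> x y; exists ((pr u x.1)%:P + (pr u y.1)%:P * 'X) => t.
by rewrite hornerD hornerM !hornerC hornerX /= prDr prZr; ring.
Qed.

Lemma poly_on_lines_pr2 u : poly_on_lines (fun q : C4 => pr u q.2).
Proof.
move=> x y; exists ((pr u x.2)%:P + (pr u y.2)%:P * 'X) => t.
by rewrite hornerD hornerM !hornerC hornerX /= prDr prZr; ring.
Qed.

Lemma poly_on_lines_det2 u w : poly_on_lines (det2 u w).
Proof.
have h1 := poly_on_linesM (poly_on_lines_pr1 u) (poly_on_lines_pr2 w).
have h2 := poly_on_linesM (poly_on_lines_pr2 u) (poly_on_lines_pr1 w).
exact: poly_on_linesD h1 (poly_on_linesN h2).
Qed.

Lemma poly_on_lines_concur a e b f c g : poly_on_lines (concur a e b f c g).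
Proof.
by do 2?apply: poly_on_linesD; apply: poly_on_linesM; exact: poly_on_lines_det2.
Qed.

Lemma det2_neq0 u w : indep2 u w -> exists q, det2 u w q != 0.
Proof.
move=> uw; have [c [c1 c2]] := functional2 uw 1 0; have [d [d1 d2]] := functional2 uw 0 1.
by exists (c, d); rewrite /det2 /= c1 c2 d1 d2 mulr0 subr0 mulr1 oner_neq0.
Qed.

(* The projections of three pairwise skew lines are concurrent only for special
   projections: if the directions are independent, make the first two lines
   parallel; otherwise normalize the common plane of the directions. *)
Lemma concur_neq0 a e b f c g :
  indep2 e f -> indep2 e g -> indep2 f g ->
  indep3 (a - b) e f -> indep3 (a - c) e g -> indep3 (b - c) f g ->
  exists q, concur a e b f c g q != 0.
Proof.
move=> ef eg fg sab sac sbc.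
have [efg|nefg] := pselect (indep3 e f g).
  have [p [pe pf pg]] := functional3 efg 0 0 1.
  have [p' [p'd p'e p'f]] := functional3 sab 1 0 0.
  (* One of [p], [p'] and [p + p'] vanishes on [e] and [f] but neither on [g] nor on [a - b]. *)
  have [h [he hf hg hd]] : exists h, [/\ pr e h = 0, pr f h = 0, pr g h != 0 & pr (a - b) h != 0].
    have [pd|pd] := eqVneq (pr (a - b) p) 0; last by exists p; rewrite pg oner_neq0.
    have [p'g|p'g] := eqVneq (pr g p') 0; last by exists p'; rewrite p'd oner_neq0.
    by exists (p + p'); rewrite !prDr pe pf pg p'd p'e p'f pd p'g !addr0 add0r oner_neq0.
  have [r [re rf rg]] := functional3 efg 1 1 0.
  exists (r, h); rewrite /concur /det2 /= he hf re rf rg.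
  move: hd; rewrite prD prN => hd.
  rewrite (_ : _ + _ = pr g h * (pr a h - pr b h)); last by ring.
  by rewrite mulf_neq0.
have [x [y [z [xyz nz]]]] : exists x y z, x *: e + y *: f + z *: g = 0 /\
    ~ [/\ x = 0, y = 0 & z = 0].
  apply: contrapT => none; apply: nefg => x y z h; apply: contrapT => nz.
  by apply: none; exists x, y, z.
have z0 : z != 0.
  apply/eqP => z0; apply: nz; move: xyz; rewrite z0 scale0r addr0 => /ef[-> ->].
  by split.
have x0 : x != 0.
  apply/eqP => x0; move: xyz; rewrite x0 scale0r add0r => /fg[_ /eqP].
  by rewrite (negbTE z0).
have y0 : y != 0.
  apply/eqP => y0; move: xyz; rewrite y0 scale0r addr0 => /eg[_ /eqP].
  by rewrite (negbTE z0).
pose al := - x / z; pose be := - y / z.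
have ge : g = al *: e + be *: f.
  have : z^-1 *: (x *: e + y *: f + z *: g) = 0 by rewrite xyz scaler0.
  rewrite !scalerDr !scalerA mulVf // scale1r => h.
  apply/eqP; rewrite -subr_eq0 -h; apply/eqP; apply/rowP => l; rewrite !mxE /al /be.
  by field.
have al0 : al != 0 by rewrite mulf_neq0 ?oppr_eq0 ?invr_eq0.
have be0 : be != 0 by rewrite mulf_neq0 ?oppr_eq0 ?invr_eq0.
have sca : indep3 (c - a) e f.
  move=> k l m h; have := sac (- k) (l - m * al / be) (m / be); case.
    rewrite -h ge; apply/rowP => o; rewrite !mxE; field; exact: be0.
  move=> /eqP; rewrite oppr_eq0 => /eqP -> hl /eqP.
  rewrite mulf_eq0 invr_eq0 (negbTE be0) orbF => /eqP m0.
  by move: hl; rewrite m0 !mul0r subr0 => ->.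
have scb : indep3 (c - b) e f.
  move=> k l m h; have := sbc (- k) (m - l * be / al) (l / al); case.
    rewrite -h ge; apply/rowP => o; rewrite !mxE; field; exact: al0.
  move=> /eqP; rewrite oppr_eq0 => /eqP -> hl /eqP.
  rewrite mulf_eq0 invr_eq0 (negbTE al0) orbF => /eqP m0.
  by move: hl; rewrite m0 !mul0r subr0 => ->.
(* The directions [e] and [f] become the axes. The point [c] lies on the vertical line through [b]
   and one unit above the horizontal line through [a], so the expression evaluates to [al]. *)
have [q2 [q2c q2e q2f]] := functional3 sca 1 0 1.
have [q1 [q1c q1e q1f]] := functional3 scb 0 1 0.
exists (q1, q2); rewrite /concur /det2 /= ge !prD !prZ q1e q1f q2e q2f.
move: q2c q1c; rewrite !prD !prN => q2c q1c.
rewrite (_ : _ + _ = al); first exact: al0.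
have -> : pr c q2 = 1 + pr a q2 by rewrite -q2c; ring.
have -> : pr c q1 = pr b q1 by rewrite -[RHS]add0r -q1c; ring.
by ring.
Qed.

End Genericity.

(** * A projection generic for the given polygon *)

Section GenericProjection.
Variables (R : realType) (n : nat) (v : 'I_n -> 'rV[R]_4).
Hypothesis v_inj : forall i j (s t : R), 0 <= s < 1 -> 0 <= t < 1 ->
  edge_point v i s = edge_point v j t -> i = j /\ s = t.

Variable e : 'I_n -> 'rV[R]_4.
Hypothesis eE : forall i, e i = v (ordS i) - v i.

Let edgeE i s : edge_point v i s = v i + s *: e i.
Proof. by apply/rowP => l; rewrite eE !mxE; ring. Qed.

Let e_neq0 i : e i != 0.
Proof.
apply/eqP => e0; have := @v_inj i i 0 (1/2); case.
- by rewrite lexx ltr01.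
- by apply/andP; split; lra.
- by rewrite !edgeE e0 !scaler0.
- by move=> _ h; clear e0; lra.
Qed.

Let skew i j := [/\ indep2 (e i) (e j) & indep3 (v i - v j) (e i) (e j)].

Let I : finType := ((unit + 'I_n) + ('I_n * 'I_n + 'I_n * 'I_n) + 'I_n * 'I_n * 'I_n)%type.

Let D01 : ('rV[R]_4 * 'rV[R]_4) := (delta_mx 0 0, delta_mx 0 1).

(** The conditions in order: the projection and the last two coordinates form a coordinate system;
    no edge is vertical; independent edge directions stay independent; a vertex off an edge line
    stays off it; three pairwise skew edge lines do not become concurrent. A condition whose premise
    fails is replaced by the constant 1. *)
Let F (i : I) : 'cV[R]_4 * 'cV[R]_4 -> R :=
  match i with
  | inl (inl (inl _)) => det2 D01.1 D01.2
  | inl (inl (inr i)) => fun q => pr (e i) q.1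
  | inl (inr (inl (i, j))) =>
      if `[< indep2 (e i) (e j) >] then det2 (e i) (e j) else fun=> 1
  | inl (inr (inr (k, j))) =>
      if `[< indep2 (v k - v j) (e j) >] then det2 (v k - v j) (e j) else fun=> 1
  | inr (i, j, k) =>
      if `[< [/\ skew i j, skew i k & skew j k] >]
      then concur (v i) (e i) (v j) (e j) (v k) (e k) else fun=> 1
  end.

Lemma dependent2 (u w : 'rV[R]_4) : w != 0 -> ~ indep2 u w -> exists m, u = m *: w.
Proof.
move=> w0 nuw; apply: contrapT => none; apply: nuw => a b h.
have a0 : a = 0.
  apply: contrapT => /eqP a0; apply: none; exists (- b / a).
  have : a^-1 *: (a *: u + b *: w) = 0 by rewrite h scaler0.
  rewrite scalerDr !scalerA mulVf // scale1r => /eqP; rewrite addr_eq0 => /eqP ->.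
  by rewrite -scaleNr; congr (_ *: _); field.
split=> //; move: h; rewrite a0 scale0r add0r => /eqP.
by rewrite scaler_eq0 (negbTE w0) orbF => /eqP.
Qed.

(** Let d be the difference of two distinct points with equal images. For parallel edges, or if one
    point is a vertex, d joins a vertex to a point of an edge line, which the fourth condition
    forbids; for coplanar non-parallel edges d is a combination of the two directions, which the
    third forbids. So the edge lines are skew, and a further edge through the crossing would violate
    the last condition. *)
Lemma generic_projection : exists q : 'cV[R]_4 * 'cV[R]_4,
  [/\ q.1 0 0 * q.2 1 0 - q.2 0 0 * q.1 1 0 != 0,
      forall i, pr (e i) q.1 != 0 &
      forall i j s t, 0 <= s <= 1 -> 0 <= t <= 1 ->
        edge_point v i s != edge_point v j t ->
        pr (edge_point v i s) q.1 = pr (edge_point v j t) q.1 ->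
        pr (edge_point v i s) q.2 = pr (edge_point v j t) q.2 ->
        [/\ 0 < s < 1, 0 < t < 1, det2 (e i) (e j) q != 0 &
         forall k r, 0 <= r <= 1 ->
           pr (edge_point v i s) q.1 = pr (edge_point v k r) q.1 ->
           pr (edge_point v i s) q.2 = pr (edge_point v k r) q.2 -> k = i \/ k = j]].
Proof.
have Fp i : poly_on_lines (F i).
  have p1 : poly_on_lines (fun=> 1 : R) (V := ('cV[R]_4 * 'cV[R]_4)%type).
    by move=> x y; exists 1 => t; rewrite hornerC.
  case: i => [[[_|i]|[[i j]|[k j]]]|[[i j] k]] /=.
  - exact: poly_on_lines_det2.
  - exact: poly_on_lines_pr1.
  - by case: ifP => _ //; exact: poly_on_lines_det2.
  - by case: ifP => _ //; exact: poly_on_lines_det2.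
  - by case: ifP => _ //; exact: poly_on_lines_concur.
have F0 i : exists q, F i q != 0.
  have p1 : exists q : 'cV[R]_4 * 'cV[R]_4, 1 != 0 :> R by exists 0; exact: oner_neq0.
  case: i => [[[_|i]|[[i j]|[k j]]]|[[i j] k]] /=.
  - apply: det2_neq0 => a b /rowP h; have := h 0; have := h 1; rewrite !mxE /=.
    by rewrite !mulr0 !mulr1 addr0 add0r => -> ->; split.
  - have := e_neq0 i; apply: contraNP => none; apply/eqP/rowP => l; rewrite [RHS]mxE.
    apply: contrapT => /eqP el; apply: none; exists (delta_mx l 0, 0).
    by rewrite /pr /= -colE mxE.
  - by case: ifP => // /asboolP; exact: det2_neq0.
  - by case: ifP => // /asboolP; exact: det2_neq0.
  - case: ifP => // /asboolP[[? ?] [? ?] [? ?]]; exact: concur_neq0.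
have [q hq] := generic_point Fp F0.
have G1 i : pr (e i) q.1 != 0 by exact: (hq (inl (inl (inr i)))).
have G2 i j : indep2 (e i) (e j) -> det2 (e i) (e j) q != 0.
  by move=> ij; have := hq (inl (inr (inl (i, j)))); rewrite /= asboolT.
have G3 k j : indep2 (v k - v j) (e j) -> det2 (v k - v j) (e j) q != 0.
  by move=> ij; have := hq (inl (inr (inr (k, j)))); rewrite /= asboolT.
have G4 i j k : skew i j -> skew i k -> skew j k ->
    concur (v i) (e i) (v j) (e j) (v k) (e k) q != 0.
  by move=> ij ik jk; have := hq (inr (i, j, k)); rewrite /= asboolT.
exists q.
have Vert k j t : pr (v k - (v j + t *: e j)) q.1 = 0 ->
    pr (v k - (v j + t *: e j)) q.2 = 0 -> v k = v j + t *: e j.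
  move=> h1 h2; have [ind|dep] := pselect (indep2 (v k - v j) (e j)).
    have /eqP[] := G3 k j ind; rewrite /det2.
    move: h1 h2; rewrite !(prD, prN, prZ) => h1 h2.
    have -> : pr (v k) q.1 = pr (v j) q.1 + t * pr (e j) q.1 by lra.
    have -> : pr (v k) q.2 = pr (v j) q.2 + t * pr (e j) q.2 by lra.
    by ring.
  have [m hm] := dependent2 (e_neq0 j) dep.
  have := h1; rewrite opprD addrA hm -scaleNr -scalerDl prZ => /eqP.
  rewrite mulf_eq0 (negbTE (G1 j)) orbF subr_eq0 => /eqP mt.
  by rewrite -mt -hm; rewrite subrKC.
have Pair i j s t : edge_point v i s != edge_point v j t ->
    pr (edge_point v i s) q.1 = pr (edge_point v j t) q.1 ->
    pr (edge_point v i s) q.2 = pr (edge_point v j t) q.2 -> skew i j.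
  move=> ne h1 h2.
  pose d := edge_point v i s - edge_point v j t.
  have d1 : pr d q.1 = 0 by rewrite prD prN h1 subrr.
  have d2 : pr d q.2 = 0 by rewrite prD prN h2 subrr.
  have dn : d != 0 by rewrite subr_eq0.
  have dE : d = (v i - v j) + s *: e i - t *: e j.
    by rewrite /d !edgeE; apply/rowP => l; rewrite !mxE; ring.
  have ij : indep2 (e i) (e j).
    apply: contrapT => dep; have [m hm] := dependent2 (e_neq0 j) dep.
    have dE' : d = v i - (v j + (t - s * m) *: e j).
      by rewrite dE hm; apply/rowP => l; rewrite !mxE; ring.
    have := Vert i j (t - s * m); rewrite -dE' => /(_ d1 d2) h.
    by move: dn; rewrite dE' h subrr eqxx.
  split=> // a b c h.
  have [a0|a0] := eqVneq a 0.
    by move: h; rewrite a0 scale0r add0r => /ij[-> ->].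
  have dE' : d = (s - b / a) *: e i + (- t - c / a) *: e j.
    have : v i - v j = - (b / a) *: e i - (c / a) *: e j.
      apply/rowP => l; have := congr1 (fun z : 'rV[R]_4 => z 0 l) h; rewrite !mxE => hl.
      rewrite [RHS](_ : _ = (- (b * e i 0 l) - c * e j 0 l) / a); last by field.
      rewrite -[LHS](mulfK a0); congr (_ / a).
      by move: hl; clear; move: (v i 0 l) (v j 0 l) (e i 0 l) (e j 0 l) => x y z w hl; lra.
    by rewrite dE => ->; apply/rowP => l; rewrite !mxE; ring.
  have /eqP[] := G2 i j ij; rewrite /det2.
  move: d1 d2 dn; rewrite dE'.
  move: (s - b / a) (- t - c / a) => x y; rewrite !prD !prZ => d1 d2 dn.
  have [x0|x0] := eqVneq x 0.
    have y0 : y != 0.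
      by apply: contraNneq dn => y0; rewrite x0 y0 !scale0r addr0.
    have h1' : pr (e j) q.1 = 0.
      apply/eqP; rewrite -(mulrI_eq0 _ (mulfI y0)) -d1 x0; apply/eqP; ring.
    have h2' : pr (e j) q.2 = 0.
      apply/eqP; rewrite -(mulrI_eq0 _ (mulfI y0)) -d2 x0; apply/eqP; ring.
    by rewrite h1' h2' !mulr0 subrr.
  apply: (mulfI x0); rewrite mulr0 mulrBr !mulrA.
  have -> : x * pr (e i) q.1 = - (y * pr (e j) q.1) by lra.
  have -> : x * pr (e i) q.2 = - (y * pr (e j) q.2) by lra.
  by ring.
have Inner i j s t : 0 <= s <= 1 -> edge_point v i s != edge_point v j t ->
    pr (edge_point v i s) q.1 = pr (edge_point v j t) q.1 ->
    pr (edge_point v i s) q.2 = pr (edge_point v j t) q.2 -> 0 < s < 1.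
  move=> /andP[s0 s1] ne h1 h2.
  have [s00|s00] := eqVneq s 0.
    have := Vert i j t; rewrite -edgeE !prD !prN.
    move: h1 h2 ne; rewrite s00 edgeE scale0r addr0 => h1 h2 ne.
    by rewrite h1 h2 !subrr => /(_ erefl erefl) h; rewrite h eqxx in ne.
  have [s11|s11] := eqVneq s 1.
    have := Vert (ordS i) j t; rewrite -edgeE !prD !prN.
    have e1 : edge_point v i 1 = v (ordS i) by rewrite edgeE scale1r eE subrKC.
    move: h1 h2 ne; rewrite s11 e1 => h1 h2 ne.
    by rewrite h1 h2 !subrr => /(_ erefl erefl) h; rewrite h eqxx in ne.
  by rewrite !lt_neqAle s0 s1 eq_sym s00 s11.
split=> //.
  by have := hq (inl (inl (inl tt))); rewrite /= /det2 !pr_delta.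
move=> i j s t s01 t01 ne h1 h2.
have ne' : edge_point v j t != edge_point v i s by rewrite eq_sym.
have sin := Inner _ _ _ _ s01 ne h1 h2.
have tin := Inner _ _ _ _ t01 ne' (esym h1) (esym h2).
have ij := Pair _ _ _ _ ne h1 h2.
split=> //; first by case: ij => /G2.
move=> k r r01 k1 k2; apply: contrapT => /not_orP[ki kj].
have distinct l u : 0 < u < 1 -> k <> l -> edge_point v l u != edge_point v k r.
  move=> /andP[u0 u1] kl; apply/eqP => h.
  have u01 : 0 <= u < 1 by rewrite ltW.
  have [r1|r1] := eqVneq r 1.
    have := @v_inj l (ordS k) u 0 u01; case.
    - by rewrite lexx ltr01.
    - by rewrite h r1 !edgeE scale1r scale0r addr0 eE subrKC.
    - by move=> _ u00; rewrite u00 ltxx in u0.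
  have := @v_inj l k u r u01; case=> //.
    by move/andP: r01 => [-> r11]; rewrite lt_neqAle r1.
  by move=> lk; exfalso; apply: kl.
have ik := Pair _ _ _ _ (distinct _ _ sin ki) k1 k2.
have jk := Pair _ _ _ _ (distinct _ _ tin kj) (etrans (esym h1) k1) (etrans (esym h2) k2).
have /eqP[] := G4 i j k ij ik jk.
rewrite /concur /det2.
move: h1 h2 k1 k2; rewrite !edgeE !prD !prZ => h1 h2 k1 k2.
have -> : pr (v j) q.1 = pr (v i) q.1 + s * pr (e i) q.1 - t * pr (e j) q.1 by rewrite h1; ring.
have -> : pr (v j) q.2 = pr (v i) q.2 + s * pr (e i) q.2 - t * pr (e j) q.2 by rewrite h2; ring.
have -> : pr (v k) q.1 = pr (v i) q.1 + s * pr (e i) q.1 - r * pr (e k) q.1 by rewrite k1; ring.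
have -> : pr (v k) q.2 = pr (v i) q.2 + s * pr (e i) q.2 - r * pr (e k) q.2 by rewrite k2; ring.
by ring.
Qed.

End GenericProjection.

(** * The checkerboard region of a plane polygon *)

(* A closed polygon in the plane with non-vertical edges, with heights in the
   plane, encoded by the abscissas [x], ordinates [y] and heights [z], [w] of
   its vertices. *)
Section PlanarPolygon.
Variables (R : realType) (n : nat) (x y z w : 'I_n -> R).

Definition slope i := (y (ordS i) - y i) / (x (ordS i) - x i).
Definition line i t := y i + slope i * (t - x i).
Definition height i t : R * R :=
  (z i + (z (ordS i) - z i) / (x (ordS i) - x i) * (t - x i),
   w i + (w (ordS i) - w i) / (x (ordS i) - x i) * (t - x i)).
(** Non-positive exactly between the abscissas of the two ends, in whichever order they come. *)
Definition gap i t := (t - x i) * (t - x (ordS i)).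
Definition lval i (u : R * R) := u.2 - line i u.1.
Definition onseg i (u : R * R) := (lval i u == 0) && (gap i u.1 <= 0).
Definition onP u := [exists i, onseg i u].

(** With [crosses], the test whether the upward vertical ray from [u] meets edge [i]. The weak
    inequality is the half-open convention by which a vertex above [u] is counted consistently in
    its two edges. *)
Definition rr k (u : R * R) := x k <= u.1.
Definition crosses i u := (rr i u (+) rr (ordS i) u) && (lval i u < 0).
Definition par u := \big[addb/false]_i crosses i u.
Definition region u := onP u || par u.

(** [gp_inj] expresses that the curve in space is embedded; [gp_cross] that the plane curve has only
    transversal double points, away from the vertices. *)
Record good_polygon : Prop := GoodPolygon {
  gp_x : forall i, x i != x (ordS i);
  gp_inj : forall i j t, gap i t <= 0 -> gap j t <= 0 -> line i t = line j t ->
    height i t = height j t ->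
    [\/ i = j, j = ordS i /\ t = x j | i = ordS j /\ t = x i];
  gp_cross : forall i j t, gap i t <= 0 -> gap j t <= 0 -> line i t = line j t ->
    height i t != height j t ->
    [/\ gap i t < 0, gap j t < 0, slope i != slope j &
     forall k, gap k t <= 0 -> line k t = line i t -> k = i \/ k = j] }.

Hypothesis gp : good_polygon.

Let dx i : x (ordS i) - x i != 0.
Proof. by rewrite subr_eq0 eq_sym; exact: gp_x. Qed.

Lemma line_start i : line i (x i) = y i.
Proof. by rewrite /line subrr mulr0 addr0. Qed.

Lemma line_end i : line i (x (ordS i)) = y (ordS i).
Proof. by rewrite /line /slope divfK // subrKC. Qed.

Lemma line_diff i t t' : line i t - line i t' = slope i * (t - t').
Proof. by rewrite /line; ring. Qed.

Lemma gap_start i : gap i (x i) = 0.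
Proof. by rewrite /gap subrr mul0r. Qed.

Lemma gap_end i : gap i (x (ordS i)) = 0.
Proof. by rewrite /gap subrr mulr0. Qed.

Lemma ordS_neq (i : 'I_n) : ordS i != i.
Proof. by apply/eqP => e; have := gp_x gp i; rewrite e eqxx. Qed.

Lemma cts_lval i : continuous (lval i).
Proof. by rewrite /lval /line; cts. Qed.

Lemma cts_gap i : continuous (fun u : R * R => gap i u.1).
Proof. by rewrite /gap; cts. Qed.

Lemma near_neq0 (T : topologicalType) (f : T -> R) u0 :
  continuous f -> f u0 != 0 -> \forall u \near u0, f u != 0.
Proof.
move=> cf; rewrite neq_lt => /orP[h|h].
  by apply: filterS (near_lt0 cf h) => u h'; rewrite lt_eqF.
by apply: filterS (near_gt0 cf h) => u h'; rewrite gt_eqF.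
Qed.

Lemma onsegN_near i u0 : ~~ onseg i u0 -> \forall u \near u0, ~~ onseg i u.
Proof.
rewrite negb_and => /orP[h|].
  apply: filterS (near_neq0 (@cts_lval i) h) => u h'; by rewrite negb_and h'.
rewrite -ltNge => h; apply: filterS (near_gt0 (@cts_gap i) h) => u h'.
by rewrite negb_and -ltNge h' orbT.
Qed.

Lemma near_onseg u0 : \forall u \near u0, forall i, onseg i u -> onseg i u0.
Proof.
apply: (@filter_forall _ _ _ (nbhs u0)) => i; have [h|h] := boolP (onseg i u0).
  by near=> u.
by apply: filterS (onsegN_near h) => u /negbTE ->.
Unshelve. all: by end_near.
Qed.

Lemma onPN_near u0 : ~~ onP u0 -> \forall u \near u0, ~~ onP u.
Proof.
move=> h; apply: filterS (near_onseg u0) => u hu; apply: contraNN h => /existsP[i].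
by move=> /hu ?; apply/existsP; exists i.
Qed.

Lemma rr_near k u0 : x k != u0.1 -> \forall u \near u0, rr k u = rr k u0.
Proof.
have c : continuous (fun u : R * R => u.1 - x k) by cts.
rewrite neq_lt => /orP[h|h].
  have := @near_gt0 _ _ _ u0 c; rewrite subr_gt0 => /(_ h).
  by apply: filterS => u; rewrite subr_gt0 /rr => /ltW ->; rewrite ltW.
have := @near_lt0 _ _ _ u0 c; rewrite subr_lt0 => /(_ h).
by apply: filterS => u; rewrite subr_lt0 /rr => h'; rewrite !leNgt h h'.
Qed.

Lemma lval_sign_near i u0 : lval i u0 != 0 ->
  \forall u \near u0, (lval i u < 0) = (lval i u0 < 0).
Proof.
rewrite neq_lt => /orP[h|h].
  by apply: filterS (near_lt0 (@cts_lval i) h) => u ->.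
apply: filterS (near_gt0 (@cts_lval i) h) => u h'.
by rewrite !ltNge (ltW h) (ltW h').
Qed.

Lemma gap_rr i (u : R * R) : gap i u.1 < 0 -> rr i u (+) rr (ordS i) u.
Proof.
rewrite /gap /rr => h.
have [h1|h1] := leP (x i) u.1; have [h2|h2] := leP (x (ordS i)) u.1 => //=; nra.
Qed.

Lemma gap_rrN i (u : R * R) : 0 < gap i u.1 -> rr i u (+) rr (ordS i) u = false.
Proof.
rewrite /gap /rr => h.
have [h1|h1] := leP (x i) u.1; have [h2|h2] := leP (x (ordS i)) u.1 => //=; nra.
Qed.

Lemma lval_vertex k u : u.1 = x k -> lval k u = u.2 - y k.
Proof. by move=> e; rewrite /lval e line_start. Qed.

Lemma lval_vertexS k u : u.1 = x (ordS k) -> lval k u = u.2 - y (ordS k).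
Proof. by move=> e; rewrite /lval e line_end. Qed.

(* Away from the segments through [u0], the half-open ray casting parity is
   locally constant: at a vertex on the vertical line of [u0], the jumps of the
   two adjacent edges cancel. *)
Lemma par_local u0 : exists c : bool, \forall u \near u0,
  par u = c (+) \big[addb/false]_(i | onseg i u0) crosses i u.
Proof.
pose b i := ~~ onseg i u0 && (lval i u0 < 0).
pose pp (k : 'I_n) := @ord_pred n k.
have parE u : par u = \big[addb/false]_(i | onseg i u0) crosses i u (+)
    \big[addb/false]_(i | ~~ onseg i u0) crosses i u.
  by rewrite /par (bigID (fun i => onseg i u0)).
(* Summation by parts around the cycle: the coefficient of [rr k u] is [b k (+) b (pp k)]. If vertex
   [k] lies on the vertical line of [u0], both edge lines pass through it, so the coefficient is
   zero; otherwise [rr k] is locally constant. *)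
exists (\big[addb/false]_k (rr k u0 && (b k (+) b (pp k)))).
have nb : \forall u \near u0, forall i, ~~ onseg i u0 ->
    crosses i u = (rr i u (+) rr (ordS i) u) && b i.
  apply: (@filter_forall _ _ _ (nbhs u0)) => i; have [h|h] := boolP (onseg i u0); first by near=> u.
  have [g|g] := ltP 0 (gap i u0.1).
    apply: filterS (near_gt0 (@cts_gap i) g) => u g' _.
    by rewrite /crosses gap_rrN.
  have l0 : lval i u0 != 0 by move: h; rewrite negb_and -ltNge ltNge g orbF.
  by apply: filterS (lval_sign_near l0) => u e _; rewrite /crosses e /b h.
have nr : \forall u \near u0, forall k,
    rr k u && (b k (+) b (pp k)) = rr k u0 && (b k (+) b (pp k)).
  apply: (@filter_forall _ _ _ (nbhs u0)) => k; have [xk|xk] := eqVneq (x k) u0.1; last first.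
    by apply: filterS (rr_near xk) => u ->.
  near=> u; suff -> : b k = b (pp k) by rewrite addbb !andbF.
  have xk' : x (ordS (pp k)) = u0.1 by rewrite ord_predK.
  rewrite /b /onseg (lval_vertex (esym xk)) (lval_vertexS (esym xk')).
  have -> : gap k u0.1 = 0 by rewrite -xk gap_start.
  have -> : gap (pp k) u0.1 = 0 by rewrite -xk' gap_end.
  by rewrite lexx !andbT ord_predK.
near=> u.
have hb : forall i, ~~ onseg i u0 -> crosses i u = (rr i u (+) rr (ordS i) u) && b i.
  by near: u.
rewrite parE addbC; congr addb.
transitivity (\big[addb/false]_i ((rr i u (+) rr (ordS i) u) && b i)).
  rewrite [RHS](bigID (fun i => onseg i u0)) /= [X in _ = X (+) _]big1.
    by rewrite addFb; apply: eq_bigr => i hi; exact: hb.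
  by move=> i hi; rewrite /b hi andbF.
transitivity (\big[addb/false]_i ((rr i u && b i) (+) (rr (ordS i) u && b i))).
  by apply: eq_bigr => i _; rewrite andb_addl.
rewrite big_split /=.
rewrite [X in _ (+) X](reindex_inj (can_inj (@ord_predK n))) /= -big_split /=.
apply: eq_bigr => k _; rewrite ord_predK -andb_addr.
by move: k; near: u.
Unshelve. all: by end_near.
Qed.

Definition vertex k : R * R := (x k, y k).

Lemma onseg_start k : onseg k (vertex k).
Proof. by rewrite /onseg lval_vertex //= subrr eqxx gap_start lexx. Qed.

Lemma onseg_end k : onseg k (vertex (ordS k)).
Proof. by rewrite /onseg lval_vertexS //= subrr eqxx gap_end lexx. Qed.

Lemma onsegP i u : reflect (u.2 = line i u.1 /\ gap i u.1 <= 0) (onseg i u).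
Proof.
by rewrite /onseg /lval subr_eq0; apply: (iffP andP) => -[/eqP ? ?].
Qed.

Lemma onseg_vertex k j : onseg j (vertex k) -> j = k \/ ordS j = k.
Proof.
move=> /onsegP[/= e gj]; have /onsegP[/= e' gk] := onseg_start k.
have [h|h] := eqVneq (height k (x k)) (height j (x k)).
  have := gp_inj gp gk gj; rewrite -e -e' => /(_ erefl h)[->|[-> xk]|[-> _]]; [by left| |by right].
  by have := gp_x gp k; rewrite {1}xk eqxx.
by have [] := gp_cross gp gk gj (etrans (esym e') e) h; rewrite gap_start ltxx.
Qed.

Lemma onseg_cross i j u : onseg i u -> onseg j u -> height i u.1 != height j u.1 ->
  [/\ gap i u.1 < 0, gap j u.1 < 0, slope i != slope j &
     forall k, onseg k u -> k = i \/ k = j].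
Proof.
move=> /onsegP[e gi] /onsegP[e' gj] h.
have [h1 h2 h3 h4] := gp_cross gp gi gj (etrans (esym e) e') h.
by split=> // k /onsegP[e'' gk]; apply: h4; rewrite // -e'' e.
Qed.

Lemma onseg_inner i j u : onseg i u -> onseg j u -> gap i u.1 < 0 ->
  height i u.1 = height j u.1 -> i = j.
Proof.
move=> /onsegP[e gi] /onsegP[e' gj] gi' h.
have [//|[ji xj]|[_ xi]] := gp_inj gp gi gj (etrans (esym e) e') h.
  by move: gi'; rewrite xj ji gap_end ltxx.
by move: gi'; rewrite xi gap_start ltxx.
Qed.

Lemma big_onseg1 (F : 'I_n -> bool) u i : (forall j, onseg j u = (j == i)) ->
  \big[addb/false]_(j | onseg j u) F j = F i.
Proof. by move=> h; rewrite (eq_bigl (pred1 i)) ?big_pred1_eq. Qed.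

Lemma big_onseg2 (F : 'I_n -> bool) u i j : i != j ->
  (forall k, onseg k u = (k == i) || (k == j)) ->
  \big[addb/false]_(k | onseg k u) F k = F i (+) F j.
Proof.
move=> ij h; rewrite (bigD1 i) ?h ?eqxx //=; congr addb.
rewrite (eq_bigl (pred1 j)) ?big_pred1_eq // => k /=; rewrite h.
by have [->|] := eqVneq k i; rewrite /= ?andbF ?andbT // (negbTE ij).
Qed.

Lemma near_gap i (u0 : R * R) : gap i u0.1 < 0 -> \forall u \near u0, gap i u.1 < 0.
Proof. by move=> h; exact: near_lt0 (@cts_gap i) h. Qed.

Lemma crosses_inner i (u : R * R) : gap i u.1 < 0 -> crosses i u = (lval i u < 0).
Proof. by move=> h; rewrite /crosses gap_rr. Qed.

Lemma onseg_inner_near i (u : R * R) : gap i u.1 < 0 -> onseg i u = (lval i u == 0).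
Proof. by move=> h; rewrite /onseg (ltW h) andbT. Qed.

Lemma region_far u0 : ~~ onP u0 ->
  \forall u \near u0, ~~ onP u /\ region u = region u0.
Proof.
move=> h; have [c hc] := par_local u0.
have no k : onseg k u0 = false by apply: contraNF h => hk; apply/existsP; exists k.
have e u : par u = c (+) \big[addb/false]_(i | onseg i u0) crosses i u -> par u = c.
  by rewrite big_pred0 ?addbF.
have pc : par u0 = c by apply: e; exact: nbhs_singleton hc.
near=> u; have hu : ~~ onP u by near: u; exact: onPN_near.
by split=> //; rewrite /region (negbTE h) (negbTE hu) pc /=; apply: e; near: u.
Unshelve. all: by end_near.
Qed.

Lemma region_inner (u0 : R * R) i : gap i u0.1 < 0 -> (forall j, onseg j u0 = (j == i)) ->
  exists s : R, (s = 1 \/ s = -1) /\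
    \forall u \near u0, onP u = (lval i u == 0) /\ region u = (0 <= s * lval i u).
Proof.
move=> gi h; have [c hc] := par_local u0.
exists (if c then 1 else -1); split; first by case: c {hc}; [left|right].
near=> u.
have gu : gap i u.1 < 0 by near: u; exact: near_gap.
have oP : onP u = (lval i u == 0).
  apply/existsP/idP => [[j hj]|]; last by rewrite -onseg_inner_near // => ?; exists i.
  have : onseg j u0 by move: j hj; near: u; exact: near_onseg.
  by rewrite h => /eqP ji; rewrite -onseg_inner_near // -ji.
split=> //; rewrite /region oP.
have -> : par u = c (+) (lval i u < 0).
  by rewrite -(crosses_inner gu) -(big_onseg1 (crosses ^~ u) h); near: u.
by case: (c); rewrite ?mul1r ?mulN1r ?oppr_ge0;
  case: (ltgtP (lval i u) 0).
Unshelve. all: by end_near.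
Qed.

Lemma prod_ge0 (a b : R) : a != 0 -> b != 0 -> (0 <= a * b) = (a < 0) (+) (b < 0) (+) true.
Proof.
move=> a0 b0; have [ha|ha|ha] := ltgtP a 0; last by rewrite ha eqxx in a0.
  have [hb|hb|hb] := ltgtP b 0; last by rewrite hb eqxx in b0.
    by rewrite nmulr_rge0 // ltW.
  by rewrite nmulr_rge0 // leNgt hb.
have [hb|hb|hb] := ltgtP b 0; last by rewrite hb eqxx in b0.
  by rewrite pmulr_rge0 // leNgt hb.
by rewrite pmulr_rge0 // ltW.
Qed.

Lemma prod_le0 (a b : R) : a != 0 -> b != 0 -> (a * b <= 0) = (a < 0) (+) (b < 0).
Proof.
move=> a0 b0; rewrite -oppr_ge0 -mulNr prod_ge0 ?oppr_eq0 // oppr_lt0.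
by have [ha|ha|ha] := ltgtP a 0; [| |by rewrite ha eqxx in a0]; case: (b < 0).
Qed.

(** Both edges switch the parity, so the region is one of the two pairs of opposite sectors; the
    sign [s] selects the pair. *)
Lemma region_crossing (u0 : R * R) i j : gap i u0.1 < 0 -> gap j u0.1 < 0 -> i != j ->
  (forall k, onseg k u0 = (k == i) || (k == j)) ->
  exists s : R, (s = 1 \/ s = -1) /\
    \forall u \near u0, onP u = (lval i u == 0) || (lval j u == 0) /\
      region u = (0 <= s * (lval i u * lval j u)).
Proof.
move=> gi gj ij h; have [c hc] := par_local u0.
exists (if c then 1 else -1); split; first by case: c {hc}; [left|right].
near=> u.
have gu : gap i u.1 < 0 by near: u; exact: near_gap.
have gv : gap j u.1 < 0 by near: u; exact: near_gap.
have oP : onP u = (lval i u == 0) || (lval j u == 0).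
  apply/existsP/orP => [[k hk]|].
    have : onseg k u0 by move: k hk; near: u; exact: near_onseg.
    rewrite h => /orP[] /eqP ki; move: hk; rewrite ki onseg_inner_near //; by [left|right].
  by case; rewrite -onseg_inner_near // => ?; [exists i|exists j].
split=> //; rewrite /region oP.
have -> : par u = c (+) ((lval i u < 0) (+) (lval j u < 0)).
  rewrite -(crosses_inner gu) -(crosses_inner gv) -(big_onseg2 (crosses ^~ u) ij h).
  by near: u.
have [hi|hi] := eqVneq (lval i u) 0; first by rewrite hi mul0r mulr0 lexx.
have [hj|hj] := eqVneq (lval j u) 0; first by rewrite hj !mulr0 lexx.
by case: (c); rewrite ?mul1r ?mulN1r ?oppr_ge0 ?prod_le0 ?prod_ge0 ?addbT.
Unshelve. all: by end_near.
Qed.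

Definition halfplane_at u0 := exists T T' : R * R -> R * R,
  [/\ homeo T T', T u0 = (0, 0) & \forall u \near u0, region u = (0 <= (T u).2)].

End PlanarPolygon.

(** * Straightening the corners of the region *)

Section VertexCharts.
Variable R : realType.

(** Straightens the graph that passes through the point with slope [a] on its left and [b] on its
    right. *)
Lemma homeo_path (a b X0 Y0 s : R) : s ^+ 2 = 1 ->
  homeo (fun u : R * R => (u.1 - X0,
           s * (u.2 - Y0 - a * Num.min (u.1 - X0) 0 - b * Num.max (u.1 - X0) 0)))
        (fun v : R * R => (v.1 + X0,
           s * v.2 + Y0 + a * Num.min v.1 0 + b * Num.max v.1 0)).
Proof.
move=> s2; split.
- by cts.
- by cts.
- move=> [u1 u2] /=; congr pair; first by ring.
  by rewrite mulrA -expr2 s2; ring.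
- move=> [v1 v2] /=; rewrite addrK; congr pair.
  rewrite (_ : _ - _ - _ - _ = s * v2); last by ring.
  by rewrite mulrA -expr2 s2 mul1r.
Qed.

(** Up to the sign [s] the second coordinate is the minimum of P and -Q, which is non-negative
    exactly on the sector P >= 0 >= Q; the sector opens to a half plane. *)
Lemma homeo_sector (a b X0 Y0 s : R) : s ^+ 2 = 1 -> a != b ->
  homeo (fun u : R * R =>
     let P := u.2 - Y0 - a * (u.1 - X0) in let Q := u.2 - Y0 - b * (u.1 - X0) in
     (P + Q, s * ((P - Q) / 2 - `|P + Q| / 2)))
   (fun v : R * R => let d := 2 * s * v.2 + `|v.1| in
     (X0 + d / (b - a), Y0 + (v.1 + d) / 2 + a * (d / (b - a)))).
Proof.
move=> s2 ab; have ba : b - a != 0 by rewrite subr_eq0 eq_sym.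
split.
- by rewrite /=; cts.
- by rewrite /=; cts.
- move=> [u1 u2] /=; set N := `|_|.
  have -> : 2 * s * (s * ((u2 - Y0 - a * (u1 - X0) - (u2 - Y0 - b * (u1 - X0))) / 2 - N / 2)) + N
     = s ^+ 2 * ((b - a) * (u1 - X0) - N) + N by field.
  by rewrite s2 mul1r subrK; congr pair; field.
- move=> [v1 v2] /=; set d := (2 * s * v2 + `|v1|).
  have e : Y0 + (v1 + d) / 2 + a * (d / (b - a)) - Y0 - a * (X0 + d / (b - a) - X0) +
     (Y0 + (v1 + d) / 2 + a * (d / (b - a)) - Y0 - b * (X0 + d / (b - a) - X0)) = v1 by field.
  rewrite e; congr pair.
  transitivity (s ^+ 2 * v2); last by rewrite s2 mul1r.
  by rewrite /d; field.
Qed.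

(** The left-hand side is membership in the region near a vertex, [D] and [E] being the offsets from
    it and [k] the parity constant; here one edge leaves to the left and the other to the right. *)
Lemma path_side (k : bool) (a b D E : R) :
  [|| (E - a * D == 0) && (D <= 0), (E - b * D == 0) && (0 <= D) |
     k (+) (~~ (0 <= D) && (E - a * D < 0) (+) (0 <= D) && (E - b * D < 0))] =
  (0 <= (if k then 1 else -1) * (E - a * Num.min D 0 - b * Num.max D 0)).
Proof.
have [D0|D0] := leP 0 D; last first.
  rewrite mulr0 subr0 (ltW D0) andbT andbF /= addbF.
  by case: k; rewrite ?mul1r ?mulN1r ?oppr_ge0; case: ltgtP.
rewrite mulr0 subr0 /= andbT.
have -> : (E - a * D == 0) && (D <= 0) = (E == 0) && (D == 0).
  have [->|Dn] := eqVneq D 0; first by rewrite mulr0 subr0 lexx.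
  by rewrite leNgt lt_neqAle (eq_sym 0) Dn D0 !andbF.
have [->|Dn] := eqVneq D 0.
  by rewrite mulr0 subr0 andbT orbA orbb;
  case: k; rewrite ?mul1r ?mulN1r ?oppr_ge0; case: ltgtP.
by rewrite andbF /=; case: k; rewrite ?mul1r ?mulN1r ?oppr_ge0; case: ltgtP.
Qed.

Lemma sector_side (k : bool) (a b D E : R) : a < b ->
  let P := E - a * D in let Q := E - b * D in
  [|| (P == 0) && (0 <= D), (Q == 0) && (0 <= D) |
     k (+) ((0 <= D) && ((P < 0) (+) (Q < 0)))] =
  (0 <= (if k then -1 else 1) * ((P - Q) / 2 - `|P + Q| / 2)).
Proof.
move=> ab P Q.
have PQ : P - Q = (b - a) * D by rewrite /P /Q; ring.
move: P Q PQ => P Q PQ; set y := (_ - _).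
have ba : 0 < b - a by rewrite subr_gt0.
have yP : y = Num.min P (- Q).
  rewrite /y; have [h|h] := leP P (- Q).
    by rewrite ler0_norm; lra.
  by rewrite ger0_norm; lra.
have [D0|D0] := leP 0 D; last first.
  have PQ0 : P - Q < 0 by rewrite PQ nmulr_llt0.
  have y0 : y < 0 by rewrite yP gt_min; have [|] := ltP P 0 => //=; lra.
  by case: k; rewrite ?mul1r ?mulN1r ?oppr_ge0 /= ?andbF ?(ltW y0) // leNgt y0.
have PQ0 : 0 <= P - Q by rewrite PQ mulr_ge0 // ltW.
have -> : (0 <= (if k then -1 else 1) * y) =
   if k then (P <= 0) || (0 <= Q) else (0 <= P) && (Q <= 0).
  case: k; rewrite ?mul1r ?mulN1r ?oppr_ge0 yP ?ge_min ?le_min ?oppr_ge0 ?oppr_le0 //.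
have [P0|P0|P0] := ltgtP P 0; have [Q0|Q0|Q0] := ltgtP Q 0; case: k => //=; lra.
Qed.

End VertexCharts.

Section PolygonVertices.
Variables (R : realType) (n : nat) (x y z w : 'I_n -> R).
Hypothesis gp : good_polygon x y z w.
Local Notation os := (onseg x y).
Local Notation ga := (gap x).
Local Notation lv := (lval x y).
Local Notation sl := (slope x y).
Local Notation li := (line x y).
Local Notation ht := (height x z w).
Local Notation vt := (vertex x y).
Local Notation oP := (onP x y).

Lemma onP_cases u : oP u ->
  [\/ exists k, u = vt (ordS k),
      exists i, ga i u.1 < 0 /\ (forall j, os j u = (j == i)) |
      exists i j, [/\ i != j, ga i u.1 < 0, ga j u.1 < 0,
        ht i u.1 != ht j u.1 & sl i != sl j /\
        forall k, os k u = (k == i) || (k == j)]].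
Proof.
move=> /existsP[i iu]; have /onsegP[ul ug] := iu.
have [g0|g0] := eqVneq (ga i u.1) 0.
  constructor 1; move/eqP: g0; rewrite /gap mulf_eq0 !subr_eq0 => /orP[] /eqP ux.
    exists (ord_pred i); rewrite ord_predK /vertex -ux.
    by case: u ul ux {iu ug} => a b /= -> ->; rewrite line_start.
  exists i; rewrite /vertex -ux.
  by case: u ul ux {iu ug} => a b /= -> ->; rewrite (line_end gp).
have gi : ga i u.1 < 0 by rewrite lt_neqAle g0.
have [[j [ji ju]]|none] := pselect (exists j, j != i /\ os j u); last first.
  constructor 2; exists i; split=> // j; have [->//|ji] := eqVneq j i.
  by apply/negbTE/negP => ju; apply: none; exists j.
constructor 3; exists i, j.
have hij : ht i u.1 != ht j u.1.
  by apply: contraNneq ji => h; rewrite (onseg_inner gp iu ju gi h).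
have [_ gj sij only] := onseg_cross gp iu ju hij.
split=> //; first by rewrite eq_sym.
split=> // k; apply/idP/orP => [/only[]->|[]/eqP->//]; by [left|right].
Qed.

Lemma onseg_at_vertex k j : os j (vt (ordS k)) = (j == k) || (j == ordS k).
Proof.
apply/idP/orP => [/(onseg_vertex gp)[->|/ordS_inj->]|[]/eqP->]; rewrite ?eqxx; auto.
  exact: onseg_end gp k.
exact: onseg_start.
Qed.

(* Otherwise the two edges would overlap. *)
Lemma slope_same_side k : 0 < (x k - x (ordS k)) * (x (ordS (ordS k)) - x (ordS k)) ->
  sl k != sl (ordS k).
Proof.
set c := ordS k => side; apply/eqP => slkc.
(* Half the smaller horizontal extent, so that one point at this distance from the vertex has
   abscissa inside both edges. *)
pose e : R := Num.min `|x k - x c| `|x (ordS c) - x c| / 2.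
have xk : x k != x c by exact: gp_x gp k.
have xc : x (ordS c) - x c != 0 by rewrite subr_eq0 eq_sym; exact: gp_x gp c.
have e0 : 0 < e by rewrite divr_gt0 // lt_min !normr_gt0 subr_eq0 xk.
have e1 : e < `|x k - x c|.
  have : Num.min `|x k - x c| `|x (ordS c) - x c| <= `|x k - x c| by rewrite ge_min lexx.
  by move: e0; rewrite /e; lra.
have e2 : e < `|x (ordS c) - x c|.
  have : Num.min `|x k - x c| `|x (ordS c) - x c| <= `|x (ordS c) - x c|.
    by rewrite ge_min lexx orbT.
  by move: e0; rewrite /e; lra.
have [t [gk gc]] : exists t, ga k t < 0 /\ ga c t < 0.
  have [h|h] := ltP 0 (x k - x c).
    exists (x c + e); move: e1 e2; rewrite /gap -/c.
    have h2 : 0 < x (ordS c) - x c by rewrite -(pmulr_rgt0 _ h).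
    by rewrite !gtr0_norm // => e1 e2; split; nra.
  have h1 : x k - x c < 0 by rewrite lt_neqAle h subr_eq0 xk.
  exists (x c - e); move: e1 e2; rewrite /gap -/c.
  have h2 : x (ordS c) - x c < 0 by rewrite -(nmulr_rgt0 _ h1).
  by rewrite !ltr0_norm // => e1 e2; split; nra.
have lc : li k t = li c t.
  have := line_diff x y k t (x c); have := line_diff x y c t (x c).
  rewrite slkc (line_end gp) line_start -/c; lra.
have [h|h] := eqVneq (ht k t) (ht c t).
  have [kc|[_ tx]|[_ tx]] := gp_inj gp (ltW gk) (ltW gc) lc h.
  - by move: (ordS_neq gp k); rewrite -/c -kc eqxx.
  - by move: gc; rewrite tx gap_start ltxx.
  - by move: gk; rewrite tx gap_start ltxx.
by have [_ _] := gp_cross gp (ltW gk) (ltW gc) lc h; rewrite slkc eqxx.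
Qed.

Lemma near_gap_side (i j : 'I_n) (u0 : R * R) (f : R -> R) :
  (forall t, f t = (t - x i) * (t - x j)) -> x i != x j -> u0.1 = x j ->
  \forall u \near u0, (f u.1 <= 0) = (if x i <= x j then u.1 <= x j else x j <= u.1).
Proof.
move=> fE xij ux.
have c : continuous (fun u : R * R => u.1 - x i) by cts.
have [h|h] := leP (x i) (x j).
  have h' : 0 < u0.1 - x i by rewrite ux subr_gt0 lt_neqAle xij.
  apply: filterS (near_gt0 c h') => u hu.
  by rewrite fE pmulr_rle0 // subr_le0.
have h' : u0.1 - x i < 0 by rewrite ux subr_lt0.
apply: filterS (near_lt0 c h') => u hu.
by rewrite fE nmulr_rle0 // subr_ge0.
Qed.

(** Edges leaving the vertex to opposite sides of its vertical line form a path; edges leaving to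
    the same side bound a sector, whose slopes differ by [slope_same_side]. *)
Lemma halfplane_vertex k : halfplane_at x y (vt (ordS k)).
Proof.
set u0 := vt (ordS k); set c := ordS k.
have [b hb] := par_local gp u0.
pose D (u : R * R) := u.1 - x c; pose E (u : R * R) := u.2 - y c.
have lk u : lv k u = E u - sl k * D u.
  rewrite /lval /E /D; have := line_diff x y k u.1 (x c).
  by rewrite (line_end gp) -/c; lra.
have lc u : lv c u = E u - sl c * D u.
  rewrite /lval /E /D; have := line_diff x y c u.1 (x c).
  by rewrite line_start; lra.
have xk : x k != x c by exact: gp_x gp k.
have xc : x (ordS c) != x c by rewrite eq_sym; exact: gp_x gp c.
have kc : k != c by rewrite eq_sym; exact: ordS_neq gp k.
pose rk := x k <= x c; pose rc := x (ordS c) <= x c.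
have reg : \forall u \near u0, region x y u =
  [|| (E u - sl k * D u == 0) && (if rk then D u <= 0 else 0 <= D u),
      (E u - sl c * D u == 0) && (if rc then D u <= 0 else 0 <= D u) |
      b (+) ((rk (+) (0 <= D u)) && (E u - sl k * D u < 0) (+)
             ((0 <= D u) (+) rc) && (E u - sl c * D u < 0))].
  near=> u.
  have oPu : oP u = os k u || os c u.
    apply/existsP/orP => [[j hj]|[] h]; [|by exists k|by exists c].
    have : os j u0 by move: j hj; near: u; exact: near_onseg.
    by rewrite onseg_at_vertex => /orP[] /eqP e; [left|right]; rewrite ?/c -e.
  have gk : (ga k u.1 <= 0) = (if rk then D u <= 0 else 0 <= D u).
    rewrite /D subr_le0 subr_ge0 /rk; near: u.
    by apply: (near_gap_side (i := k) (j := c) (f := ga k)).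
  have gc : (ga c u.1 <= 0) = (if rc then D u <= 0 else 0 <= D u).
    rewrite /D subr_le0 subr_ge0 /rc; near: u.
    apply: (near_gap_side (i := ordS c) (j := c) (f := ga c)) => // t.
    by rewrite /gap mulrC.
  have rrk : rr x k u = rk by near: u; apply: rr_near.
  have rrc : rr x (ordS c) u = rc by near: u; apply: rr_near.
  have rr0 : rr x c u = (0 <= D u) by rewrite /rr /D subr_ge0.
  have pu : par x y u = b (+) (crosses x y k u (+) crosses x y c u).
    by rewrite -(big_onseg2 (crosses x y ^~ u) kc (onseg_at_vertex k)); near: u.
  rewrite /region oPu pu /onseg /crosses gk gc rrk rrc -/c rr0 lk lc.
  by rewrite -orbA.
have s1 (h : bool) : (if h then 1 else -1 : R) ^+ 2 = 1 by case: h; rewrite ?sqrrN expr1n.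
have s2 (h : bool) : (if h then -1 else 1 : R) ^+ 2 = 1 by case: h; rewrite ?sqrrN expr1n.
have u00 : D u0 = 0 /\ E u0 = 0 by rewrite /D /E /= !subrr.
have pathT (a d : R) : (\forall u \near u0, region x y u =
    (0 <= (if b then 1 else -1) * (E u - a * Num.min (D u) 0 - d * Num.max (D u) 0))) ->
    halfplane_at x y u0.
  move=> h; have H := homeo_path a d (x c) (y c) (s1 b).
  eexists; eexists; split; [exact: H| |exact: h].
  by rewrite /= !subrr minxx maxxx !mulr0 !subr0 mulr0.
have sectorT (a d : R) : a != d -> (\forall u \near u0, region x y u =
    (let P := E u - a * D u in let Q := E u - d * D u in
     0 <= (if b then -1 else 1) * ((P - Q) / 2 - `|P + Q| / 2))) ->
    halfplane_at x y u0.
  move=> ad h; have H := homeo_sector (x c) (y c) (s2 b) ad.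
  eexists; eexists; split; [exact: H| |exact: h].
  by rewrite /= !subrr !mulr0 !subr0 addr0 normr0 mul0r subr0 mulr0.
have side : rk = rc -> sl k != sl c.
  move=> rkc; apply: slope_same_side; rewrite -/c.
  move: rkc; rewrite /rk /rc; have [h1|h1] := leP (x k) (x c) => /esym.
    move=> h2; rewrite nmulr_rgt0 ?subr_lt0 lt_neqAle ?xk ?h1 //.
    by rewrite xc h2.
  by move=> /negbT; rewrite -ltNge => h2; rewrite pmulr_rgt0 subr_gt0.
move: reg side; case: rk; case: rc => reg side.
- have {}side := side erefl.
  (* Reflection in the vertical line, which negates slopes and exchanges their order. The two
     conventions for [D u = 0] agree, as both tests then coincide and cancel. *)
  have flip (a d : R) u : a < d -> [|| (E u - a * D u == 0) && (D u <= 0),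
        (E u - d * D u == 0) && (D u <= 0) |
      b (+) (~~ (0 <= D u) && ((E u - a * D u < 0) (+) (E u - d * D u < 0)))] =
     (let P := E u - d * D u in let Q := E u - a * D u in
     0 <= (if b then -1 else 1) * ((P - Q) / 2 - `|P + Q| / 2)).
    move=> ad; have nad : - d < - a by rewrite ltrN2.
    have := @sector_side R b (- d) (- a) (- D u) (E u) nad.
    rewrite !mulrNN !oppr_ge0 /= => <-.
    have -> : ~~ (0 <= D u) && ((E u - a * D u < 0) (+) (E u - d * D u < 0)) =
        (D u <= 0) && ((E u - d * D u < 0) (+) (E u - a * D u < 0)).
      case: (ltgtP (D u) 0) => [||->] //=; first by rewrite addbC.
      by rewrite !mulr0 addbb.
    by rewrite orbCA.
  have [ad|da|] := ltgtP (sl k) (sl c); last by move=> e; rewrite e eqxx in side.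
    apply: (sectorT (sl c) (sl k)); first by rewrite eq_sym.
    by apply: filterS reg => u ->; rewrite addbT -andb_addr; exact: flip.
  apply: (sectorT (sl k) (sl c)) => //.
  apply: filterS reg => u ->; rewrite addbT -andb_addr.
  by rewrite orbCA (addbC (E u - sl k * D u < 0)); exact: flip.
- apply: (pathT (sl k) (sl c)); apply: filterS reg => u ->.
  by rewrite -path_side /= addbF.
- apply: (pathT (sl c) (sl k)); apply: filterS reg => u ->.
  rewrite -path_side orbCA addbT addFb.
  by rewrite (addbC ((0 <= D u) && _)).
- have {}side := side erefl.
  have [ad|da|] := ltgtP (sl k) (sl c); last by move=> e; rewrite e eqxx in side.
    apply: (sectorT (sl k) (sl c)) => //.
    by apply: filterS reg => u ->; rewrite addbF -andb_addr; exact: sector_side.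
  apply: (sectorT (sl c) (sl k)); first by rewrite eq_sym.
  apply: filterS reg => u ->; rewrite addbF -andb_addr.
  by rewrite orbCA (addbC (E u - sl k * D u < 0)); exact: sector_side.
Unshelve. all: by end_near.
Qed.

Lemma halfplane_inner u0 i : ga i u0.1 < 0 -> (forall j, os j u0 = (j == i)) ->
  halfplane_at x y u0.
Proof.
move=> gi h; have [s [s1 hs]] := region_inner gp gi h.
have s2 : s ^+ 2 = 1 by case: s1 => ->; rewrite ?sqrrN expr1n.
have H := homeo_path (sl i) (sl i) u0.1 u0.2 s2.
have /onsegP[u2 _] : os i u0 by rewrite h.
eexists; eexists; split; [exact: H| |].
  by rewrite /= !subrr minxx maxxx !mulr0 !subr0 mulr0.
apply: filterS hs => u [_ ->] /=; congr (0 <= s * _).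
have := line_diff x y i u.1 u0.1; rewrite -u2 /lval => e.
rewrite -addrA -opprD -mulrDr.
have -> : Num.min (u.1 - u0.1) 0 + Num.max (u.1 - u0.1) 0 = u.1 - u0.1.
  by rewrite addr_min_max addr0.
by lra.
Qed.

End PolygonVertices.

(** * Triangulation of the checkerboard region *)

Section PlaneCombinations.
Variable R : realType.
Local Notation pt := (R * R)%type.

Definition comb3 (a b c : R) (p q r : pt) : pt :=
  (a * p.1 + b * q.1 + c * r.1, a * p.2 + b * q.2 + c * r.2).

Definition mass3 (a b c : R) (p q r v : pt) : R :=
  a * (v == p)%:R + b * (v == q)%:R + c * (v == r)%:R.

(* A linear expression in the barycentric coordinates depends only on the mass
   distribution that they define on the vertices. *)
Lemma mass3_ext (F : pt -> R) a b c p q r a' b' c' p' q' r' :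
  mass3 a b c p q r =1 mass3 a' b' c' p' q' r' ->
  a * F p + b * F q + c * F r = a' * F p' + b' * F q' + c' * F r'.
Proof.
move=> e; pose s := undup [:: p; q; r; p'; q'; r'].
have one (g : R) v0 : v0 \in s -> \sum_(v <- s) g * (v == v0)%:R * F v = g * F v0.
  move=> v0s; rewrite (bigD1_seq v0) ?undup_uniq //= eqxx mulr1 big1 ?addr0 //.
  by move=> v /negbTE ->; rewrite mulr0 mul0r.
have E k l m (v1 v2 v3 : pt) : v1 \in s -> v2 \in s -> v3 \in s ->
    \sum_(v <- s) mass3 k l m v1 v2 v3 v * F v = k * F v1 + l * F v2 + m * F v3.
  move=> h1 h2 h3; rewrite -(one k v1) // -(one l v2) // -(one m v3) // -!big_split /=.
  by apply: eq_bigr => v _; rewrite /mass3 !mulrDl.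
rewrite -E ?mem_undup ?inE ?eqxx ?orbT // -E ?mem_undup ?inE ?eqxx ?orbT //.
by apply: eq_bigr => v _; rewrite e.
Qed.

End PlaneCombinations.

Lemma lower_bound_pos (R : realType) (I : finType) (f : I -> R) :
  exists2 e : R, 0 < e & forall i, 0 < f i -> e < f i.
Proof.
have : \forall e \near (0 : R)^'+, forall i, 0 < f i -> e < f i.
  apply: filter_forall => i; have [h|h] := ltP 0 (f i).
    by apply: filterS (nbhs_right_lt h) => e he _.
  by near=> e.
move=> h; have [e [e0 he]] := filter_ex (filterI (nbhs_right_gt (0 : R)) h).
by exists e.
Unshelve. all: by end_near.
Qed.

(** * Marks and elementary segments on the edge lines *)

Section ElementarySegments.
Variables (R : realType) (n : nat) (x y z w : 'I_n -> R).
Hypothesis gp : good_polygon x y z w.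
Local Notation lv := (lval x y).
Local Notation sl := (slope x y).
Local Notation li := (line x y).
Local Notation pt := (R * R)%type.

(* The abscissa at which the lines [i] and [j] meet; for parallel lines, and in
   particular for [j = i], this is the abscissa of the vertex [i] instead. *)
Definition mark i j : R :=
  if sl i == sl j then x i
  else (y j - sl j * x j - (y i - sl i * x i)) / (sl i - sl j).

Lemma markP i j t : sl i != sl j -> (li i t == li j t) = (t == mark i j).
Proof.
move=> ij; have ij0 : sl i - sl j != 0 by rewrite subr_eq0.
rewrite /mark (negbTE ij); apply/eqP/eqP => [h|->].
  by apply: (mulIf ij0); rewrite divfK //; move: h; rewrite /line; lra.
by rewrite /line; field.
Qed.

Lemma mark_diag i : mark i i = x i.
Proof. by rewrite /mark eqxx. Qed.

Definition lpt i t : pt := (t, li i t).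

Lemma lval_lpt i t : lv i (lpt i t) = 0.
Proof. by rewrite /lval subrr. Qed.

Lemma lval0 i (u : pt) : lv i u = 0 -> u = lpt i u.1.
Proof. by case: u => a b; rewrite /lval /lpt /= => /eqP; rewrite subr_eq0 => /eqP ->. Qed.

Definition sameline i j := (sl i == sl j) && (li i 0 == li j 0).

Lemma samelineE i j : sameline i j -> forall t, li i t = li j t.
Proof.
move=> /andP[/eqP s /eqP h] t.
by have := line_diff x y i t 0; have := line_diff x y j t 0; rewrite s h; lra.
Qed.

Lemma sameline_of i j t : sl i = sl j -> li i t = li j t -> sameline i j.
Proof.
move=> s h; rewrite /sameline s eqxx; apply/eqP.
by have := line_diff x y i t 0; have := line_diff x y j t 0; rewrite s h; lra.
Qed.

Lemma sameline_refl i : sameline i i.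
Proof. by rewrite /sameline !eqxx. Qed.

Lemma sameline_lval i j u : sameline i j -> lv i u = lv j u.
Proof. by move=> h; rewrite /lval (samelineE h). Qed.

Lemma sameline_slope i j : sameline i j -> sl i = sl j.
Proof. by move=> /andP[/eqP]. Qed.

Lemma lval_line k i t : lv k (lpt i t) = lv k (lpt i 0) + (sl i - sl k) * t.
Proof. by rewrite /lval /lpt /line /=; ring. Qed.

Variable ep : R.
Hypothesis ep0 : 0 < ep.
Hypothesis ep_gap : forall i j k l, mark i j != mark k l ->
  3 * ep < `|mark i j - mark k l|.

(** The three marks at a meeting point: itself and the feet of a possible tent. The factor 3 in
    [ep_gap] lets a foot, at distance [ep] from its own mark, stay more than [2 * ep] away from
    every other mark. *)
Definition base i j (k : 'I_3) : R := mark i j + ((k : nat)%:R - 1) * ep.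

Definition isB (u : pt) := exists i j k, u = lpt i (base i j k).

Lemma base_mid i j : base i j 1 = mark i j.
Proof. by rewrite /base /= subrr mul0r addr0. Qed.

(** A base point of a line of different slope that happens to lie on line [i] is where the two lines
    meet, hence also a middle mark of [i] itself. *)
Lemma isB_line i t : isB (lpt i t) <-> exists j l k, sameline j i /\ t = base j l k.
Proof.
split=> [[j [l [k e]]]|[j [l [k [ji ->]]]]]; last first.
  by exists j, l, k; rewrite /lpt (samelineE ji).
have tE : t = base j l k by case: e.
have ij : li i t = li j t by case: e => _; rewrite tE.
have [s|s] := eqVneq (sl j) (sl i).
  by exists j, l, k; split=> //; exact: sameline_of s (esym ij).
exists i, j, 1; split; first exact: sameline_refl.
by rewrite base_mid; apply/eqP; rewrite -markP ?ij // eq_sym.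
Qed.

Lemma isB_cross i j t : sl i != sl j -> li i t = li j t -> isB (lpt i t).
Proof.
move=> s h; apply/isB_line; exists i, j, 1; split; first exact: sameline_refl.
by rewrite base_mid; apply/eqP; rewrite -markP // h.
Qed.

Definition el i a b := [/\ a < b, isB (lpt i a), isB (lpt i b) &
  forall t, a < t < b -> ~ isB (lpt i t)].

Lemma el_unique i a b b' : el i a b -> el i a b' -> b = b'.
Proof.
move=> [ab _ Bb nab] [ab' _ Bb' nab'].
have [h|h|//] := ltgtP b b'.
  by case: (nab' b); rewrite ?ab.
by case: (nab b'); rewrite ?ab'.
Qed.

Lemma el_sameline i j a b : sameline i j -> el i a b -> el j a b.
Proof.
move=> ij [ab Ba Bb nab]; have e t : lpt j t = lpt i t by rewrite /lpt (samelineE ij).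
by split=> //; rewrite ?e // => t /nab; rewrite e.
Qed.

Lemma el_nonzero i a b k t : el i a b -> a < t < b -> ~~ sameline i k ->
  lv k (lpt i t) != 0.
Proof.
move=> [_ _ _ nab] tab nik; apply/eqP => h; apply: (nab t tab).
have e : li i t = li k t by move/eqP: h; rewrite /lval subr_eq0 => /eqP.
apply: (@isB_cross i k) => //; apply/negP => /eqP s.
by move: nik; rewrite (sameline_of s e).
Qed.

(** An affine function with opposite signs at [t] and [t'] would vanish strictly inside the segment,
    where no other line passes. *)
Lemma el_sign i a b k t t' : el i a b -> a < t < b -> a <= t' <= b -> ~~ sameline i k ->
  0 <= Num.sg (lv k (lpt i t)) * lv k (lpt i t').
Proof.
move=> eab /andP[at_ tb] /andP[at' t'b] nik; rewrite leNgt; apply/negP => neg.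
set f := fun s => lv k (lpt i s).
have fE s : f s = f 0 + (sl i - sl k) * s by exact: lval_line.
have ft : f t != 0 by apply: el_nonzero eab _ nik; rewrite at_.
have prod : f t * f t' < 0.
  move: neg; rewrite -/(f t) -/(f t'); case: (sgrP (f t)) ft => [->|ft0 _|ft0 _]; rewrite ?eqxx //.
    by rewrite mul1r => ?; rewrite pmulr_rlt0.
  by rewrite mulN1r oppr_lt0 => ?; rewrite nmulr_rlt0.
have tt' : t != t' by apply: contraTneq prod => <-; rewrite -leNgt -expr2 sqr_ge0.
have s0 : sl i - sl k != 0.
  apply: contraTneq prod => s0; rewrite -leNgt.
  by rewrite (fE t) (fE t') s0 !mul0r !addr0 -expr2 sqr_ge0.
pose r := t - f t / (sl i - sl k).
have fr : f r = 0 by rewrite fE /r; have := fE t; move: (f t) => ? ->; field.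
have rE : (r - t) * (sl i - sl k) = - f t by rewrite /r; field.
have rE' : (r - t') * (sl i - sl k) = - f t'.
  by have := fE t; have := fE t'; have := rE; lra.
have rr' : (r - t) * (r - t') < 0.
  have : ((r - t) * (sl i - sl k)) * ((r - t') * (sl i - sl k)) < 0 by rewrite rE rE' mulrNN.
  rewrite mulrACA pmulr_llt0 // -expr2 lt_neqAle sqr_ge0 eq_sym sqrf_eq0 s0 //.
have rin : a < r < b by apply/andP; split; nra.
by have := el_nonzero eab rin nik; rewrite -/(f r) fr eqxx.
Qed.

(* If the point is a base point, all the mass sits there; otherwise the two
   segments lie on one line and coincide. *)
Lemma el_mass i a b i' a' b' (k l k' l' m : R) : el i a b -> el i' a' b' ->
  0 <= k -> 0 <= l -> 0 <= k' -> 0 <= l' -> 0 < m -> k + l = m -> k' + l' = m ->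
  k * a + l * b = k' * a' + l' * b' ->
  k * li i a + l * li i b = k' * li i' a' + l' * li i' b' ->
  forall v, k * (v == lpt i a)%:R + l * (v == lpt i b)%:R =
            k' * (v == lpt i' a')%:R + l' * (v == lpt i' b')%:R.
Proof.
move=> ei ei' k0 l0 k0' l0' m0 kl kl' e1 e2.
have m0' : m != 0 by rewrite gt_eqF.
pose t := (k * a + l * b) / m.
have lin j p q (c d : R) : c + d = m -> c * li j p + d * li j q = m * li j ((c * p + d * q) / m).
  by move=> cd; rewrite /line; move: (y j) (sl j) (x j) => Y s X; rewrite -cd; field; rewrite cd.
have tE : li i t = li i' t.
  by apply: (mulfI m0'); rewrite -lin // {1}/t e1 -lin //.
have mt : m * t = k * a + l * b by rewrite /t; field.
have [ab Ba Bb nab] := ei; have [ab' Ba' Bb' nab'] := ei'.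
have at_ : a <= t by rewrite -(ler_pM2l m0) mt -kl; nra.
have tb : t <= b by rewrite -(ler_pM2l m0) mt -kl; nra.
have at' : a' <= t by rewrite -(ler_pM2l m0) mt e1 -kl'; nra.
have tb' : t <= b' by rewrite -(ler_pM2l m0) mt e1 -kl'; nra.
have pE : lpt i t = lpt i' t by rewrite /lpt tE.
have conc j (p q c d : R) : p < q -> c + d = m -> m * t = c * p + d * q -> t = p \/ t = q ->
    forall v, c * (v == lpt j p)%:R + d * (v == lpt j q)%:R = m * (v == lpt j t)%:R.
  move=> pq cd mE tpq v.
  have pt0 : lpt j p = lpt j q -> False by move=> [h _]; rewrite h ltxx in pq.
  case: tpq => te.
    have d0 : d = 0.
      have : d * (q - p) = 0 by move: mE; rewrite te -cd; lra.
      by move=> /eqP; rewrite mulf_eq0 subr_eq0 (gt_eqF pq) orbF => /eqP.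
    by rewrite te d0 mul0r addr0 -cd d0 addr0.
  have c0 : c = 0.
    have : c * (q - p) = 0 by move: mE; rewrite te -cd; lra.
    by move=> /eqP; rewrite mulf_eq0 subr_eq0 (gt_eqF pq) orbF => /eqP.
  by rewrite te c0 mul0r add0r -cd c0 add0r.
have [Bt|nBt] := pselect (isB (lpt i t)).
  have ends j p q : el j p q -> isB (lpt j t) -> p <= t -> t <= q -> t = p \/ t = q.
    move=> [_ _ _ npq] Bj pt_ tq.
    have [->|tp] := eqVneq t p; first by left.
    have [->|tq'] := eqVneq t q; first by right.
    by case: (npq t) => //; rewrite !lt_neqAle pt_ tq tq' eq_sym tp.
  move=> v.
  rewrite (conc i a b) //; last exact: ends ei Bt at_ tb.
  rewrite (conc i' a' b') ?pE //; first by rewrite mt e1.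
  by apply: (ends _ _ _ ei') => //; rewrite -pE.
have sii : sl i = sl i'.
  apply/eqP; apply: contraPT (nBt) => s h; apply: h; exact: isB_cross s tE.
have same := sameline_of sii tE.
have ei2 : el i a' b'.
  by apply: el_sameline ei'; rewrite /sameline eq_sym sii eqxx; case/andP: same => _; rewrite eq_sym.
have lE s : lpt i' s = lpt i s by rewrite /lpt (samelineE same).
have inn p q : el i p q -> p <= t -> t <= q -> p < t < q.
  move=> [_ Bp Bq _] pt_ tq; rewrite !lt_neqAle pt_ tq !andbT.
  by apply/andP; split; apply/eqP => h; apply: nBt; rewrite ?h // -h.
have [/andP[a1 b1] /andP[a2 b2]] := (inn _ _ ei at_ tb, inn _ _ ei2 at' tb').
have [_ Ba2 Bb2 nab2] := ei2.
have aa : a = a'.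
  have [h|h|//] := ltgtP a a'.
    by case: (nab a') => //; rewrite h (lt_trans a2).
  by case: (nab2 a) => //; rewrite h (lt_trans a1).
have bb : b = b'.
  have [h|h|//] := ltgtP b b'.
    by case: (nab2 b) => //; rewrite h andbT (lt_trans a2).
  by case: (nab b') => //; rewrite h andbT (lt_trans a1).
have ll : l = l'.
  have : (l - l') * (b - a) = 0 by move: e1 kl kl'; rewrite -aa -bb => e1 kl kl'; nra.
  by move=> /eqP; rewrite mulf_eq0 (subr_eq0 b) (gt_eqF ab) orbF subr_eq0 => /eqP.
have kk : k = k' by move: kl kl'; rewrite ll; lra.
by move=> v; rewrite kk ll aa bb !lE.
Qed.

End ElementarySegments.

Lemma nbhs0_right (R : realType) (N : set R) (e : R) : nbhs (0 : R) N -> 0 < e ->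
  exists t, [/\ 0 < t, t < e & N t].
Proof.
move=> /nbhs_ballP[d /= d0 h] e0; exists (Num.min d e / 2).
have m0 : 0 < Num.min d e by rewrite lt_min d0.
have md : Num.min d e <= d by rewrite ge_min lexx.
have me : Num.min d e <= e by rewrite ge_min lexx orbT.
split; [by rewrite divr_gt0|lra|].
by apply: h; rewrite -ball_normE /= sub0r normrN gtr0_norm ?divr_gt0 //; lra.
Qed.

(** Connectedness of the interval: the indicator function is continuous and would have to take the
    value 1/2. *)
Lemma locally_constant_bool (R : realType) (P : R -> bool) :
  (forall s : R, 0 <= s <= 1 -> \forall s' \near s, P s' = P s) -> P 0 = P 1.
Proof.
move=> loc; apply: contrapT => ne.
pose f s : R := if P s then 1 else 0.
have cf : {within `[0, 1], continuous f}.
  apply: continuous_in_subspaceT => s; rewrite inE /= in_itv /= => s01.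
  move=> B hB; have Bs : B (f s) by exact: nbhs_singleton hB.
  have := loc s s01; apply: (@filterS _ (nbhs s)) => s' h.
  by rewrite /= /f h.
have [|c _ fc] := @IVT R f 0 1 (1 / 2) ler01 cf.
  by move: ne; rewrite /f; case: (P 0); case: (P 1) => // _;
    rewrite ge_min le_max; apply/andP; split; apply/orP; by [left; lra|right; lra].
by move: fc; rewrite /f; case: (P c) => h; lra.
Qed.

(** * Fans over the cells of the line arrangement *)

Section Triangulation.
Variables (R : realType) (n : nat) (x y z w : 'I_n -> R).
Hypothesis gp : good_polygon x y z w.
Local Notation lv := (lval x y).
Local Notation sl := (slope x y).
Local Notation li := (line x y).
Local Notation oP := (onP x y).
Local Notation pt := (R * R)%type.
Local Notation lp := (lpt x y).
Local Notation same := (sameline x y).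
Local Notation pa := (par x y).
Local Notation mk := (mark x y).

Lemma lval_comb3 k a b c p q r : a + b + c = 1 ->
  lv k (comb3 a b c p q r) = a * lv k p + b * lv k q + c * lv k r.
Proof.
move=> s; rewrite /lval /comb3 /line /=.
move: (y k) (sl k) (x k) => Y S X; have -> : a = 1 - b - c by lra.
by ring.
Qed.

(** The segment from [u] to [v] keeps all signs, so it misses the polygon, and along it the parity
    is locally constant. *)
Lemma par_cell u v : (forall k, lv k u != 0) -> (forall k, Num.sg (lv k u) = Num.sg (lv k v)) ->
  pa u = pa v.
Proof.
move=> u0 uv.
pose r s : pt := comb3 (1 - s) s 0 u v v.
have rE k s : lv k (r s) = (1 - s) * lv k u + s * lv k v.
  by rewrite lval_comb3 ?mul0r ?addr0 //; ring.
have rn k s : 0 <= s <= 1 -> lv k (r s) != 0.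
  move=> /andP[s0 s1]; rewrite rE.
  have := uv k; have := u0 k.
  case: (sgrP (lv k u)) => [//|h _|h _].
    move=> /esym/eqP; rewrite sgr_cp0 => h'; rewrite gt_eqF //.
    have [->|s00] := eqVneq s 0; first by rewrite subr0 mul1r mul0r addr0.
    have s0' : 0 < s by rewrite lt_neqAle eq_sym s00.
    apply: ltr_wpDl; last exact: mulr_gt0.
    by apply: mulr_ge0; [rewrite subr_ge0|exact: ltW].
  move=> /esym/eqP; rewrite sgr_cp0 => h'; rewrite lt_eqF //.
  have [->|s00] := eqVneq s 0; first by rewrite subr0 mul1r mul0r addr0.
  have s0' : 0 < s by rewrite lt_neqAle eq_sym s00.
  apply: ltr_wnDl; last by rewrite pmulr_rlt0.
  by apply: mulr_ge0_le0; [rewrite subr_ge0|exact: ltW].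
have cr : continuous r by rewrite /r /comb3; cts.
have r0 : r 0 = u by rewrite /r /comb3; case: u {uv u0 rE rn r cr} => a b /=; congr pair; ring.
have r1 : r 1 = v by rewrite /r /comb3; case: v {uv u0 rE rn r cr r0} => a b /=; congr pair; ring.
rewrite -r0 -r1; apply: (@locally_constant_bool R (fun s => pa (r s))) => s s01.
have nP : ~~ oP (r s).
  by apply/existsP => -[k /andP[/eqP h _]]; have := rn k s s01; rewrite h eqxx.
have near_s : nbhs s (r @^-1` [set v | ~~ oP v /\ region x y v = region x y (r s)]).
  exact: (cr s _ (region_far gp nP)).
apply: filterS near_s => s' [h1 h2].
by move: h2; rewrite /region (negbTE nP) (negbTE h1).
Qed.

(** Far to the left, right or above, no edge is crossed. Far below, every edge over the abscissa is
    crossed, and the endpoint terms cancel around the cycle. *)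
Lemma par_far u (d : pt) : d != (0, 0) -> exists2 s : R, 0 <= s &
  pa (u.1 + s * d.1, u.2 + s * d.2) = false.
Proof.
case: d => d1 d2 d0 /=.
have fin (f : 'I_n -> R) : exists2 M : R, 0 <= M & forall i, f i <= M.
  exists (\sum_i `|f i|); first by rewrite sumr_ge0.
  move=> i; rewrite (bigD1 i) //=; apply: le_trans (ler_norm _) _.
  by rewrite lerDl sumr_ge0.
have [d10|d10|d10] := ltgtP d1 0.
- have [M M0 hM] := fin (fun i => (u.1 - x i + 1) / - d1).
  exists M => //; rewrite /par big1 // => i _; rewrite /crosses.
  have h j : rr x j (u.1 + M * d1, u.2 + M * d2) = false.
    apply/negbTE; rewrite /rr /= -ltNge.
    by have := hM j; rewrite ler_pdivrMr ?oppr_gt0 //; lra.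
  by rewrite !h.
- have [M M0 hM] := fin (fun i => (x i - u.1) / d1).
  exists M => //; rewrite /par big1 // => i _; rewrite /crosses.
  have h j : rr x j (u.1 + M * d1, u.2 + M * d2).
    by rewrite /rr /=; have := hM j; rewrite ler_pdivrMr //; lra.
  by rewrite !h.
have lE i s : lv i (u.1 + s * d1, u.2 + s * d2) = lv i u + s * d2.
  by rewrite /lval d10 mulr0 addr0 /=; ring.
have d20 : d2 != 0 by apply: contraNneq d0 => ->; rewrite d10.
have [d2n|d2p] := ltP d2 0; last first.
  have d2p' : 0 < d2 by rewrite lt_neqAle eq_sym d20.
  have [M M0 hM] := fin (fun i => - lv i u / d2).
  exists M => //; rewrite /par big1 // => i _; rewrite /crosses lE.
  have := hM i; rewrite ler_pdivrMr // => h.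
  by rewrite [_ < 0](_ : _ = false) ?andbF //; apply/negbTE; rewrite -leNgt; lra.
have [M M0 hM] := fin (fun i => (lv i u + 1) / - d2).
exists M => //; rewrite /par.
set v := (_, _).
transitivity (\big[addb/false]_(i < n) (rr x i v (+) rr x (ordS i) v)).
  apply: eq_bigr => i _; rewrite /crosses lE.
  have := hM i; rewrite ler_pdivrMr ?oppr_gt0 // => h.
  by rewrite [_ < 0](_ : _ = true) ?andbT //; lra.
rewrite big_split /= [X in _ (+) X](reindex_inj (can_inj (@ord_predK n))) /=.
under [X in _ (+) X]eq_bigr do rewrite ord_predK.
by rewrite addbb.
Qed.

(** Chosen as a function of the sign vector alone, so that all triangles of one cell share the same
    apex; the default belongs to empty cells. *)
Definition cen (s : 'I_n -> R) : pt :=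
  xget (0, 0) [set u : pt | forall k, Num.sg (lv k u) = s k].

Lemma cenP s u : (forall k, Num.sg (lv k u) = s k) -> forall k, Num.sg (lv k (cen s)) = s k.
Proof.
move=> h; rewrite /cen.
by have := @xgetPex pt (0, 0) [set u : pt | forall k, Num.sg (lv k u) = s k]; apply; exists u.
Qed.

(** The signs of the cell next to the segment: on the line of the segment itself they are dictated
    by the side [s], on all other lines they are read off at the midpoint. *)
Definition sgs i a b (s : bool) k : R :=
  if same i k then (if s then 1 else -1) else Num.sg (lv k (lp i ((a + b) / 2))).

Variable ep : R.
Hypothesis ep0 : 0 < ep.
Hypothesis ep_gap : forall i j k l, mk i j != mk k l -> 3 * ep < `|mk i j - mk k l|.
Local Notation elem := (el x y ep).

(* Every shaded cell is a fan around its centre [cen], with one triangle for each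
   elementary segment [el] of its boundary; [s] is the side of the line [i]. *)
Definition is_tri i a b s := elem i a b /\
  exists u, (forall k, Num.sg (lv k u) = sgs i a b s k) /\ pa u.

Definition tri i a b s : pt * pt * pt := (cen (sgs i a b s), lp i a, lp i b).

Lemma sgs_cases i a b s k : elem i a b -> sgs i a b s k = 1 \/ sgs i a b s k = -1.
Proof.
move=> e; rewrite /sgs; case: ifP => [_|/negbT h]; first by case: s; [left|right].
have := el_nonzero e (t := (a + b) / 2) _ h.
have [ab _ _ _] := e; have -> : a < (a + b) / 2 < b by apply/andP; split; lra.
by move=> /(_ isT); case: sgrP => // _ _; [left|right].
Qed.

Lemma sgs_vertex i a b s k t : elem i a b -> a <= t <= b -> 0 <= sgs i a b s k * lv k (lp i t).
Proof.
move=> e tab; rewrite /sgs; case: ifP => [h|/negbT h].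
  by rewrite -(sameline_lval _ h) lval_lpt mulr0.
have [ab _ _ _] := e; apply: (el_sign e) => //.
by apply/andP; split; lra.
Qed.

Lemma tri_cen i a b s : is_tri i a b s -> forall k, Num.sg (lv k (cen (sgs i a b s))) = sgs i a b s k.
Proof. by move=> [_ [u [h _]]]; exact: cenP h. Qed.

Lemma tri_cen_pos i a b s k : is_tri i a b s -> 0 < sgs i a b s k * lv k (cen (sgs i a b s)).
Proof.
move=> h; have := tri_cen h k; have [e _] := h.
by case: (sgs_cases s k e) => -> /eqP; rewrite sgr_cp0 ?mul1r ?mulN1r ?oppr_gt0.
Qed.

Lemma tri_lower i a b s k c0 c1 c2 : is_tri i a b s -> 0 <= c1 -> 0 <= c2 -> c0 + c1 + c2 = 1 ->
  c0 * (sgs i a b s k * lv k (cen (sgs i a b s))) <=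
  sgs i a b s k * lv k (comb3 c0 c1 c2 (cen (sgs i a b s)) (lp i a) (lp i b)).
Proof.
move=> h p1 p2 sum; rewrite lval_comb3 //.
have [e _] := h; have [ab _ _ _] := e.
have h1 : 0 <= sgs i a b s k * lv k (lp i a) by apply: sgs_vertex; rewrite ?lexx ?ltW.
have h2 : 0 <= sgs i a b s k * lv k (lp i b) by apply: sgs_vertex; rewrite ?lexx ?ltW.
have := mulr_ge0 p1 h1; have := mulr_ge0 p2 h2.
by move: (sgs i a b s k) (lv k _) (lv k _) (lv k _) => S A B C; lra.
Qed.

Lemma tri_sign i a b s k c0 c1 c2 : is_tri i a b s -> 0 < c0 -> 0 <= c1 -> 0 <= c2 ->
  c0 + c1 + c2 = 1 ->
  Num.sg (lv k (comb3 c0 c1 c2 (cen (sgs i a b s)) (lp i a) (lp i b))) = sgs i a b s k.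
Proof.
move=> h p0 p1 p2 sum.
have := tri_lower k h p1 p2 sum; have := mulr_gt0 p0 (tri_cen_pos k h).
move=> q1 q2; have := lt_le_trans q1 q2; have [e _] := h.
by case: (sgs_cases s k e) => ->; rewrite ?mul1r ?mulN1r ?oppr_gt0 => h';
  apply/eqP; rewrite sgr_cp0.
Qed.

Lemma tri_side0 i a b s c1 c2 : is_tri i a b s -> c1 + c2 = 1 ->
  lv i (comb3 0 c1 c2 (cen (sgs i a b s)) (lp i a) (lp i b)) = 0.
Proof. by move=> h sum; rewrite lval_comb3 ?add0r // !lval_lpt !mulr0 mul0r !addr0. Qed.

Lemma tri_lval i a b s c0 c1 c2 : c0 + c1 + c2 = 1 ->
  lv i (comb3 c0 c1 c2 (cen (sgs i a b s)) (lp i a) (lp i b)) = c0 * lv i (cen (sgs i a b s)).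
Proof. by move=> sum; rewrite lval_comb3 // !lval_lpt !mulr0 !addr0. Qed.

Lemma sg_sgs i a b s k : elem i a b -> sgs i a b s k * sgs i a b s k = 1.
Proof. by move=> e; case: (sgs_cases s k e) => ->; rewrite ?mulrNN mul1r. Qed.

(** A positive apex coordinate puts the point into the open cell, a zero one onto a line; so both
    are zero or both positive. If positive, the cells agree, and so do the apex coordinates, since
    the distance to either outer line is at least the apex share, with equality for its own
    triangle. The rest is the one-dimensional statement [el_mass]. *)
Lemma tri_inj i a b s i' a' b' s' c0 c1 c2 d0 d1 d2 :
  is_tri i a b s -> is_tri i' a' b' s' ->
  0 <= c0 -> 0 <= c1 -> 0 <= c2 -> c0 + c1 + c2 = 1 ->
  0 <= d0 -> 0 <= d1 -> 0 <= d2 -> d0 + d1 + d2 = 1 ->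
  comb3 c0 c1 c2 (cen (sgs i a b s)) (lp i a) (lp i b) =
  comb3 d0 d1 d2 (cen (sgs i' a' b' s')) (lp i' a') (lp i' b') ->
  mass3 c0 c1 c2 (cen (sgs i a b s)) (lp i a) (lp i b) =1
  mass3 d0 d1 d2 (cen (sgs i' a' b' s')) (lp i' a') (lp i' b').
Proof.
move=> h h' p0 p1 p2 sp q0 q1 q2 sq e.
have [eT _] := h; have [eT' _] := h'.
have seg m : 0 < m -> c1 + c2 = m -> d1 + d2 = m ->
    c1 * a + c2 * b = d1 * a' + d2 * b' ->
    c1 * li i a + c2 * li i b = d1 * li i' a' + d2 * li i' b' ->
    forall v, c1 * (v == lp i a)%:R + c2 * (v == lp i b)%:R =
              d1 * (v == lp i' a')%:R + d2 * (v == lp i' b')%:R.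
  by move=> m0 s1 s2 e1 e2; apply: (el_mass eT eT' p1 p2 q1 q2 m0).
have mixed j c d r k0 k1 k2 j' c' d' r' l1 l2 : is_tri j c d r -> is_tri j' c' d' r' ->
    0 < k0 -> 0 <= k1 -> 0 <= k2 -> k0 + k1 + k2 = 1 -> l1 + l2 = 1 ->
    comb3 k0 k1 k2 (cen (sgs j c d r)) (lp j c) (lp j d) =
    comb3 0 l1 l2 (cen (sgs j' c' d' r')) (lp j' c') (lp j' d') -> False.
  move=> t t' r0 r1 r2 rs ls ee; have [et _] := t.
  have := tri_sign j' t r0 r1 r2 rs; rewrite ee tri_side0 // sgr0 => /esym h0.
  have := sg_sgs r j' et; rewrite h0 mul0r => /eqP.
  by rewrite eq_sym oner_eq0.
have [c00|c00] := eqVneq c0 0; have [d00|d00] := eqVneq d0 0.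
- move: sp sq e; rewrite c00 d00 !add0r => sp sq e v; rewrite /mass3 !mul0r !add0r.
  move: e; rewrite /comb3 /= !mul0r !add0r => -[e1 e2].
  exact: (seg 1).
- exfalso; move: sp e; rewrite c00 add0r => sp e.
  have q0' : 0 < d0 by rewrite lt_neqAle eq_sym d00.
  exact: (mixed _ _ _ _ _ _ _ _ _ _ _ _ _ h' h q0' q1 q2 sq sp (esym e)).
- exfalso; move: sq e; rewrite d00 add0r => sq e.
  have p0' : 0 < c0 by rewrite lt_neqAle eq_sym c00.
  exact: (mixed _ _ _ _ _ _ _ _ _ _ _ _ _ h h' p0' p1 p2 sp sq e).
have p0' : 0 < c0 by rewrite lt_neqAle eq_sym c00.
have q0' : 0 < d0 by rewrite lt_neqAle eq_sym d00.
have ss : sgs i a b s = sgs i' a' b' s'.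
  apply/funext => k; rewrite -(tri_sign k h p0' p1 p2 sp) e.
  exact: tri_sign.
have cd : c0 = d0.
  apply/eqP; rewrite eq_le; apply/andP; split.
    have := tri_lower i' h p1 p2 sp; rewrite e tri_lval //.
    have := tri_cen_pos i' h'; rewrite ss => g0.
    by rewrite [leRHS]mulrCA (ler_pM2r g0).
  have := tri_lower i h' q1 q2 sq; rewrite -e tri_lval //.
  have := tri_cen_pos i h; rewrite -ss => g0.
  by rewrite [leRHS]mulrCA (ler_pM2r g0).
move: e; rewrite -ss -cd /comb3 /= => -[e1 e2].
move=> v; rewrite /mass3 -!addrA; congr (_ + _).
have [m0|m0] := eqVneq (c1 + c2) 0.
  have [z1 z2] : c1 = 0 /\ c2 = 0 by split; lra.
  have [z3 z4] : d1 = 0 /\ d2 = 0 by split; lra.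
  by rewrite z1 z2 z3 z4 !mul0r.
have m0' : 0 < c1 + c2 by rewrite lt_neqAle eq_sym m0 addr_ge0.
by apply: (seg (c1 + c2)) => //; lra.
Qed.

(** Points with positive apex coordinate lie in a shaded cell. Points of the outer side are limits
    of these, and off the polygon membership is locally constant. *)
Lemma tri_sub_region i a b s c0 c1 c2 : is_tri i a b s ->
  0 <= c0 -> 0 <= c1 -> 0 <= c2 -> c0 + c1 + c2 = 1 ->
  region x y (comb3 c0 c1 c2 (cen (sgs i a b s)) (lp i a) (lp i b)).
Proof.
move=> h p0 p1 p2 sum; set o := cen _.
have pos d0 d1 d2 : 0 < d0 -> 0 <= d1 -> 0 <= d2 -> d0 + d1 + d2 = 1 ->
    region x y (comb3 d0 d1 d2 o (lp i a) (lp i b)).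
  move=> q0 q1 q2 sd; rewrite /region; apply/orP; right.
  have [eT [u [hu pu]]] := h; rewrite -(par_cell (u := u)) //.
    move=> k; apply: contraTneq isT => uk; have := sg_sgs s k eT.
    by rewrite -hu uk sgr0 mul0r => /eqP; rewrite eq_sym oner_eq0.
  by move=> k; rewrite hu (tri_sign k h).
have [c00|c00] := eqVneq c0 0; last by apply: pos => //; rewrite lt_neqAle eq_sym c00.
apply: contrapT => /negP nr.
pose r t : pt := comb3 t ((1 - t) * c1) ((1 - t) * c2) o (lp i a) (lp i b).
have cr : continuous r by rewrite /r /comb3; cts.
have r0 : r 0 = comb3 c0 c1 c2 o (lp i a) (lp i b) by rewrite /r c00 subr0 !mul1r.
have nP : ~~ oP (r 0) by apply: contraNN nr; rewrite r0 /region => ->.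
have := cr 0 _ (region_far gp nP).
move=> /nbhs0_right/(_ ltr01)[t [t0 t1 [_ ht]]].
by move: nr; rewrite -r0 -ht pos // ?mulr_ge0 ?subr_ge0 ?(ltW t1) //; nra.
Qed.

End Triangulation.

Lemma finite_min (R : realType) (I : finType) (P : pred I) (f : I -> R) :
  (exists i, P i) -> exists2 i, P i & forall j, P j -> f i <= f j.
Proof.
move=> [i0 Pi0].
by exists [arg min_(i < i0 | P i) f i]%O; case: arg_minP => // i Pi hi.
Qed.

(** Where the next function vanishes, a small step along its gradient makes it positive and is too
    short to disturb the earlier ones. *)
Lemma affine_generic (R : realType) (I : finType) (a b c : I -> R) (u0 : R * R)
    (N : set (R * R)) : (forall i, a i ^+ 2 + b i ^+ 2 != 0) -> nbhs u0 N ->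
  exists u, N u /\ forall i, a i * u.1 + b i * u.2 + c i != 0.
Proof.
move=> nz nN; pose f i (u : R * R) := a i * u.1 + b i * u.2 + c i.
have cf i : continuous (f i) by rewrite /f; cts.
suff : exists u, nbhs u N /\ forall i, i \in enum I -> f i u != 0.
  move=> [u [nu hu]]; exists u; split; first exact: nbhs_singleton nu.
  by move=> i; apply: hu; rewrite mem_enum.
elim: (enum I) => [|j s [u [nu hu]]]; first by exists u0.
have [fju|fju] := eqVneq (f j u) 0; last first.
  by exists u; split=> // i; rewrite inE => /orP[/eqP->|]; last exact: hu.
have ns : \forall v \near u, forall i, i \in s -> f i v != 0.
  apply: (@filter_forall _ _ (fun i v => i \in s -> f i v != 0) (nbhs u)) => i.
  have [si|nsi] := boolP (i \in s); last by apply: nearW.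
  by apply: filterS (near_neq0 (cf i) (hu i si)) => v h _; exact: h.
have nN' := filterI nu ns.
have nI : nbhs u (N `&` [set v | forall i, i \in s -> f i v != 0])°.
  apply: nbhs_interior; exact: nN'.
pose r (t : R) : R * R := (u.1 + t * a j, u.2 + t * b j).
have cr : continuous r by rewrite /r; cts.
have r0 : r 0 = u by rewrite /r !mul0r !addr0 -surjective_pairing.
have : nbhs (0 : R) (r @^-1` (N `&` [set v | forall i, i \in s -> f i v != 0])°).
  by apply: cr; rewrite r0.
move=> /nbhs0_right/(_ ltr01)[t [t0 _ ht]].
exists (r t); split; first by apply: filterS ht => v [].
have [_ hs] := nbhs_singleton ht.
move=> i; rewrite inE => /orP[/eqP->|]; last exact: hs.
have -> : f j (r t) = f j u + t * (a j ^+ 2 + b j ^+ 2) by rewrite /f /r /=; ring.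
by rewrite fju add0r mulf_neq0 // gt_eqF.
Qed.

(** * Counting the triangles and covering the shaded cells *)

Section TriangleList.
Variables (R : realType) (n : nat) (x y z w : 'I_n -> R).
Hypothesis gp : good_polygon x y z w.
Local Notation lv := (lval x y).
Local Notation sl := (slope x y).
Local Notation li := (line x y).
Local Notation pt := (R * R)%type.
Local Notation lp := (lpt x y).
Local Notation same := (sameline x y).
Local Notation pa := (par x y).
Local Notation mk := (mark x y).
Variable ep : R.
Hypothesis ep0 : 0 < ep.
Hypothesis ep_gap : forall i j k l, mk i j != mk k l -> 3 * ep < `|mk i j - mk k l|.
Local Notation elem := (el x y ep).
Local Notation isb := (isB x y ep).
Local Notation bas := (base x y ep).
Local Notation istri := (is_tri x y ep).
Local Notation tr := (tri x y).
Local Notation sg := (sgs x y).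
Local Notation ce := (cen x y).

Lemma sameline_sym i j : same i j -> same j i.
Proof. by rewrite /sameline eq_sym (eq_sym (li i 0)). Qed.

Lemma sameline_trans i j k : same i j -> same j k -> same i k.
Proof. by rewrite /sameline => /andP[/eqP-> /eqP->]. Qed.

Lemma lpt_sameline i j t : same i j -> lp i t = lp j t.
Proof. by move=> h; rewrite /lpt (samelineE h). Qed.

Lemma sgs_sameline i j a b s : same i j -> sg i a b s = sg j a b s.
Proof.
move=> ij; apply/funext => k; rewrite /sgs (lpt_sameline _ ij).
suff -> : same i k = same j k by [].
by apply/idP/idP; apply: sameline_trans => //; exact: sameline_sym.
Qed.

Lemma is_tri_sameline i j a b s : same i j -> istri i a b s -> istri j a b s.
Proof.
move=> ij [e [u h]]; split; first exact: el_sameline ij e.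
by exists u; rewrite -(sgs_sameline _ _ _ ij).
Qed.

(** Two lines, one of three marks and a side determine the triangle, the right end being the next
    base point [nxt]. Coinciding lines yield the same triangle, so every triangle has such a
    name. *)
Lemma tri_list : exists L : seq (pt * pt * pt), [/\ (size L <= 6 * n ^ 2)%N,
  forall t, t \in L -> exists i a b s, istri i a b s /\ t = tr i a b s &
  forall i a b s, istri i a b s -> tr i a b s \in L].
Proof.
pose nxt i a := xget 0 [set b | elem i a b].
pose J : finType := ('I_n * 'I_n * 'I_3 * bool)%type.
pose A (q : J) : R := bas q.1.1.1 q.1.1.2 q.1.2.
pose valid (q : J) := `[< istri q.1.1.1 (A q) (nxt q.1.1.1 (A q)) q.2 >].
pose T (q : J) := tr q.1.1.1 (A q) (nxt q.1.1.1 (A q)) q.2.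
exists [seq T q | q <- enum J & valid q]; split.
- rewrite size_map size_filter (leq_trans (count_size _ _)) // -cardE.
  by rewrite !card_prod !card_ord card_bool -mulnn; lia.
- move=> t /mapP[q]; rewrite mem_filter => /andP[/asboolP h _] ->.
  by exists q.1.1.1, (A q), (nxt q.1.1.1 (A q)), q.2.
- move=> i a b s h; have [e _] := h; have [_ Ba _ _] := e.
  have /isB_line[j [l [k [ji aE]]]] := Ba.
  have ij := sameline_sym ji.
  have h' := is_tri_sameline ij h; have [e' _] := h'.
  have nb : nxt j a = b.
    have : elem j a (nxt j a) by apply: (@xgetPex _ 0 [set b | elem j a b]); exists b.
    by move=> e''; exact: el_unique e'' e'.
  apply/mapP; exists (j, l, k, s); last first.
    by rewrite /T /A /= -aE nb /tri (sgs_sameline _ _ _ ij) !(lpt_sameline _ ij).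
  by rewrite mem_filter mem_enum andbT /valid /A /= -aE nb; apply/asboolP.
Qed.

Lemma sg_mul_gt0 (a b : R) : Num.sg a = Num.sg b -> a != 0 -> 0 < Num.sg b * a.
Proof. by move=> <- a0; rewrite -normrEsg normr_gt0. Qed.

(* The triangle through [u] is found by following the ray from the centre of the
   cell of [u] through [u] until it leaves the cell; the cell is bounded since
   the parity vanishes far away. *)
Lemma cover u : (forall k, lv k u != 0) -> pa u ->
  (forall v, isb v -> let o := ce (fun k => Num.sg (lv k u)) in
     (v.1 - o.1) * (u.2 - o.2) - (v.2 - o.2) * (u.1 - o.1) != 0) ->
  exists i a b s c0 c1 c2, [/\ istri i a b s, [/\ 0 <= c0, 0 <= c1 & 0 <= c2],
    c0 + c1 + c2 = 1 & u = comb3 c0 c1 c2 (ce (sg i a b s)) (lp i a) (lp i b)].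
Proof.
move=> u0 pu; set sig := fun k => Num.sg (lv k u) => /= gen.
pose o := ce sig.
have ho k : Num.sg (lv k o) = sig k by apply: (@cenP _ _ _ _ sig u).
have o0 k : lv k o != 0 by rewrite -sgr_eq0 ho sgr_eq0.
have U0 k : 0 < sig k * lv k u by exact: sg_mul_gt0.
have O0 k : 0 < sig k * lv k o by apply: sg_mul_gt0; rewrite ?ho.
have ss k : sig k * sig k = 1.
  by rewrite /sig; case: sgrP (u0 k) => // _ _; rewrite ?mulrNN mulr1.
have sig_eq k t : 0 < sig k * t -> Num.sg t = sig k.
  move=> h; have : Num.sg (sig k * t) = 1 by apply/eqP; rewrite sgr_cp0.
  rewrite sgrM /sig sgr_id -/(sig k) => e.
  by rewrite -[LHS]mul1r -(ss k) -mulrA e mulr1.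
(* A ray that keeps all signs of [u] stays in the cell, where the parity is odd, against
   [par_far]. *)
have stays (q : R -> pt) (d : pt) : d != (0, 0) -> (exists v : pt, forall s, q s = (v.1 + s * d.1, v.2 + s * d.2)) ->
    (forall s k, 0 <= s -> 0 < sig k * lv k (q s)) -> False.
  move=> d0 [v qE] h; have [s s0] := @par_far _ _ x y v d d0.
  rewrite -qE -(par_cell gp (u := u)) ?pu // => k.
  by rewrite (sig_eq k (lv k (q s))) // h.
pose r (k : R) : pt := (o.1 + k * (u.1 - o.1), o.2 + k * (u.2 - o.2)).
have rE j k : lv j (r k) = (1 - k) * lv j o + k * lv j u.
  by rewrite /lval /line /r /=; ring.
have d0 : (u.1 - o.1, u.2 - o.2) != (0, 0).
  apply/eqP => -[e1 e2].
  have [i _] : exists i : 'I_n, true.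
    apply: contrapT => none; move: pu; rewrite /par big1 // => i _.
    by exfalso; apply: none; exists i.
  have Bi : isb (lp i (bas i i 1)) by exists i, i, 1.
  by have := gen _ Bi; rewrite -/o e1 e2 !mulr0 subr0 eqxx.
(* The lines that the ray approaches. The quotient below is the parameter at which the ray meets
   line [j]; its minimum [K] is the exit from the cell. *)
pose dec j := 0 < sig j * (lv j o - lv j u).
have [|i di imin] := @finite_min R _ dec (fun j => lv j o / (lv j o - lv j u)).
  apply: contrapT => none; apply: (stays r _ d0); first by exists o.
  move=> s k s0; rewrite rE.
  have : ~~ dec k by apply/negP => h; apply: none; exists k.
  rewrite /dec -leNgt => h; have := O0 k; have := mulr_ge0 s0 (_ : 0 <= - (sig k * (lv k o - lv k u))).
  by rewrite oppr_ge0 => /(_ h); move: (sig k) (lv k o) (lv k u) => S A B; lra.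
have den0 j : dec j -> lv j o - lv j u != 0.
  by move=> dj; apply: contraTneq dj => e; rewrite /dec e mulr0 ltxx.
pose K := lv i o / (lv i o - lv i u).
have K1 : 1 < K.
  have -> : K = (sig i * lv i o) / (sig i * (lv i o - lv i u)).
    have s0 : sig i != 0 by apply: contraTneq (U0 i) => ->; rewrite mul0r ltxx.
    by rewrite /K; field; rewrite s0 den0.
  rewrite ltr_pdivlMr // mul1r; have := U0 i; move: (sig i) (lv i o) (lv i u) => S A B; lra.
have K0 : 0 < K by lra.
have ei : lv i (r K) = 0.
  by have h := den0 i di; rewrite rE /K; field; exact: h.
have ew j : 0 <= sig j * lv j (r K).
  rewrite rE; have [dj|] := boolP (dec j); last first.
    rewrite /dec -leNgt => h; have := O0 j; have := mulr_ge0 (ltW K0) (_ : 0 <= - (sig j * (lv j o - lv j u))).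
    by rewrite oppr_ge0 => /(_ h); clear; clearbody K; lra.
  have := imin j dj; rewrite -/K.
  have -> : lv j o / (lv j o - lv j u) = (sig j * lv j o) / (sig j * (lv j o - lv j u)).
    have s0 : sig j != 0 by apply: contraTneq (U0 j) => ->; rewrite mul0r ltxx.
    by field; rewrite s0 den0.
  by rewrite ler_pdivlMr //; clear; clearbody K; lra.
pose t := (r K).1.
have eE : r K = lp i t by exact: lval0.
have nBe : ~ isb (lp i t).
  rewrite -eE => /gen; rewrite -/o /r /= => /eqP[].
  by ring.
have es j : ~~ same i j -> 0 < sig j * lv j (lp i t).
  move=> nij; rewrite lt_neqAle -eE ew andbT eq_sym mulf_eq0 sgr_eq0 (negbTE (u0 j)) /=.
  rewrite eE; apply/eqP => h; have e : li i t = li j t.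
    by move/eqP: h; rewrite /lval subr_eq0 => /eqP.
  have [s|s] := eqVneq (sl i) (sl j); last by apply: nBe; exact: isB_cross s e.
  by move: nij; rewrite (sameline_of s e).
(* If line [i] had no base point on one side of the exit point, the ray from [u] parallel to line
   [i] in that direction would cross no line and never leave the cell. *)
have side (ta : R) : ta ^+ 2 = 1 -> exists T, isb (lp i T) /\ 0 < ta * (T - t).
  move=> ta2; apply: contrapT => none.
  have tan : ta != 0 by apply: contraTneq isT => e; move/eqP: ta2; rewrite e expr0n eq_sym oner_eq0.
  apply: (stays (fun s => (u.1 + s * ta, u.2 + s * (ta * sl i))) (ta, ta * sl i)).
  - by apply/eqP => -[/eqP]; rewrite (negbTE tan).
  - by exists u.
  move=> s k s0.
  have -> : lv k (u.1 + s * ta, u.2 + s * (ta * sl i)) = lv k u + s * (ta * (sl i - sl k)).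
    by rewrite /lval /line /=; ring.
  rewrite mulrDr ltr_pwDl // mulrCA mulr_ge0 //.
  have [sik|sik] := eqVneq (sl i) (sl k); first by rewrite sik subrr !mulr0.
  have sk0 : sl i - sl k != 0 by rewrite subr_eq0.
  have nik : ~~ same i k by apply: contraNN sik => /sameline_slope ->.
  rewrite leNgt; apply/negP => neg; apply: none.
  pose T := t - lv k (lp i t) / (sl i - sl k).
  have lT : lv k (lp i T) = 0.
    rewrite lval_line /T; have := lval_line x y k i t; move: (lv k (lp i t)) => L LE.
    have -> : lv k (lp i 0) = L - (sl i - sl k) * t by rewrite LE; ring.
    by field.
  exists T; split.
    by apply: (@isB_cross _ _ _ _ ep i k) => //; move/eqP: lT; rewrite /lval subr_eq0 => /eqP.
  have -> : ta * (T - t) = (sig k * lv k (lp i t)) / - (sig k * (ta * (sl i - sl k))).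
    have s0' : sig k != 0 by apply: contraTneq (U0 k) => ->; rewrite mul0r ltxx.
    rewrite /T; move: (lv k (lp i t)) => L.
    rewrite -[RHS]mul1r -[in RHS]ta2.
    by field; rewrite tan s0' sk0.
  by rewrite divr_gt0 ?oppr_gt0 // es.
pose J : finType := ('I_n * 'I_n * 'I_3)%type.
pose B (q : J) := bas q.1.1 q.1.2 q.2.
have Bq T : isb (lp i T) <-> exists q : J, same q.1.1 i /\ T = B q.
  split; first by move=> /isB_line[j [l [k [? ?]]]]; exists (j, l, k).
  by move=> [[[j l] k] [? ?]]; apply/isB_line; exists j, l, k.
have [q /andP[qi qt] qmin] : exists2 q, same q.1.1 i && (t < B q) &
    forall q', same q'.1.1 i && (t < B q') -> B q <= B q'.
  apply: finite_min; have [|T [/Bq[q [qi ->]] h]] := side 1; first by rewrite expr1n.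
  by exists q; rewrite qi; move: h; rewrite mul1r subr_gt0.
have [p /andP[pi pt_] pmax] : exists2 q, same q.1.1 i && (B q < t) &
    forall q', same q'.1.1 i && (B q' < t) -> - B q <= - B q'.
  apply: (@finite_min R _ _ (fun q => - B q)).
  have [|T [/Bq[q' [qi' ->]] h]] := side (-1); first by rewrite sqrrN expr1n.
  by exists q'; rewrite qi'; move: h; rewrite mulN1r oppr_gt0 subr_lt0.
set b := B q in qt qmin; set a := B p in pt_ pmax.
have ab : a < b by exact: lt_trans pt_ qt.
have eab : elem i a b.
  split=> //; [by apply/Bq; exists p|by apply/Bq; exists q|].
  move=> T /andP[aT Tb] BT; have [q' [qi' TE]] := (iffLR (Bq T)) BT.
  have [Tt|Tt|Tt] := ltgtP T t.
  - by have := pmax q'; rewrite qi' -TE Tt lerN2 leNgt aT => /(_ isT).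
  - by have := qmin q'; rewrite qi' -TE Tt leNgt Tb => /(_ isT).
  - by apply: nBe; rewrite -Tt.
have sgE : sg i a b (sig i == 1) = sig.
  apply/funext => k; rewrite /sgs; case: ifP => [ik|/negbT ik].
    have -> : sig k = sig i by rewrite /sig (sameline_lval _ ik).
    by have := U0 i; rewrite /sig; case: sgrP (u0 i) => // _ _ _; rewrite ?eqxx // eq_sym -subr_eq0 opprK (_ : 1 + 1 = 2%:R) ?pnatr_eq0.
  apply: (sig_eq k); rewrite lt_neqAle eq_sym; apply/andP; split.
    rewrite mulf_neq0 ?sgr_eq0 //; apply: (el_nonzero eab) => //.
    by apply/andP; split; lra.
  rewrite -(sig_eq _ _ (es k ik)); apply: (el_sign eab) => //; first by rewrite pt_.
  by apply/andP; split; lra.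
exists i, a, b, (sig i == 1).
have ba0 : b - a != 0 by rewrite subr_eq0 gt_eqF.
have Kn : K != 0 by rewrite gt_eqF.
(* The point [u] divides the segment from the centre to the exit point [r K] in the ratio given by
   [K]; the exit point in turn divides the segment from [a] to [b]. *)
exists (1 - K^-1), (K^-1 * ((b - t) / (b - a))), (K^-1 * ((t - a) / (b - a))).
rewrite sgE -/o; split.
- by split=> //; exists u; split=> // k; rewrite sgE.
- have Ki : 0 < K^-1 by rewrite invr_gt0.
  split.
  + by rewrite subr_ge0 invf_le1 // ltW.
  + by rewrite mulr_ge0 ?(ltW Ki) // divr_ge0 // subr_ge0 ltW.
  + by rewrite mulr_ge0 ?(ltW Ki) // divr_ge0 // subr_ge0 ltW.
- by field; rewrite ba0 Kn.
- have tE : t = o.1 + K * (u.1 - o.1) by [].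
  have lE : li i t = o.2 + K * (u.2 - o.2) by have := congr1 snd eE => /= <-.
  rewrite /comb3 /lpt /=.
  have -> : (1 - K^-1) * o.1 + K^-1 * ((b - t) / (b - a)) * a + K^-1 * ((t - a) / (b - a)) * b = u.1.
    transitivity ((1 - K^-1) * o.1 + K^-1 * t); first by field; rewrite ba0 Kn.
    by rewrite tE; field.
  have -> : (1 - K^-1) * o.2 + K^-1 * ((b - t) / (b - a)) * li i a + K^-1 * ((t - a) / (b - a)) * li i b = u.2.
    transitivity ((1 - K^-1) * o.2 + K^-1 * li i t); last by rewrite lE; field.
    by rewrite /line; field; rewrite ba0 Kn.
  by rewrite -surjective_pairing.
Qed.

End TriangleList.

(** * Closed unions of plane triangles *)

Section PlaneTriangles.
Variable R : realType.
Local Notation pt := (R * R)%type.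

Definition hull3 (t : pt * pt * pt) : set pt := [set u | exists c0 c1 c2,
  [/\ 0 <= c0, 0 <= c1, 0 <= c2, c0 + c1 + c2 = 1 & u = comb3 c0 c1 c2 t.1.1 t.1.2 t.2]].

Definition union3 (L : seq (pt * pt * pt)) : set pt := [set u | exists2 t, t \in L & hull3 t u].

Lemma compact_hull3 t : compact (hull3 t).
Proof.
have -> : hull3 t = (fun q : R * R =>
    comb3 (1 - q.1) (q.1 * (1 - q.2)) (q.1 * q.2) t.1.1 t.1.2 t.2) @`
    (`[0, 1]%classic `*` `[0, 1]%classic).
  apply/seteqP; split=> u /=.
    move=> [a [b [c [a0 b0 c0 s ->]]]].
    have [bc|bc] := eqVneq (b + c) 0.
      exists (0, 0); rewrite /= ?in_itv /= ?lexx ?ler01 //.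
      have [-> [-> ->]] : a = 1 /\ b = 0 /\ c = 0 by split; [|split]; lra.
      by rewrite subr0 !mul0r.
    exists (b + c, c / (b + c)); rewrite /= ?in_itv /=.
      have bc0 : 0 < b + c by rewrite lt_neqAle eq_sym bc addr_ge0.
      split; apply/andP; split; rewrite ?divr_ge0 ?ler_pdivrMr //; lra.
    by rewrite (_ : 1 - (b + c) = a); [congr comb3; field|lra].
  move=> [[u1 v1] /= []]; rewrite !in_itv /= => /andP[u0 u1'] /andP[v0 v1'] <-.
  exists (1 - u1), (u1 * (1 - v1)), (u1 * v1); split=> //; try ring.
  - lra.
  - by rewrite mulr_ge0 // subr_ge0.
  - by rewrite mulr_ge0.
apply: continuous_compact; last by apply: compact_setX; exact: segment_compact.
by apply: continuous_subspaceT; rewrite /comb3; cts.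
Qed.

Lemma hausdorff_plane : hausdorff_space pt.
Proof. exact: norm_hausdorff. Qed.

Lemma closed_hull3 t : closed (hull3 t).
Proof. exact: compact_closed hausdorff_plane (@compact_hull3 t). Qed.

Lemma union3_cons t L : union3 (t :: L) = hull3 t `|` union3 L.
Proof.
apply/seteqP; split=> u.
  move=> [s]; rewrite inE => /orP[/eqP->|sT] h; first by left.
  by right; exists s.
case=> [h|[s sT h]]; first by exists t; rewrite ?mem_head.
by exists s; rewrite // inE sT orbT.
Qed.

Lemma closed_union3 L : closed (union3 L).
Proof.
elim: L => [|t L IH].
  rewrite (_ : union3 _ = set0); first exact: closed0.
  by apply/seteqP; split=> u // -[].
by rewrite union3_cons; apply: closedU => //; exact: closed_hull3.
Qed.

End PlaneTriangles.

(** * The triangulated region and functions linear on its triangles *)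

Section RegionTriangulation.
Variables (R : realType) (n : nat) (x y z w : 'I_n -> R).
Hypothesis gp : good_polygon x y z w.
Local Notation lv := (lval x y).
Local Notation sl := (slope x y).
Local Notation li := (line x y).
Local Notation oP := (onP x y).
Local Notation pt := (R * R)%type.
Local Notation lp := (lpt x y).
Local Notation pa := (par x y).
Local Notation mk := (mark x y).
Variable ep : R.
Hypothesis ep0 : 0 < ep.
Hypothesis ep_gap : forall i j k l, mk i j != mk k l -> 3 * ep < `|mk i j - mk k l|.
Local Notation bas := (base x y ep).
Local Notation istri := (is_tri x y ep).
Local Notation tr := (tri x y).
Local Notation sg := (sgs x y).
Local Notation ce := (cen x y).

(** The region is the closure of its interior: every local model, be it a half plane or a pair of
    opposite sectors, has interior points arbitrarily close by. *)
Lemma region_regular u0 (N : set pt) : region x y u0 -> nbhs u0 N ->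
  exists u1 : pt, nbhs u1 (N `&` [set u | region x y u]).
Proof.
move=> r0 nN; have [P0|nP0] := boolP (oP u0); last first.
  exists u0; apply: filterI nN _; apply: filterS (region_far gp nP0) => u [_ /= ->].
  exact: r0.
have half : halfplane_at x y u0 -> exists u1 : pt, nbhs u1 (N `&` [set u | region x y u]).
  move=> [T [T' [[cT cT' TK T'K] T0 hT]]].
  have nI : nbhs u0 (N `&` [set u | region x y u = (0 <= (T u).2)])°.
    by apply: nbhs_interior; apply: filterI.
  pose r (t : R) := T' (0, t).
  have c0 : continuous (fun t : R => (0 : R, t)) by cts.
  have cr : continuous r := cts_comp cT' c0.
  have r00 : r 0 = u0 by rewrite /r -T0 TK.
  have nr : nbhs (0 : R) (r @^-1` (N `&` [set u | region x y u = (0 <= (T u).2)])°).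
    by apply: cr; rewrite r00.
  have [t [t0 _ ht]] := nbhs0_right nr ltr01.
  exists (r t).
  have pos : \forall u \near r t, 0 < (T u).2.
    have c2 : continuous (fun u => (T u).2) by cts.
    by apply: (near_gt0 c2); rewrite /r T'K.
  apply: filterS (filterI ht pos) => u [[Nu ru] pu]; split=> //=.
  by rewrite ru ltW.
have [[k uk]|[i [gi hi]]|[i [j [ij gi gj _ [sij hij]]]]] := onP_cases gp P0.
- by apply: half; rewrite uk; exact: halfplane_vertex gp k.
- exact: half (halfplane_inner gp gi hi).
have [s [s1 hs]] := region_crossing gp gi gj ij hij.
pose N' := N `&` [set u | oP u = (lv i u == 0) || (lv j u == 0) /\
  region x y u = (0 <= s * (lv i u * lv j u))].
have nI : nbhs u0 N'° by apply: nbhs_interior; apply: filterI.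
have sn : sl j - sl i != 0 by rewrite subr_eq0 eq_sym.
(* Chosen so that [lval i] is [t] and [lval j] is [s * t] along it: a path into the interior of a
   shaded sector. *)
pose r (t : R) : pt := (u0.1 + (1 - s) * t / (sl j - sl i),
   u0.2 + t + sl i * ((1 - s) * t / (sl j - sl i))).
have cr : continuous r by rewrite /r; cts.
have r00 : r 0 = u0 by rewrite /r !mulr0 !mul0r !mulr0 !addr0 -surjective_pairing.
have li0 : lv i u0 = 0 by have := hij i; rewrite eqxx => /andP[/eqP].
have lj0 : lv j u0 = 0 by have := hij j; rewrite eqxx orbT => /andP[/eqP].
have lir t : lv i (r t) = t.
  rewrite -[RHS]addr0 -li0 /lval /r /line /=; ring.
have ljr t : lv j (r t) = s * t.
  rewrite -[RHS]addr0 -lj0 /lval /r /line /=; field; exact: sn.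
have nr : nbhs (0 : R) (r @^-1` N'°) by apply: cr; rewrite r00.
have [t [t0 _ ht]] := nbhs0_right nr ltr01.
exists (r t).
have pos : \forall u \near r t, 0 < s * (lv i u * lv j u).
  have ci := @cts_lval _ _ x y i; have cj := @cts_lval _ _ x y j.
  have cc : continuous (fun u => s * (lv i u * lv j u)) by cts.
  apply: (near_gt0 cc); rewrite lir ljr.
  have s2 : s ^+ 2 = 1 by case: s1 => ->; rewrite ?sqrrN expr1n.
  have -> : s * (t * (s * t)) = s ^+ 2 * t ^+ 2 by ring.
  by rewrite s2 mul1r exprn_gt0.
apply: filterS (filterI ht pos) => u [[Nu [_ ru]] pu]; split=> //=.
by rewrite ru ltW.
Qed.

Variable L : seq (pt * pt * pt).
Hypothesis L_tri : forall t, t \in L -> exists i a b s, istri i a b s /\ t = tr i a b s.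
Hypothesis tri_L : forall i a b s, istri i a b s -> tr i a b s \in L.

Lemma lval_sg_near k u0 : lv k u0 != 0 ->
  \forall u \near u0, Num.sg (lv k u) = Num.sg (lv k u0).
Proof.
have cl := @cts_lval _ _ x y k; rewrite neq_lt => /orP[h|h].
  by apply: filterS (near_lt0 cl h) => u h'; rewrite !ltr0_sg.
by apply: filterS (near_gt0 cl h) => u h'; rewrite !gtr0_sg.
Qed.

(** The union is closed, so a region point outside it would come with a whole open set of such
    points, and [cover] applies to a generic one among them. *)
Lemma region_union3 : [set u | region x y u] = union3 L.
Proof.
apply/seteqP; split=> u0 /=; last first.
  move=> [t /L_tri[i [a [b [s [h ->]]]]] [c0 [c1 [c2 [p0 p1 p2 sum ->]]]]].
  exact: tri_sub_region gp _ _ _ _ _ _ _ _ h p0 p1 p2 sum.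
move=> r0; apply: contrapT => nU.
have nN : nbhs u0 (~` union3 L).
  by apply: open_nbhs_nbhs; split=> //; apply: closed_openC; exact: closed_union3.
have [u1 nu1] := region_regular r0 nN.
have a1 i : (- sl i) ^+ 2 + 1 ^+ 2 != 0 :> R.
  by rewrite gt_eqF // expr1n ltr_wpDl // sqr_ge0.
have [u2 [nu2 hu2]] := affine_generic (fun i => - (y i - sl i * x i)) a1 (nbhs_interior nu1).
have lu2 k : lv k u2 != 0.
  apply: contraNneq (hu2 k) => h; apply/eqP; rewrite -[RHS]h /lval /line; ring.
set o := ce (fun k => Num.sg (lv k u2)).
have ho k : Num.sg (lv k o) = Num.sg (lv k u2).
  by apply: (@cenP _ _ _ _ (fun k => Num.sg (lv k u2)) u2).
have ns : \forall u \near u2, forall k, Num.sg (lv k u) = Num.sg (lv k u2).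
  by apply: (@filter_forall _ _ _ (nbhs u2)) => k; exact: lval_sg_near.
pose J : finType := ('I_n * 'I_n * 'I_3)%type.
pose v (q : J) := lp q.1.1 (bas q.1.1 q.1.2 q.2).
have a2 q : (- ((v q).2 - o.2)) ^+ 2 + ((v q).1 - o.1) ^+ 2 != 0.
  apply/eqP => /eqP; rewrite paddr_eq0 ?sqr_ge0 // !sqrf_eq0 oppr_eq0 !subr_eq0.
  move=> /andP[/eqP e2 /eqP e1].
  have vo : v q = o by rewrite [LHS]surjective_pairing e1 e2 -surjective_pairing.
  have := lu2 q.1.1; rewrite -sgr_eq0 -ho -vo lval_lpt sgr0 eqxx //.
have nu2' : nbhs u2 (~` union3 L `&` [set u | region x y u]) by exact: nu2.
(* The centre depends only on the signs, which a small move preserves; so it stays fixed while the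
   point leaves the finitely many lines that join it to base points. *)
have [u3 [[[nU3 r3] hs3] hu3]] := affine_generic
  (fun q => ((v q).2 - o.2) * o.1 - ((v q).1 - o.1) * o.2) a2 (filterI nu2' ns).
have lu3 k : lv k u3 != 0 by rewrite -sgr_eq0 hs3 sgr_eq0.
have pu3 : pa u3.
  move: r3; rewrite /= /region => /orP[/existsP[k /andP[/eqP h _]]|//].
  by have := lu3 k; rewrite h eqxx.
have oE : ce (fun k => Num.sg (lv k u3)) = o by rewrite /o; congr cen; apply/funext.
have [|i [a [b [s [c0 [c1 [c2 [h [p0 p1 p2] sum e]]]]]]]] := @cover _ _ x y z w gp ep u3 lu3 pu3.
  move=> u [i [j [k ->]]]; rewrite oE /=.
  have := hu3 (i, j, k); rewrite /v /=; apply: contraNneq => h.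
  by apply/eqP; rewrite -[RHS]h; ring.
by apply: nU3; exists (tr i a b s); [exact: tri_L|exists c0, c1, c2].
Qed.

Lemma tri_det i a b s : istri i a b s -> let o := ce (sg i a b s) in
  (a - o.1) * (li i b - o.2) - (li i a - o.2) * (b - o.1) != 0.
Proof.
move=> h /=; set o := ce _; have := tri_cen_pos i h; rewrite -/o => /gt_eqF/negbT.
rewrite mulf_eq0 negb_or => /andP[_ l0].
have [[ab _ _ _] _] := h.
rewrite (_ : _ - _ = lv i o * (b - a)); last by rewrite /lval /line; ring.
by rewrite mulf_neq0 // subr_eq0 gt_eqF.
Qed.

(** The interpolation is well defined by [tri_inj] and [mass3_ext], affine on each of finitely many
    closed triangles, hence continuous and bounded on the union; Tietze's theorem extends it to the
    plane. *)
Lemma graph_function (F : pt -> R) : exists f : pt -> R, continuous f /\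
  forall i a b s c0 c1 c2, istri i a b s -> 0 <= c0 -> 0 <= c1 -> 0 <= c2 -> c0 + c1 + c2 = 1 ->
    f (comb3 c0 c1 c2 (ce (sg i a b s)) (lp i a) (lp i b)) =
    c0 * F (ce (sg i a b s)) + c1 * F (lp i a) + c2 * F (lp i b).
Proof.
pose rel u r := exists i a b s c0 c1 c2, [/\ istri i a b s,
  [/\ 0 <= c0, 0 <= c1, 0 <= c2 & c0 + c1 + c2 = 1],
  u = comb3 c0 c1 c2 (ce (sg i a b s)) (lp i a) (lp i b) &
  r = c0 * F (ce (sg i a b s)) + c1 * F (lp i a) + c2 * F (lp i b)].
have uniq u r r' : rel u r -> rel u r' -> r = r'.
  move=> [i [a [b [s [c0 [c1 [c2 [h [p0 p1 p2 sum] ue ->]]]]]]]].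
  move=> [i' [a' [b' [s' [d0 [d1 [d2 [h' [q0 q1 q2 sum'] ue' ->]]]]]]]].
  apply: mass3_ext; apply: (tri_inj h h') => //.
  by rewrite -ue -ue'.
pose f0 u := xget (0 : R) [set r | rel u r].
have f0E u r : rel u r -> f0 u = r.
  move=> h; apply: (uniq u) => //; rewrite /f0.
  by apply: (@xgetPex R 0 [set r | rel u r]); exists r.
have [M M0 hM] : exists2 M, 0 < M & forall t, t \in L -> `|F t.1.1| + `|F t.1.2| + `|F t.2| <= M.
  elim: L => [|t s [M M0 IH]]; first by exists 1.
  exists (M + (`|F t.1.1| + `|F t.1.2| + `|F t.2|)).
    by rewrite ltr_pwDl // !addr_ge0.
  move=> t'; rewrite inE => /orP[/eqP->|/IH h]; first by rewrite lerDr ltW.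
  by apply: le_trans h _; rewrite lerDl !addr_ge0.
have bound u : union3 L u -> `|f0 u| <= M.
  move=> [t tL [c0 [c1 [c2 [p0 p1 p2 sum ue]]]]].
  have [i [a [b [s [h te]]]]] := L_tri tL.
  rewrite (f0E u (c0 * F t.1.1 + c1 * F t.1.2 + c2 * F t.2)); last first.
    by exists i, a, b, s, c0, c1, c2; split=> //; rewrite ?ue te.
  apply: le_trans (hM t tL); apply: le_trans (ler_normD _ _) _; apply: lerD.
    apply: le_trans (ler_normD _ _) _; apply: lerD; rewrite normrM ger0_norm // ler_piMl //; lra.
  by rewrite normrM ger0_norm // ler_piMl //; lra.
have cont : {within union3 L, continuous f0}.
  have loc t : t \in L -> {within hull3 t, continuous f0}.
    move=> tL; have [i [a [b [s [h te]]]]] := L_tri tL.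
    pose o := ce (sg i a b s).
    have D0 := tri_det h; rewrite -/o /= in D0; set D := (_ - _) in D0.
    (* Barycentric coordinates by Cramer's rule. *)
    pose e1 (u : pt) := ((u.1 - o.1) * (li i b - o.2) - (u.2 - o.2) * (b - o.1)) / D.
    pose e2 (u : pt) := ((a - o.1) * (u.2 - o.2) - (li i a - o.2) * (u.1 - o.1)) / D.
    pose g (u : pt) := (1 - e1 u - e2 u) * F o + e1 u * F (lp i a) + e2 u * F (lp i b).
    have cg : continuous g.
      have ce1 : continuous e1 by rewrite /e1; cts.
      have ce2 : continuous e2 by rewrite /e2; cts.
      by rewrite /g; cts.
    apply: (subspace_eq_continuous _ (continuous_subspaceT cg)).
    move=> u; rewrite inE => -[c0 [c1 [c2 [p0 p1 p2 sum ue]]]].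
    apply/esym; apply: f0E; exists i, a, b, s, c0, c1, c2.
    have {}ue : u = comb3 c0 c1 c2 o (lp i a) (lp i b) by rewrite ue te.
    suff gE : g u = c0 * F o + c1 * F (lp i a) + c2 * F (lp i b) by split=> //; exact: gE.
    rewrite /g; have c0E : c0 = 1 - c1 - c2 by lra.
    have -> : e1 u = c1 by rewrite /e1 ue /comb3 /= c0E; move: D0; rewrite /D => D0; field.
    have -> : e2 u = c2 by rewrite /e2 ue /comb3 /= c0E; move: D0; rewrite /D => D0; field.
    by rewrite c0E.
  have : forall L', {subset L' <= L} -> {within union3 L', continuous f0}.
    elim=> [_|t s IH sub].
      rewrite (_ : union3 _ = set0); last by apply/seteqP; split=> u // -[].
      exact: continuous_subspace0.
    rewrite union3_cons; apply: withinU_continuous.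
    - exact: closed_hull3.
    - exact: closed_union3.
    - by apply: loc; apply: sub; rewrite mem_head.
    - by apply: IH => t' t's; apply: sub; rewrite inE t's orbT.
  by apply.
have [f [fE cf _]] := @continuous_bounded_extension pt R (@pseudometric_normal R pt)
  _ (@closed_union3 _ L) f0 M M0 cont bound.
exists f; split; first exact: cf.
move=> i a b s c0 c1 c2 h p0 p1 p2 sum.
rewrite -fE; last first.
  by rewrite inE; exists (tr i a b s); [exact: tri_L|exists c0, c1, c2].
by apply: f0E; exists i, a, b, s, c0, c1, c2.
Qed.

End RegionTriangulation.

(** * Tents over the crossings *)

Section Tents.
Variables (R : realType) (n : nat) (x y z w : 'I_n -> R).
Hypothesis gp : good_polygon x y z w.
Local Notation os := (onseg x y).
Local Notation ga := (gap x).
Local Notation lv := (lval x y).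
Local Notation sl := (slope x y).
Local Notation li := (line x y).
Local Notation ht := (height x z w).
Local Notation oP := (onP x y).
Local Notation pt := (R * R)%type.
Local Notation lp := (lpt x y).
Local Notation same := (sameline x y).
Local Notation mk := (mark x y).
Variable ep : R.
Hypothesis ep0 : 0 < ep.
Hypothesis ep_gap : forall i j k l, mk i j != mk k l -> 3 * ep < `|mk i j - mk k l|.
Local Notation elem := (el x y ep).
Local Notation isb := (isB x y ep).
Local Notation bas := (base x y ep).
Local Notation istri := (is_tri x y ep).
Local Notation sg := (sgs x y).
Local Notation ce := (cen x y).

Lemma height_affine i a b c1 c2 : c1 + c2 = 1 ->
  ht i (c1 * a + c2 * b) = (c1 * (ht i a).1 + c2 * (ht i b).1, c1 * (ht i a).2 + c2 * (ht i b).2).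
Proof.
move=> s; have -> : c1 = 1 - c2 by lra.
by rewrite /height /=; congr pair; ring.
Qed.

(* The height of a vertex of the triangulation; at a crossing this singles out
   one of the two strands as the upper one. *)
Definition hg (v : pt) : pt := if [pick i | os i v] is Some i then ht i v.1 else (0, 0).

(** At this crossing the graph takes the height of [j], so an arc of [i] is detached from it and
    receives a tent. *)
Definition under i j := [&& sl i != sl j, ga i (mk i j) < 0, ga j (mk i j) < 0,
  ht i (mk i j) != ht j (mk i j) & hg (lp i (mk i j)) == ht j (mk i j)].

Lemma onseg_lpt i t : os i (lp i t) = (ga i t <= 0).
Proof. by rewrite /onseg lval_lpt eqxx. Qed.

Lemma lpt_mark i j : sl i != sl j -> lp i (mk i j) = lp j (mk i j).
Proof. by move=> s; rewrite /lpt; congr pair; apply/eqP; rewrite markP. Qed.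

Lemma onseg_meet i j (u : pt) : sl i != sl j -> lv i u = 0 -> lv j u = 0 -> u.1 = mk i j.
Proof.
move=> s /lval0 ui /lval0 uj; apply/eqP; rewrite -(markP _ s); apply/eqP.
by have := congr1 snd ui; have := congr1 snd uj; rewrite /= => -> ->.
Qed.

Lemma onseg_lv i u : os i u -> lv i u = 0.
Proof. by move=> /andP[/eqP]. Qed.

Lemma onseg_ga i u : os i u -> ga i u.1 <= 0.
Proof. by move=> /andP[]. Qed.

Lemma hg_pick v : (exists i, os i v) -> exists2 i, os i v & hg v = ht i v.1.
Proof.
move=> [i iv]; rewrite /hg; case: pickP => [k kv|none]; first by exists k.
by have := none i; rewrite iv.
Qed.

Lemma hg_cases i v : os i v -> hg v = ht i v.1 \/ exists j, under i j /\ v.1 = mk i j.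
Proof.
move=> iv; have [k kv hk] := hg_pick (ex_intro _ i iv).
have [h|h] := eqVneq (ht i v.1) (ht k v.1); first by left; rewrite hk.
right; exists k; have [gi gk sik only] := onseg_cross gp iv kv h.
have vm := onseg_meet sik (onseg_lv iv) (onseg_lv kv).
split=> //; rewrite /under sik -vm gi gk h /=.
by rewrite -(lval0 (onseg_lv iv)) hk.
Qed.

Lemma mark_close i j k l : `|mk i j - mk k l| <= 3 * ep -> mk i j = mk k l.
Proof.
move=> h; apply/eqP; apply: contraTT h => ne; rewrite -ltNge; exact: ep_gap.
Qed.

Lemma isB_start i : isb (lp i (x i)).
Proof. by exists i, i, 1; rewrite base_mid mark_diag. Qed.

Lemma isB_end i : isb (lp i (x (ordS i))).
Proof.
have -> : lp i (x (ordS i)) = lp (ordS i) (x (ordS i)).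
  by rewrite /lpt (line_end gp) line_start.
exact: isB_start.
Qed.

Lemma gap_between i t : ga i t <= 0 -> (x i <= t <= x (ordS i)) || (x (ordS i) <= t <= x i).
Proof.
rewrite /gap => h; case: (lerP (x i) t) => h1; case: (lerP t (x (ordS i))) => h2; apply/orP.
- by left.
- by right; apply/andP; split; nra.
- by right; apply/andP; split; nra.
- by right; apply/andP; split; nra.
Qed.

Lemma betweenP i t : (x i <= t <= x (ordS i)) || (x (ordS i) <= t <= x i) -> ga i t <= 0.
Proof. by rewrite /gap => /orP[] /andP[h1 h2]; nra. Qed.

(** The ends of an edge are base points, so the base points nearest to [t] on both sides do not
    leave the edge. *)
Lemma el_exists i t : ga i t <= 0 -> exists a b, [/\ elem i a b, a <= t <= b,
  ga i a <= 0 & ga i b <= 0].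
Proof.
have ep_pos := ep0.
pose J : finType := ('I_n * 'I_n * 'I_3)%type.
pose B (q : J) := bas q.1.1 q.1.2 q.2.
have Bq T : isb (lp i T) <-> exists q : J, same q.1.1 i /\ T = B q.
  split; first by move=> /isB_line[j [l [k [? ?]]]]; exists (j, l, k).
  by move=> [[[j l] k] [? ?]]; apply/isB_line; exists j, l, k.
have key lo hi : isb (lp i lo) -> isb (lp i hi) -> lo < hi -> lo <= t <= hi ->
    exists a b, [/\ elem i a b, a <= t <= b, lo <= a & b <= hi].
  move=> /Bq[ql [sl_ lE]] /Bq[qh [sh hE]] lh /andP[lt_ th].
  have [th'|ht'] := ltP t hi.
    have [q /andP[qi qt] qmin] := @finite_min R J (fun q => same q.1.1 i && (t < B q)) B
      (ex_intro _ qh (introT andP (conj sh (eq_ind hi (fun h => t < h) th' _ hE)))).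
    have [p /andP[pi pt_] pmax] := @finite_min R J (fun q => same q.1.1 i && (B q <= t)) (fun q => - B q)
      (ex_intro _ ql (introT andP (conj sl_ (eq_ind lo (fun h => h <= t) lt_ _ lE)))).
    exists (B p), (B q); split.
    - split; [exact: le_lt_trans pt_ qt|by apply/Bq; exists p|by apply/Bq; exists q|].
      move=> T /andP[aT Tb] /Bq[q' [qi' TE]].
      have [Tt|Tt] := leP T t.
        by have := pmax q'; rewrite qi' -TE Tt lerN2 leNgt aT => /(_ isT).
      by have := qmin q'; rewrite qi' -TE Tt leNgt Tb => /(_ isT).
    - by rewrite pt_ ltW.
    - by rewrite -lerN2 lE; apply: pmax; rewrite sl_ -lE.
    - by rewrite hE; apply: qmin; rewrite sh -hE.
  (* At the right end of the edge the segment to the left is taken, as the one to the right may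
     leave the edge. *)
  have te : t = hi by apply/eqP; rewrite eq_le th.
  have [p /andP[pi pt_] pmax] := @finite_min R J (fun q => same q.1.1 i && (B q < hi)) (fun q => - B q)
    (ex_intro _ ql (introT andP (conj sl_ (eq_ind lo (fun h => h < hi) lh _ lE)))).
  exists (B p), hi; split.
  - split; [exact: pt_|by apply/Bq; exists p|by apply/Bq; exists qh|].
    move=> T /andP[aT Tb] /Bq[q' [qi' TE]].
    by have := pmax q'; rewrite qi' -TE Tb lerN2 leNgt aT => /(_ isT).
  - by rewrite te lexx ltW.
  - by rewrite -lerN2 lE; apply: pmax; rewrite sl_ -lE.
  - exact: lexx.
have ne := gp_x gp i.
move=> /gap_between /orP[] tt.
  have lt1 : x i < x (ordS i) by case/andP: tt => h1 h2; rewrite lt_neqAle ne (le_trans h1 h2).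
  have [a [b [e /andP[h1 h2] h3 h4]]] := key _ _ (isB_start i) (isB_end i) lt1 tt.
  have [ab _ _ _] := e.
  exists a, b; split; rewrite ?h1 //; apply: betweenP; apply/orP; left; apply/andP; split; lra.
have lt1 : x (ordS i) < x i by case/andP: tt => h1 h2; rewrite lt_neqAle eq_sym ne (le_trans h1 h2).
have [a [b [e /andP[h1 h2] h3 h4]]] := key _ _ (isB_end i) (isB_start i) lt1 tt.
have [ab _ _ _] := e.
exists a, b; split; rewrite ?h1 //; apply: betweenP; apply/orP; right; apply/andP; split; lra.
Qed.

(* The parity changes across an edge, so one of its two sides is shaded. *)
Lemma tri_of_segment i a b : elem i a b -> ga i a <= 0 -> ga i b <= 0 -> exists s, istri i a b s.
Proof.
have ep_pos := ep0.
move=> e ga_ gb; have [ab Ba Bb nab] := e.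
pose m := (a + b) / 2.
have mab : a < m < b by rewrite /m; apply/andP; split; lra.
have nBm := nab m mab.
pose u := lp i m.
have gm : ga i m < 0.
  have gm : ga i m <= 0.
    apply: betweenP; case/andP: mab => h1 h2.
    have ne := gp_x gp i.
    move: (gap_between ga_) (gap_between gb) => /orP[] /andP[p1 p2] /orP[] /andP[p3 p4];
      apply/orP; first [by left; apply/andP; split; lra|by right; apply/andP; split; lra].
  rewrite lt_neqAle gm andbT /gap mulf_eq0 !subr_eq0; apply/norP; split; apply/eqP => em; apply: nBm.
    by rewrite em; exact: isB_start.
  by rewrite em; exact: isB_end.
have ou : os i u by rewrite onseg_lpt ltW.
have only j : os j u = (j == i).
  apply/idP/eqP => [ju|->//].
  have [h|h] := eqVneq (ht i u.1) (ht j u.1); first by rewrite (onseg_inner gp ou ju gm h).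
  have [_ _ sij _] := onseg_cross gp ou ju h.
  exfalso; apply: nBm; apply: (@isB_cross _ _ _ _ ep i j) => //.
  have := onseg_lv ju; rewrite /lval /= => /eqP; by rewrite subr_eq0 => /eqP.
have [s [s1 hs]] := region_inner gp (gm : ga i u.1 < 0) only.
have ns : \forall v \near u, forall k, ~~ same i k -> Num.sg (lv k v) = Num.sg (lv k u).
  apply: (@filter_forall _ _ (fun k v => ~~ same i k -> Num.sg (lv k v) = Num.sg (lv k u)) (nbhs u)) => k.
  have [ik|ik] := boolP (same i k); first by apply: nearW.
  by apply: filterS (lval_sg_near (el_nonzero e mab ik)) => v h _.
pose r (t : R) : pt := (m, li i m + s * t).
have cr : continuous r by rewrite /r; cts.
have r0 : r 0 = u by rewrite /r mulr0 addr0.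
have nr : nbhs (0 : R) (r @^-1` [set v | (oP v = (lv i v == 0) /\ region x y v = (0 <= s * lv i v)) /\
    forall k, ~~ same i k -> Num.sg (lv k v) = Num.sg (lv k u)]).
  by apply: cr; rewrite r0; exact: filterI hs ns.
have [t [t0 _ [[oPr rr_] sr]]] := nbhs0_right nr ltr01.
have s2 : s * s = 1 by case: s1 => ->; rewrite ?mulrNN mulr1.
have lr : lv i (r t) = s * t by rewrite /lval /r /=; ring.
have s0 : s != 0 by apply: contraTneq isT => s0; move/eqP: s2; rewrite s0 mul0r eq_sym oner_eq0.
exists (s == 1); split=> //; exists (r t); split.
  move=> k; rewrite /sgs; case: ifP => [ik|/negbT ik]; last exact: sr.
  rewrite -(sameline_lval _ ik) lr sgrM (gtr0_sg t0) mulr1.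
  by case: s1 => ->; rewrite ?eqxx ?sgr1 // sgrN sgr1; case: eqP => // h; exfalso; lra.
move: rr_; rewrite /region oPr lr mulrA s2 mul1r (ltW t0) mulf_eq0 (negbTE s0) (gt_eqF t0) //.
Qed.

Lemma el_unique_left i a a' b : elem i a b -> elem i a' b -> a = a'.
Proof.
move=> [ab Ba _ nab] [ab' Ba' _ nab'].
have [h|h|//] := ltgtP a a'.
  by case: (nab a') => //; rewrite h ab'.
by case: (nab' a) => //; rewrite h ab.
Qed.

Lemma base_cases i j (k : 'I_3) : [\/ bas i j k = mk i j - ep, bas i j k = mk i j | bas i j k = mk i j + ep].
Proof.
rewrite /base; case: k => [[|[|[|//]]] h] /=; [constructor 1|constructor 2|constructor 3].
- by rewrite sub0r mulN1r.
- by rewrite subrr mul0r addr0.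
- by rewrite (_ : 2%:R - 1 = 1 :> R) ?mul1r //; lra.
Qed.

Lemma isB_tent i j : isb (lp i (mk i j - ep)) /\ isb (lp i (mk i j + ep)).
Proof.
split; [exists i, j, ord0|exists i, j, (Ordinal (isT : (2 < 3)%N))]; rewrite /base /=.
  by rewrite sub0r mulN1r.
by congr lpt; congr (_ + _); rewrite (_ : 2%:R - 1 = 1 :> R) ?mul1r //; lra.
Qed.

(** Another mark, even displaced by [ep], would have to lie within [3 * ep] of this one. *)
Lemma isB_near_mark i j t : `|t - mk i j| < 2 * ep -> isb (lp i t) ->
  [\/ t = mk i j - ep, t = mk i j | t = mk i j + ep].
Proof.
have ep_pos := ep0.
rewrite ltr_norml => /andP[t1 t2] /isB_line[k [l [c [_ tE]]]].
have close e : t = mk k l + e -> `|e| <= ep -> mk k l = mk i j.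
  rewrite ler_norml => te /andP[e1 e2]; apply: mark_close; rewrite ler_norml; apply/andP; split; lra.
have := base_cases k l c; rewrite -tE => -[] te; rewrite te.
- rewrite (close (- ep)) ?normrN ?gtr0_norm //; by constructor 1.
- by rewrite (close 0) ?normr0 ?addr0 ?(ltW ep0) //; constructor 2.
- by rewrite (close ep) ?gtr0_norm //; constructor 3.
Qed.

Lemma el_tent i j : sl i != sl j -> elem i (mk i j - ep) (mk i j) /\ elem i (mk i j) (mk i j + ep).
Proof.
have ep_pos := ep0.
move=> sij; have [B1 B2] := isB_tent i j.
have B0 : isb (lp i (mk i j)) by exists i, j, 1; rewrite base_mid.
split; split; rewrite ?gtrBl ?ltrDl //.
- move=> t /andP[t1 t2] Bt.
  have : `|t - mk i j| < 2 * ep by rewrite ltr_norml; apply/andP; split; lra.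
  by move=> /isB_near_mark/(_ Bt)[] te; lra.
- move=> t /andP[t1 t2] Bt.
  have : `|t - mk i j| < 2 * ep by rewrite ltr_norml; apply/andP; split; lra.
  by move=> /isB_near_mark/(_ Bt)[] te; lra.
Qed.

Lemma underP i j : under i j -> [/\ sl i != sl j, ga i (mk i j) < 0, ga j (mk i j) < 0,
  ht i (mk i j) != ht j (mk i j) & hg (lp i (mk i j)) = ht j (mk i j)].
Proof. by move=> /and5P[? ? ? ? /eqP]. Qed.

(** The ends of an edge are marks too, hence more than [3 * ep] away from a crossing inside the
    edge. *)
Lemma gap_tent i j k t : ga k (mk i j) < 0 -> `|t - mk i j| <= 2 * ep -> ga k t < 0.
Proof.
have ep_pos := ep0.
move=> g; rewrite ler_norml => /andP[t1 t2].
have ne1 : mk i j != mk k k.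
  by rewrite mark_diag; apply: contraTneq g => ->; rewrite gap_start ltxx.
have ne2 : mk i j != mk (ordS k) (ordS k).
  by rewrite mark_diag; apply: contraTneq g => ->; rewrite gap_end ltxx.
move: (ep_gap ne1) (ep_gap ne2); rewrite !mark_diag => d1 d2.
move: g; rewrite /gap; move: d1 d2.
move: (mk i j) t1 t2 => X t1 t2.
case: (ger0P (X - x k)) => h1; case: (ger0P (X - x (ordS k))) => h2 d1 d2 g.
- by move: g; rewrite ltNge mulr_ge0.
- by rewrite pmulr_rlt0; lra.
- by rewrite nmulr_rlt0; lra.
- by move: g; rewrite ltNge mulr_le0 ?ltW //; lra.
Qed.

(** Distinct tents have disjoint bases. The marks coincide by the spacing; if the two lines differ,
    both pass through the crossing, and of its two strands only one is detached. *)
Lemma under_same i j i' j' (u : pt) : under i j -> under i' j' -> lv i u = 0 -> lv i' u = 0 ->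
  `|u.1 - mk i j| <= ep -> `|u.1 - mk i' j'| <= ep -> i = i' /\ j = j'.
Proof.
have ep_pos := ep0.
move=> /underP[sij gi gj hij hgj] /underP[sij' gi' gj' hij' hgj'] lu lu' d d'.
have oi : os i u.
  rewrite (lval0 lu) onseg_lpt; apply: ltW; apply: gap_tent gi _; apply: le_trans d _; lra.
have oi' : os i' u.
  rewrite (lval0 lu') onseg_lpt; apply: ltW; apply: gap_tent gi' _; apply: le_trans d' _; lra.
move: (d) (d'); rewrite !ler_norml => /andP[d1 d2] /andP[d3 d4].
have XX : mk i j = mk i' j' by apply: mark_close; rewrite ler_norml; apply/andP; split; lra.
have [si|si] := eqVneq (sl i) (sl i').
  have giu : ga i u.1 < 0 by apply: gap_tent gi _; apply: le_trans d _; lra.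
  have ii : i = i'.
    have [h|h] := eqVneq (ht i u.1) (ht i' u.1); first exact: (onseg_inner gp oi oi' giu h).
    by have [_ _ /eqP[]] := onseg_cross gp oi oi' h.
  split=> //; move: hgj' gj' hij' sij'; rewrite -XX -ii => hgj' gj' hij' sij'.
  have oj : os j (lp i (mk i j)) by rewrite lpt_mark // onseg_lpt ltW.
  have oj' : os j' (lp i (mk i j)).
    move: (lpt_mark sij'); rewrite ii -XX -ii => ->; by rewrite onseg_lpt ltW.
  by apply: (onseg_inner gp oj oj'); rewrite //= -hgj.
have um := onseg_meet si lu lu'.
have X1 : mk i i' = mk i j by apply: mark_close; rewrite ler_norml; apply/andP; split; lra.
have uX : u.1 = mk i j by rewrite um.
have uE : u = lp i (mk i j) by rewrite -uX; exact: lval0.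
have oj : os j u by rewrite uE lpt_mark // onseg_lpt ltW.
have [_ _ _ only] := onseg_cross gp oi oj (eq_ind_r (fun t => ht i t != ht j t) hij uX).
have [ii|ij] := only _ oi'; first by rewrite ii eqxx in si.
exfalso; move: hij' => /eqP[]; rewrite -hgj' -XX ij.
by rewrite -(lpt_mark sij) hgj.
Qed.

Variable phi : pt -> pt.
Hypothesis phiE : forall i a b s c0 c1 c2, istri i a b s ->
  0 <= c0 -> 0 <= c1 -> 0 <= c2 -> c0 + c1 + c2 = 1 ->
  phi (comb3 c0 c1 c2 (ce (sg i a b s)) (lp i a) (lp i b)) =
  comb3 c0 c1 c2 (hg (ce (sg i a b s))) (hg (lp i a)) (hg (lp i b)).

Lemma phi_segment i a b t : elem i a b -> ga i a <= 0 -> ga i b <= 0 -> a <= t <= b ->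
  phi (lp i t) = (((b - t) / (b - a)) * (hg (lp i a)).1 + ((t - a) / (b - a)) * (hg (lp i b)).1,
                  ((b - t) / (b - a)) * (hg (lp i a)).2 + ((t - a) / (b - a)) * (hg (lp i b)).2).
Proof.
move=> e ga_ gb /andP[at_ tb]; have [s h] := tri_of_segment e ga_ gb.
have [ab _ _ _] := e; have ba : 0 < b - a by rewrite subr_gt0.
have ba0 : b - a != 0 by rewrite gt_eqF.
have c1 : 0 <= (b - t) / (b - a) by rewrite divr_ge0 ?(ltW ba) // subr_ge0.
have c2 : 0 <= (t - a) / (b - a) by rewrite divr_ge0 ?(ltW ba) // subr_ge0.
have sum : 0 + (b - t) / (b - a) + (t - a) / (b - a) = 1 by field.
have := phiE h (lexx 0) c1 c2 sum; rewrite /comb3 !mul0r !add0r => <-.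
congr phi; rewrite /lpt /=; congr pair; first by field.
by rewrite /line; field.
Qed.

(** Both ends of the elementary segment carry the height of [i]: an end with another height would be
    a detaching crossing, whose adjacent segments have length [ep]. *)
Lemma phi_line i t : ga i t <= 0 -> (forall j, under i j -> ep < `|t - mk i j|) ->
  phi (lp i t) = ht i t.
Proof.
have ep_pos := ep0.
move=> gt_ far; have [a [b [e tab ga_ gb]]] := el_exists gt_.
have [ab _ _ _] := e; have ba0 : b - a != 0 by rewrite subr_eq0 gt_eqF.
have ha : hg (lp i a) = ht i a.
  have [//|[j [uj /= aE]]] : hg (lp i a) = ht i a \/ exists j, under i j /\ (lp i a).1 = mk i j.
    by apply: hg_cases; rewrite onseg_lpt.
  have [sij _ _ _ _] := underP uj; have [_ e2] := el_tent sij.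
  have bE : b = mk i j + ep by apply: el_unique e _; rewrite aE.
  exfalso; have := far j uj; rewrite ltNge => /negP; apply.
  by rewrite ler_norml; case/andP: tab => h1 h2; apply/andP; split; lra.
have hb : hg (lp i b) = ht i b.
  have [//|[j [uj /= bE]]] : hg (lp i b) = ht i b \/ exists j, under i j /\ (lp i b).1 = mk i j.
    by apply: hg_cases; rewrite onseg_lpt.
  have [sij _ _ _ _] := underP uj; have [e1 _] := el_tent sij.
  have aE : a = mk i j - ep by apply: el_unique_left e _; rewrite bE.
  exfalso; have := far j uj; rewrite ltNge => /negP; apply.
  by rewrite ler_norml; case/andP: tab => h1 h2; apply/andP; split; lra.
rewrite (phi_segment e ga_ gb tab) ha hb -height_affine; last by field.
by congr height; field.
Qed.

Definition tent (s : R) : R := Num.max 0 (1 - `|s| / ep).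

Lemma tent_in s : `|s| <= ep -> tent s = 1 - `|s| / ep.
Proof. by move=> h; rewrite /tent max_r // subr_ge0 ler_pdivrMr // mul1r. Qed.

Lemma tent_out s : ep <= `|s| -> tent s = 0.
Proof. by move=> h; rewrite /tent max_l // subr_le0 ler_pdivlMr // mul1r. Qed.

Lemma tent_ge0 s : 0 <= tent s.
Proof. by rewrite /tent le_max lexx. Qed.

Lemma cts_tent : continuous tent.
Proof. by rewrite /tent; cts. Qed.

Lemma hg_foot i j t : under i j -> (t = mk i j - ep \/ t = mk i j + ep) -> hg (lp i t) = ht i t.
Proof.
have ep_pos := ep0.
move=> uj tE; have [sij gi _ _ _] := underP uj.
have tX : `|t - mk i j| = ep.
  by case: tE => ->; rewrite addrAC subrr add0r ?normrN gtr0_norm.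
have [//|[k [uk /= tk]]] : hg (lp i t) = ht i t \/ exists j, under i j /\ (lp i t).1 = mk i j.
  by apply: hg_cases; rewrite onseg_lpt ltW //; apply: gap_tent gi _; rewrite tX; lra.
have := @mark_close i k i j; rewrite -tk tX => /(_ _) h.
have /eqP : t - mk i j = 0 by rewrite h ?subrr //; lra.
by rewrite -normr_eq0 tX gt_eqF.
Qed.

(** On the two segments at the crossing [phi] interpolates between the feet, at the height of [i],
    and the crossing, at the height of [j]. *)
Lemma phi_under i j t : under i j -> `|t - mk i j| <= 2 * ep ->
  phi (lp i t) = ((ht i t).1 + tent (t - mk i j) * ((ht j (mk i j)).1 - (ht i (mk i j)).1),
                  (ht i t).2 + tent (t - mk i j) * ((ht j (mk i j)).2 - (ht i (mk i j)).2)).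
Proof.
have ep_pos := ep0.
move=> uj t2; have [sij gi gj hij hgX] := underP uj.
set X := mk i j in t2 gi gj hgX *.
have gX s : `|s - X| <= 2 * ep -> ga i s <= 0 by move=> h; apply: ltW; exact: gap_tent gi h.
have ep0' : ep != 0 by rewrite gt_eqF.
have [te|te] := leP `|t - X| ep; last first.
  rewrite tent_out ?(ltW te) // !mul0r !addr0 -surjective_pairing.
  apply: phi_line; first exact: gX.
  move=> k uk; rewrite ltNge; apply/negP => h.
  have XX : mk i k = X.
    by apply: mark_close; rewrite -/X; move: h t2; rewrite !ler_norml => /andP[? ?] /andP[? ?]; apply/andP; split; lra.
  by move: h; rewrite XX leNgt te.
rewrite tent_in //.
have [e1 e2] := el_tent sij; rewrite -/X in e1 e2.
have g1 : ga i (X - ep) <= 0 by apply: gX; rewrite addrAC subrr add0r normrN gtr0_norm //; lra.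
have g2 : ga i (X + ep) <= 0 by apply: gX; rewrite addrAC subrr add0r gtr0_norm //; lra.
have g0 : ga i X <= 0 by exact: ltW.
have h1 : hg (lp i (X - ep)) = ht i (X - ep) by apply: (hg_foot uj); left.
have h2 : hg (lp i (X + ep)) = ht i (X + ep) by apply: (hg_foot uj); right.
case: (ger0P (t - X)) te => tX te.
  have tin : X <= t <= X + ep by apply/andP; split; lra.
  have dE : X + ep - X = ep by ring.
  rewrite (phi_segment e2 g0 g2 tin) hgX h2 dE.
  have sum : (X + ep - t) / ep + (t - X) / ep = 1 by field.
  have hE := height_affine i X (X + ep) sum.
  have tE : (X + ep - t) / ep * X + (t - X) / ep * (X + ep) = t by field.
  rewrite tE in hE; move: (ht i t) (ht j X) (ht i X) (ht i (X + ep)) hE => A B C D -> /=.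
  by congr pair; field.
have tin : X - ep <= t <= X by apply/andP; split; lra.
have dE : X - (X - ep) = ep by ring.
rewrite (phi_segment e1 g1 g0 tin) hgX h1 dE.
have sum : (X - t) / ep + (t - (X - ep)) / ep = 1 by field.
have hE := height_affine i (X - ep) X sum.
have tE : (X - t) / ep * (X - ep) + (t - (X - ep)) / ep * X = t by field.
rewrite tE in hE; move: (ht i t) (ht j X) (ht i X) (ht i (X - ep)) hE => A B C D -> /=.
by congr pair; field.
Qed.

End Tents.

Lemma flat_at_near (R : realType) (T : topologicalType) b (S S' : set T) x :
  (\forall y \near x, S y <-> S' y) -> flat_at R b S' x -> flat_at R b S x.
Proof.
move=> e [f [g [fg fx nx]]]; exists f, g; split=> //.
by apply: filterS2 e nx => y -> ->.
Qed.

(** * The local model of a crossing with its tent *)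

Section TentModel.
Variables (R : realType) (tau : R -> R).
Hypothesis cts_tau : continuous tau.
Hypothesis tau_ge0 : forall t, 0 <= tau t.
Hypothesis tau0 : tau 0 = 1.
Local Notation Q4 := ((R * R) * (R * R))%type.

(* Coordinates ((s, r), (z, w)): two opposite quadrants of the plane z = w = 0
   together with the region under the tent in the plane r = w = 0. *)
Definition tent_model : set Q4 := [set q |
  (0 <= q.1.1 * q.1.2 /\ q.2 = (0, 0)) \/
  (q.1.2 = 0 /\ q.2.2 = 0 /\ - tau q.1.1 <= q.2.1 <= 0)].

(** In the coordinates t = s + r and y = z + |r| the model is the graph of r = [clamp t y] over the
    set - tau t <= y <= |t|. On the quadrants r has the sign of t and |r| = y <= |t|; on the tent y
    <= 0 and r = 0. Subtracting [clamp] flattens it. *)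
Definition clamp (t y : R) := Num.max (Num.min t (Num.max y 0)) (- Num.max y 0).

Definition flatten_tent (q : Q4) : Q4 :=
  ((q.1.1 + q.1.2, q.2.1 + `|q.1.2|),
   (q.1.2 - clamp (q.1.1 + q.1.2) (q.2.1 + `|q.1.2|), q.2.2)).

Definition unflatten_tent (q : Q4) : Q4 :=
  ((q.1.1 - (q.2.1 + clamp q.1.1 q.1.2), q.2.1 + clamp q.1.1 q.1.2),
   (q.1.2 - `|q.2.1 + clamp q.1.1 q.1.2|, q.2.2)).

Lemma homeo_flatten_tent : homeo flatten_tent unflatten_tent.
Proof.
split.
- by rewrite /flatten_tent /clamp; cts.
- by rewrite /unflatten_tent /clamp; cts.
- by move=> [[s r] [z w]]; rewrite /flatten_tent /unflatten_tent /= !subrK !addrK.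
- move=> [[t y] [r w]]; rewrite /flatten_tent /unflatten_tent /= !subrK.
  by congr ((_, _), (_, _)); rewrite addrK.
Qed.

Lemma flatten_tentP q : tent_model q <->
  (flatten_tent q).2 = (0, 0) /\
  - tau (flatten_tent q).1.1 <= (flatten_tent q).1.2 <= `|(flatten_tent q).1.1|.
Proof.
case: q => [[s r] [z w]]; rewrite /tent_model /flatten_tent /clamp /=.
have tau_nn := tau_ge0; split.
  case=> [[sr [-> ->]]|[-> [-> zz]]]; last first.
    have z0 : z <= 0 by case/andP: zz.
    rewrite normr0 !addr0 (max_r z0) oppr0.
    have -> : Num.max (Num.min s 0) 0 = 0 by rewrite max_r // ge_min lexx orbT.
    rewrite subrr; split=> //; case/andP: zz => -> h /=.
    exact: le_trans h (normr_ge0 _).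
  rewrite add0r (max_l (normr_ge0 r)).
  have -> : Num.max (Num.min (s + r) `|r|) (- `|r|) = r.
    case: (ger0P r) sr => r0 sr.
      have sr0 : r = 0 \/ 0 <= s.
        by have [->|h] := eqVneq r 0; [left|right; move: sr; rewrite pmulr_lge0 // lt_neqAle eq_sym h].
      case: sr0 => [->|s0]; first by rewrite addr0 oppr0 max_r // ge_min lexx orbT.
      by rewrite min_r ?max_l; lra.
    have s0 : s <= 0 by move: sr; rewrite nmulr_lge0.
    by rewrite opprK min_l ?max_r //; lra.
  rewrite subrr; split=> //; apply/andP; split.
    by apply: le_trans (normr_ge0 r); rewrite oppr_le0.
  case: (ger0P r) sr => r0 sr.
    have sr0 : r = 0 \/ 0 <= s.
      by have [->|h] := eqVneq r 0; [left|right; move: sr; rewrite pmulr_lge0 // lt_neqAle eq_sym h].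
    case: sr0 => [->|s0]; first by rewrite normr_ge0.
    by rewrite ger0_norm; lra.
  have s0 : s <= 0 by move: sr; rewrite nmulr_lge0.
  by rewrite ler0_norm; lra.
move=> [[/eqP]]; rewrite subr_eq0 => /eqP + -> /andP[].
move t_E : (s + r) => t; move y_E : (z + `|r|) => Y.
have [Y0|Y0] := leP Y 0; rewrite ?oppr0.
  have -> : Num.max (Num.min t 0) 0 = 0 by rewrite max_r // ge_min lexx orbT.
  move=> r0 h _; right; move: y_E t_E; rewrite r0 normr0 !addr0 => -> ->.
  by rewrite h Y0.
move=> rE h1 h2; left.
have rr : (0 <= t /\ r = Y) \/ (t <= 0 /\ r = - Y).
  move: h2; case: (ger0P t) => t0 h2; [left|right]; split; rewrite ?(ltW t0) //.
    by rewrite rE min_r // max_l //; lra.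
  by rewrite rE min_l ?max_r //; lra.
have nr : `|r| = Y by case: rr => -[_ ->]; rewrite ?normrN ger0_norm // ltW.
split; last by congr pair; lra.
case: rr => -[t0 r_E].
  by rewrite mulr_ge0; move: h2; rewrite ?(ger0_norm t0); lra.
by rewrite mulr_le0; move: h2; rewrite ?(ler0_norm t0); lra.
Qed.

Definition shear (f : R -> R) (c d e : R) (q : Q4) : Q4 := ((q.1.1 - c, d * (q.1.2 - f q.1.1) - e), q.2).

Lemma homeo_shear f c d e : continuous f -> d * d = 1 ->
  homeo (shear f c d e) (fun q => ((q.1.1 + c, d * (q.1.2 + e) + f (q.1.1 + c)), q.2)).
Proof.
move=> cf dd; split.
- rewrite /shear; cts; exact: (cts_comp cf (cts_fst (cts_fst (@cts_id _)))).
- cts; apply: (cts_comp cf); cts.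
- by move=> [[a b] q]; rewrite /shear /= subrK; congr ((_, _), _); rewrite subrK mulrA dd mul1r subrK.
- by move=> [[a b] q]; rewrite /shear /= addrK; congr ((_, _), _); rewrite addrK mulrA dd mul1r addrK.
Qed.

(** The flattened model lies between the graphs of [- tau] and the absolute value, which are
    disjoint since [tau] is non-negative and [tau 0 = 1]. Each graph is straightened by a shear.
    With the second coordinate 0, the upper graph is met only at the origin. *)
Lemma tent_model_flat (b : bool) s0 z0 : - tau s0 <= z0 <= 0 ->
  b = (z0 == - tau s0) || (z0 == `|s0|) -> flat_at R b tent_model ((s0, 0), (z0, 0)).
Proof.
move=> /andP[h1 h2] bE.
suff main : flat_at R b [set q : Q4 | q.2 = (0, 0) /\ - tau q.1.1 <= q.1.2 <= `|q.1.1|] ((s0, z0), (0, 0)).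
  rewrite (_ : tent_model = flatten_tent @^-1` [set q : Q4 | q.2 = (0, 0) /\ - tau q.1.1 <= q.1.2 <= `|q.1.1|]).
    apply: flat_at_homeo homeo_flatten_tent _.
    have c0 : clamp (s0 + 0) (z0 + `|0 : R|) = 0.
      by rewrite /clamp normr0 !addr0 (max_r h2) oppr0 max_r // ge_min lexx orbT.
    by rewrite /flatten_tent /= c0 normr0 !addr0 subr0.
  by apply/seteqP; split=> q /=; move/flatten_tentP.
have cN : continuous (fun q : Q4 => `|q.1.1| - q.1.2) by cts.
have cT : continuous (fun q : Q4 => tau q.1.1 + q.1.2).
  cts; exact: (cts_comp cts_tau (cts_fst (cts_fst (@cts_id _)))).
have [lo|lo] := eqVneq z0 (- tau s0).
  move: bE; rewrite lo eqxx /= => ->.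
  have up : 0 < `|s0| + tau s0.
    have [->|s00] := eqVneq s0 0; first by rewrite normr0 tau0 add0r.
    by rewrite ltr_wpDr // normr_gt0.
  have H := @homeo_shear (fun t => - tau t) s0 1 0 (fun t => continuousN (@cts_tau t)) (mulr1 1).
  eexists; eexists; split; [exact: H|by rewrite /shear /= !subrr mulr0 subr0|].
  apply: filterS (@near_gt0 _ _ _ ((s0, - tau s0), (0, 0)) cN _); last by rewrite /= opprK.
  move=> q /=; rewrite subr_gt0 => lt; rewrite /shear /= mul1r subr0 opprK (ltW lt) andbT.
  rewrite -[in X in _ <-> X]lerBlDr sub0r.
  by split=> -[-> h]; split=> //; exact: h.
have [hi|hi] := eqVneq z0 `|s0|.
  move: bE; rewrite hi eqxx orbT => ->.
  have s00 : s0 = 0.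
    by apply/eqP; rewrite -normr_eq0 eq_le normr_ge0 andbT -hi.
  rewrite s00 normr0.
  have H := @homeo_shear Num.norm 0 (-1) 0 (@norm_continuous _ _) (etrans (mulrNN 1 1) (mulr1 1)).
  eexists; eexists; split; [exact: H|by rewrite /shear /= normr0 !subrr mulr0 subrr|].
  apply: filterS (@near_gt0 _ _ _ ((0, 0), (0, 0)) cT _); last by rewrite /= tau0 addr0.
  move=> q /= lt; rewrite /shear /= mulN1r opprB !subr0 subr_ge0.
  have -> /= : - tau q.1.1 <= q.1.2 by rewrite -subr_ge0 opprK addrC ltW.
  by split=> -[-> h]; split=> //; exact: h.
move: bE; rewrite (negbTE lo) (negbTE hi) /= => ->.
have H := @homeo_shear (fun=> z0) s0 1 0 (@cst_continuous _ _ _) (mulr1 1).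
eexists; eexists; split; [exact: H|by rewrite /shear /= !subrr mulr0 ?subrr ?subr0|].
have l0 : z0 < `|s0| by rewrite lt_neqAle hi (le_trans h2).
have l1 : 0 < tau s0 + z0 by rewrite -ltrBlDl sub0r lt_neqAle eq_sym lo.
have N1 := @near_gt0 _ _ _ ((s0, z0), (0, 0)) cN; have N2 := @near_gt0 _ _ _ ((s0, z0), (0, 0)) cT.
move: N1 N2; rewrite /= subr_gt0 => /(_ l0) N1 /(_ l1) N2.
apply: filterS2 N1 N2 => q; rewrite subr_gt0 => h3 h4.
rewrite (ltW h3) andbT -[_ <= _]subr_ge0 opprK addrC (ltW h4) /shear /=.
by split=> -[].
Qed.

End TentModel.

(** * Flat charts of the surface *)

Section Charts.
Variables (R : realType) (n : nat) (x y z w : 'I_n -> R).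
Hypothesis gp : good_polygon x y z w.
Local Notation os := (onseg x y).
Local Notation ga := (gap x).
Local Notation lv := (lval x y).
Local Notation sl := (slope x y).
Local Notation li := (line x y).
Local Notation ht := (height x z w).
Local Notation oP := (onP x y).
Local Notation pt := (R * R)%type.
Local Notation Q4 := ((R * R) * (R * R))%type.
Local Notation lp := (lpt x y).
Local Notation mk := (mark x y).
Local Notation hg := (hg x y z w).
Local Notation under := (under x y z w).
Variable ep : R.
Hypothesis ep0 : 0 < ep.
Hypothesis ep_gap : forall i j k l, mk i j != mk k l -> 3 * ep < `|mk i j - mk k l|.
Local Notation istri := (is_tri x y ep).
Local Notation sg := (sgs x y).
Local Notation ce := (cen x y).
Local Notation tent := (tent ep).
Variable phi : pt -> pt.
Hypothesis cts_phi : continuous phi.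
Hypothesis phiE : forall i a b s c0 c1 c2, istri i a b s ->
  0 <= c0 -> 0 <= c1 -> 0 <= c2 -> c0 + c1 + c2 = 1 ->
  phi (comb3 c0 c1 c2 (ce (sg i a b s)) (lp i a) (lp i b)) =
  comb3 c0 c1 c2 (hg (ce (sg i a b s))) (hg (lp i a)) (hg (lp i b)).

Definition rise i j : pt :=
  ((ht j (mk i j)).1 - (ht i (mk i j)).1, (ht j (mk i j)).2 - (ht i (mk i j)).2).

(* The triangle that closes the gap, over the crossing of the edges [i] and
   [j], between the edge [i] and the graph of [phi]. *)
Definition tentset i j (p : Q4) := [/\ lv i p.1 = 0, `|p.1.1 - mk i j| <= ep &
  exists2 c, 0 <= c <= tent (p.1.1 - mk i j) &
    p.2 = ((ht i p.1.1).1 + c * (rise i j).1, (ht i p.1.1).2 + c * (rise i j).2)].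

Definition surf : set Q4 := [set p | (region x y p.1 /\ p.2 = phi p.1) \/
  exists i j, under i j /\ tentset i j p].

Definition curve : set Q4 := [set p | exists i, os i p.1 /\ p.2 = ht i p.1.1].

Definition under_tent i j (u : pt) := under i j /\ lv i u = 0 /\ `|u.1 - mk i j| <= ep.

Lemma under_tent_onseg i j u : under_tent i j u -> ga i u.1 < 0 /\ os i u.
Proof.
have ep_pos := ep0; move=> [uj [lu d]]; have [_ gi _ _ _] := underP uj.
have g : ga i u.1 < 0 by apply: (gap_tent ep0 ep_gap gi); apply: le_trans d _; lra.
by split=> //; rewrite /onseg lu eqxx ltW.
Qed.

Lemma tentset_under i j p : under i j -> tentset i j p -> under_tent i j p.1.
Proof. by move=> ? []. Qed.

Lemma curve_onP p : curve p -> oP p.1.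
Proof. by move=> [i [h _]]; apply/existsP; exists i. Qed.

Lemma near_not_under i j (u0 : pt) : ~ under_tent i j u0 ->
  \forall u \near u0, ~ under_tent i j u.
Proof.
move=> h; have [uj|nu] := boolP (under i j); last first.
  by near=> u; move=> [uj _]; rewrite uj in nu.
have [l0|l0] := eqVneq (lv i u0) 0; last first.
  apply: filterS (near_neq0 (@cts_lval _ _ x y i) l0) => u /eqP ? [_ [? _]]; by [].
have far : 0 < `|u0.1 - mk i j| - ep.
  by rewrite subr_gt0 ltNge; apply/negP => d; apply: h.
have c : continuous (fun u : pt => `|u.1 - mk i j| - ep) by cts.
apply: filterS (near_gt0 c far) => u; rewrite subr_gt0 => lt [_ [_]].
by rewrite leNgt lt.
Unshelve. all: by end_near.
Qed.

Lemma near_fst (A : set pt) (p : Q4) : nbhs p.1 A -> \forall q \near p, A q.1.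
Proof. by move=> h; apply: (cts_fst (@cts_id _)) h. Qed.

Definition over_chart (T : pt -> pt) (q : Q4) : Q4 :=
  (T q.1, (q.2.1 - (phi q.1).1, q.2.2 - (phi q.1).2)).

(** Subtracting [phi] turns the graph into the plane; this is a homeomorphism of the whole space as
    [phi] is continuous on the whole plane. *)
Lemma homeo_over_chart T T' : homeo T T' -> homeo (over_chart T)
  (fun q => (T' q.1, (q.2.1 + (phi (T' q.1)).1, q.2.2 + (phi (T' q.1)).2))).
Proof.
move=> [cT cT' TK T'K].
have c1 : continuous (fun q : Q4 => phi q.1) by exact: cts_comp cts_phi (cts_fst (@cts_id _)).
have c2 : continuous (fun q : Q4 => T' q.1) by exact: cts_comp cT' (cts_fst (@cts_id _)).
have c3 : continuous (fun q : Q4 => phi (T' q.1)) by exact: cts_comp cts_phi c2.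
split.
- by rewrite /over_chart; cts; exact: cts_comp cT (cts_fst (@cts_id _)).
- by cts.
- by move=> [u [a b]]; rewrite /over_chart /= TK !subrK.
- by move=> [u [a b]]; rewrite /over_chart /= T'K !addrK.
Qed.

Lemma flat_graph (b : bool) (T T' : pt -> pt) p0 : homeo T T' -> T p0.1 = (0, 0) -> p0.2 = phi p0.1 ->
  (\forall q \near p0, surf q <-> q.2 = phi q.1 /\ (b -> 0 <= (T q.1).2)) ->
  flat_at R b surf p0.
Proof.
move=> TT T0 p0E hn; eexists; eexists; split; [exact: homeo_over_chart TT| |].
  by rewrite /over_chart T0 p0E !subrr.
apply: filterS hn => -[u [a c]] /= ->; case: (phi u) => f g /=.
split=> -[h1 h2]; split=> //.
  by case: h1 => -> ->; rewrite !subrr.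
by case: h1 => /eqP + /eqP; rewrite !subr_eq0 => /eqP -> /eqP ->.
Qed.

Lemma homeo_translate (u0 : pt) : homeo (fun u : pt => (u.1 - u0.1, u.2 - u0.2))
  (fun u => (u.1 + u0.1, u.2 + u0.2)).
Proof.
split; [by cts|by cts| |] => -[a b] /=; by rewrite ?subrK ?addrK.
Qed.

Lemma flat_off_curve p0 : surf p0 -> ~~ oP p0.1 -> flat_at R false surf p0.
Proof.
move=> Sp nP.
have no q : ~~ oP q.1 -> (exists i j, under i j /\ tentset i j q) -> False.
  move=> /negP nq [i [j [uj t]]]; apply: nq; apply/existsP; exists i.
  by have [] := under_tent_onseg (tentset_under uj t).
case: Sp => [[rp pE]|]; last by move=> h; case: (no _ nP h).
apply: flat_graph (homeo_translate p0.1) _ pE _; first by rewrite !subrr.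
apply: filterS (near_fst (region_far gp nP)) => q [nq rq].
split=> [[[_ qE]|h]|[qE _]]; [by split|by case: (no _ nq h)|].
by left; split=> //; rewrite rq.
Qed.

(** At a crossing the vertex height differs from that of one strand, which then is detached; so away
    from the tents only vertices and inner points of edges remain. *)
Lemma not_under_halfplane u0 : oP u0 -> (forall i j, ~ under_tent i j u0) -> halfplane_at x y u0.
Proof.
have ep_pos := ep0.
move=> P0 no; have [[k ->]|[i [gi h]]|[i [j [ij gi gj hij [sij h]]]]] := onP_cases gp P0.
- exact: (halfplane_vertex gp).
- exact: (halfplane_inner gp gi h).
have oi : os i u0 by rewrite h eqxx.
have oj : os j u0 by rewrite h eqxx orbT.
have [hi|[k [uk uE]]] := hg_cases gp oi; last first.
  by case: (no i k); split=> //; rewrite uE subrr normr0 (onseg_lv oi) (ltW ep0).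
have [hj|[k [uk uE]]] := hg_cases gp oj; last first.
  by case: (no j k); split=> //; rewrite uE subrr normr0 (onseg_lv oj) (ltW ep0).
by move: hij; rewrite -hi -hj eqxx.
Qed.

Lemma phi_not_under i u0 : os i u0 -> (forall j, ~ under_tent i j u0) -> phi u0 = ht i u0.1.
Proof.
move=> oi no; rewrite {1}(lval0 (onseg_lv oi)).
apply: (phi_line gp ep0 ep_gap phiE); first exact: onseg_ga oi.
move=> j uj; rewrite ltNge; apply/negP => d; apply: (no j).
by split=> //; rewrite (onseg_lv oi).
Qed.

Lemma flat_not_under p0 : oP p0.1 -> (forall i j, ~ under_tent i j p0.1) -> p0.2 = phi p0.1 ->
  flat_at R true surf p0.
Proof.
move=> P0 no pE; have [T [T' [TT T0 hT]]] := not_under_halfplane P0 no.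
apply: flat_graph TT T0 pE _.
have no' : \forall u \near p0.1, forall i j, ~ under_tent i j u.
  apply: (@filter_forall _ _ (fun i u => forall j, ~ under_tent i j u) (nbhs p0.1)) => i.
  apply: (@filter_forall _ _ (fun j u => ~ under_tent i j u) (nbhs p0.1)) => j.
  exact: near_not_under (no i j).
apply: filterS2 (near_fst no') (near_fst hT) => q nq rq; rewrite /surf /= rq.
split=> [[[rr qE]|[i [j [uj t]]]]|[qE rr]]; first by [].
  by case: (nq i j); exact: tentset_under.
by left; split=> //; exact: rr.
Qed.

Lemma curve_sub_surf p : curve p -> surf p.
Proof.
move=> [i [oi pE]].
have [[j uj]|no] := pselect (exists j, under_tent i j p.1).
  right; exists i, j; case: uj => uj [lu d]; split=> //; split=> //.
  by exists 0; rewrite ?lexx ?tent_ge0 // !mul0r !addr0 -surjective_pairing.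
left; split; first by apply/orP; left; apply/existsP; exists i.
by rewrite pE (phi_not_under oi) // => j uj; apply: no; exists j.
Qed.

(** The form s r >= 0 of two opposite quadrants also holds along the tent base away from the
    crossing, where the first factor has locally constant sign and the region is a half plane. *)
Lemma region_under i j u0 : under_tent i j u0 -> exists2 k : R, k != 0 &
  \forall u \near u0, region x y u = (0 <= lv j u / (sl i - sl j) * (k * lv i u)).
Proof.
move=> ut; have [gi oi] := under_tent_onseg ut; have [uj [lu d]] := ut.
have [sij gi' gj' hij _] := underP uj.
have D0 : sl i - sl j != 0 by rewrite subr_eq0.
have ij : i != j by apply: contraNneq hij => ->.
have [uX|uX] := eqVneq u0.1 (mk i j).
  have u0E : u0 = lp j u0.1 by rewrite {1}(lval0 lu) uX lpt_mark.
  have oj : os j u0 by rewrite u0E onseg_lpt uX ltW.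
  have [_ gj _ only] := onseg_cross gp oi oj (eq_ind_r (fun t => ht i t != ht j t) hij uX).
  have h k : os k u0 = (k == i) || (k == j).
    by apply/idP/idP => [/only[]->|/orP[]/eqP->]; rewrite ?eqxx ?orbT.
  have [s [s1 hs]] := region_crossing gp gi gj ij h.
  exists (s * (sl i - sl j)); first by rewrite mulf_neq0 //; case: s1 => ->; rewrite ?oppr_eq0 oner_eq0.
  apply: filterS hs => u [_ ->]; congr (0 <= _); field; exact: D0.
have h k : os k u0 = (k == i).
  apply/idP/eqP => [ok|->//]; apply: esym; apply: (onseg_inner gp oi ok gi).
  apply/eqP; apply: contraNT uX => /(onseg_cross gp oi ok)[_ _ sik _].
  have um := onseg_meet sik lu (onseg_lv ok); have ep_pos := ep0.
  by rewrite um (mark_close ep_gap (j := k) (k := i) (l := j)) // -um; apply: le_trans d _; lra.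
have [s [s1 hs]] := region_inner gp gi h.
have lE u : lv j u / (sl i - sl j) = u.1 - mk i j + lv i u / (sl i - sl j).
  have e := lpt_mark sij; case: e => e.
  have := line_diff x y i u.1 (mk i j); have := line_diff x y j u.1 (mk i j).
  rewrite /lval e => h1 h2.
  have {h1}-> : li j u.1 = sl j * (u.1 - mk i j) + li j (mk i j) by lra.
  have {h2}-> : li i u.1 = sl i * (u.1 - mk i j) + li j (mk i j) by lra.
  by field.
have l0 : lv j u0 / (sl i - sl j) != 0 by rewrite lE lu mul0r addr0 subr_eq0.
have cl : continuous (fun u => lv j u / (sl i - sl j)).
  by have := @cts_lval _ _ x y j => c; cts.
exists (s * Num.sg (lv j u0 / (sl i - sl j))).
  by rewrite mulf_neq0 // ?sgr_eq0 //; case: s1 => ->; rewrite ?oppr_eq0 oner_eq0.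
case: (ltgtP (lv j u0 / (sl i - sl j)) 0) => [neg|pos|/eqP]; last by rewrite (negbTE l0).
  rewrite ltr0_sg //; apply: filterS2 hs (near_lt0 cl neg) => u [_ ->] lt.
  by rewrite (nmulr_rge0 _ lt) mulrN1 mulNr oppr_le0.
rewrite gtr0_sg //; apply: filterS2 hs (near_gt0 cl pos) => u [_ ->] lt.
by rewrite (pmulr_rge0 _ lt) mulr1.
Qed.

(* The fibre coordinates are taken along and across the direction [rise i j]. *)
Definition tent_chart (k : R) i j (q : Q4) : Q4 :=
  let D := sl i - sl j in let d := rise i j in let N := d.1 ^+ 2 + d.2 ^+ 2 in
  let W1 := q.2.1 - (phi q.1).1 in let W2 := q.2.2 - (phi q.1).2 in
  ((lv j q.1 / D, k * lv i q.1),
   ((W1 * d.1 + W2 * d.2) / N, (W2 * d.1 - W1 * d.2) / N)).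

(** Recovers the plane point from the first two coordinates of [tent_chart]. *)
Definition tent_base (k : R) i j (q : Q4) : pt :=
  (mk i j + q.1.1 - q.1.2 / (k * (sl i - sl j)),
   q.1.2 / k + li i (mk i j + q.1.1 - q.1.2 / (k * (sl i - sl j)))).

Definition tent_unchart (k : R) i j (q : Q4) : Q4 :=
  let d := rise i j in let u := tent_base k i j q in
  (u, ((phi u).1 + (q.2.1 * d.1 - q.2.2 * d.2), (phi u).2 + (q.2.1 * d.2 + q.2.2 * d.1))).

Lemma rise_norm i j : under i j -> (rise i j).1 ^+ 2 + (rise i j).2 ^+ 2 != 0.
Proof.
move=> /underP[_ _ _ + _]; apply: contraNneq => /eqP; rewrite /rise.
move: (ht i _) (ht j _) => [a b] [c d] /=.
by rewrite paddr_eq0 ?sqr_ge0 // !sqrf_eq0 !subr_eq0 => /andP[/eqP-> /eqP->].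
Qed.

Lemma homeo_tent_chart k i j : k != 0 -> under i j -> homeo (tent_chart k i j) (tent_unchart k i j).
Proof.
move=> k0 uj; have [sij _ _ _ _] := underP uj; have N0 := rise_norm uj.
have D0 : sl i - sl j != 0 by rewrite subr_eq0.
have c1 : continuous (fun q : Q4 => phi q.1) by exact: cts_comp cts_phi (cts_fst (@cts_id _)).
have cl a : continuous (fun q : Q4 => lv a q.1) by exact: cts_comp (@cts_lval _ _ x y a) (cts_fst (@cts_id _)).
have cb : continuous (fun q : Q4 => tent_base k i j q) by rewrite /tent_base /line; cts.
have c2 : continuous (fun q : Q4 => phi (tent_base k i j q)) by exact: cts_comp cts_phi cb.
have lE : li i (mk i j) = li j (mk i j) by case: (lpt_mark sij).
have li_ a t : li a t = li a (mk i j) + sl a * (t - mk i j).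
  by have := line_diff x y a t (mk i j); lra.
split.
- by rewrite /tent_chart /=; cts; exact: cl.
- by rewrite /tent_unchart /=; cts.
- move=> [u [a b]]; rewrite /tent_unchart /tent_chart.
  move: (rise i j) N0 => d N0 /=; set D := sl i - sl j in D0 *.
  have bE q : tent_base k i j ((lv j u / D, k * lv i u), q) = u.
    rewrite /tent_base /= -/D.
    have tE : mk i j + lv j u / D - k * lv i u / (k * D) = u.1.
      rewrite /lval (li_ j) (li_ i u.1) lE /D; field; by rewrite -/D D0 k0.
    by rewrite tE [RHS]surjective_pairing; congr pair; rewrite /lval; field.
  by rewrite bE; congr (_, (_, _)); field.
- move=> [[s r] [a b]]; rewrite /tent_unchart /tent_chart.
  move: (rise i j) N0 => d N0 /=; set D := sl i - sl j in D0 *.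
  have E1 : lv j (tent_base k i j ((s, r), (a, b))) / D = s.
    rewrite /lval /tent_base /= -/D (li_ i) (li_ j) lE /D; field; by rewrite -/D D0 k0.
  have E2 : k * lv i (tent_base k i j ((s, r), (a, b))) = r.
    by rewrite /lval /tent_base /=; field.
  rewrite E1 E2; congr (_, (_, _)); field; exact: N0.
Qed.

Lemma lval_along i j u : sl i != sl j -> lv i u = 0 -> lv j u / (sl i - sl j) = u.1 - mk i j.
Proof.
move=> sij lu; have D0 : sl i - sl j != 0 by rewrite subr_eq0.
have [e] := lpt_mark sij; rewrite (lval0 lu) /lval /lpt [_.2]/= [_.1]/=.
have := line_diff x y i u.1 (mk i j); have := line_diff x y j u.1 (mk i j) => h1 h2.
apply: (mulIf D0); rewrite divfK //; lra.
Qed.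

(** The parameter [c] measures the way from strand [i] towards strand [j], and [phi] sits at
    [c = tent]. Relative to [phi] a tent point has coordinate [c - tent] along [rise] and 0 across
    it. *)
Lemma tent_fibre k i j p c : under_tent i j p.1 ->
  p.2 = ((ht i p.1.1).1 + c * (rise i j).1, (ht i p.1.1).2 + c * (rise i j).2) <->
  (tent_chart k i j p).2 = (c - tent (p.1.1 - mk i j), 0).
Proof.
have ep_pos := ep0; move=> ut; have [uj [lu d]] := ut.
have d2 : `|p.1.1 - mk i j| <= 2 * ep by apply: le_trans d _; lra.
have := phi_under gp ep0 ep_gap phiE uj d2; rewrite -(lval0 lu) -/(rise i j).
rewrite /tent_chart -[(ht j _).1 - _]/((rise i j).1) -[(ht j _).2 - _]/((rise i j).2) => ->.
have N0 := rise_norm uj; move: (rise i j) N0 => e N0.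
move: (ht i p.1.1) (tent _) => h t; case: p.2 => a b /=.
split=> [[-> ->]|[/eqP h1 /eqP h2]]; first by congr pair; field.
have {h2}h2 : (b - (h.2 + t * e.2)) * e.1 - (a - (h.1 + t * e.1)) * e.2 = 0.
  by apply/eqP; move: h2; rewrite mulf_eq0 invr_eq0 (negbTE N0) orbF.
have {h1}h1 : (a - (h.1 + t * e.1)) * e.1 + (b - (h.2 + t * e.2)) * e.2 = (c - t) * (e.1 ^+ 2 + e.2 ^+ 2).
  by apply/eqP; move: h1; rewrite eq_sym -subr_eq0 -(inj_eq (mulIf N0)) mulrBl divfK // mul0r subr_eq0 eq_sym.
move/eqP: h1; rewrite -subr_eq0 => /eqP h1; congr pair; apply: (mulIf N0); apply/eqP; rewrite -subr_eq0.
  rewrite (_ : _ - _ = e.1 * ((a - (h.1 + t * e.1)) * e.1 + (b - (h.2 + t * e.2)) * e.2 -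
    (c - t) * (e.1 ^+ 2 + e.2 ^+ 2)) - e.2 * ((b - (h.2 + t * e.2)) * e.1 - (a - (h.1 + t * e.1)) * e.2)).
    by rewrite h1 h2 !mulr0 subrr.
  by ring.
rewrite (_ : _ - _ = e.2 * ((a - (h.1 + t * e.1)) * e.1 + (b - (h.2 + t * e.2)) * e.2 -
  (c - t) * (e.1 ^+ 2 + e.2 ^+ 2)) + e.1 * ((b - (h.2 + t * e.2)) * e.1 - (a - (h.1 + t * e.1)) * e.2)).
  by rewrite h1 h2 !mulr0 addr0.
by ring.
Qed.

Lemma curve_tentP i j p : under_tent i j p.1 -> surf p ->
  curve p <-> p.2 = ht i p.1.1 \/ (p.1.1 = mk i j /\ p.2 = ht j p.1.1).
Proof.
move=> ut Sp; have [gi oi] := under_tent_onseg ut; have [uj [lu d]] := ut.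
have [sij gi' gj' hij _] := underP uj; have ep_pos := ep0; split; last first.
  case=> [pE|[pX pE]]; first by exists i.
  by exists j; split=> //; rewrite (lval0 lu) pX lpt_mark // onseg_lpt ltW.
move=> [k [ok pE]]; have [e|ne] := eqVneq (ht i p.1.1) (ht k p.1.1); first by left; rewrite pE e.
have [_ _ sik only] := onseg_cross gp oi ok ne; right.
have um := onseg_meet sik lu (onseg_lv ok).
have pX : p.1.1 = mk i j.
  by rewrite um; apply: (mark_close ep_gap); rewrite -um; apply: le_trans d _; lra.
split=> //; have oj : os j p.1 by rewrite (lval0 lu) pX lpt_mark // onseg_lpt ltW.
have hij' : ht i p.1.1 != ht j p.1.1 by rewrite pX.
have [_ _ _ only'] := onseg_cross gp oi oj hij'.
case: (only' _ ok) => kE; last by rewrite pE kE.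
by rewrite kE eqxx in ne.
Qed.

(** In [tent_chart] the surface near [p0] is the tent model, since [under_same] keeps all other
    tents away. The points of the curve over the tent base are strand [i] and the apex, which are
    the two boundary cases of [tent_model_flat]. *)
Lemma flat_under i j p0 (b : bool) : under_tent i j p0.1 -> surf p0 -> (b <-> curve p0) ->
  flat_at R b surf p0.
Proof.
move=> ut Sp bE; have ep_pos := ep0; have [uj [lu d]] := ut.
have [k k0 hk] := region_under ut.
have hn : \forall q \near p0, surf q <-> tent_model tent (tent_chart k i j q).
  have no : \forall u \near p0.1, forall i' j', (i', j') != (i, j) -> ~ under_tent i' j' u.
    apply: (@filter_forall _ _ (fun i' u => forall j', (i', j') != (i, j) -> ~ under_tent i' j' u) (nbhs p0.1)) => i'.
    apply: (@filter_forall _ _ (fun j' u => (i', j') != (i, j) -> ~ under_tent i' j' u) (nbhs p0.1)) => j'.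
    have [e|ne] := eqVneq (i', j') (i, j); first by near=> u.
    have h : ~ under_tent i' j' p0.1.
      move=> [uj' [lu' d']]; have [e1 e2] := under_same gp ep0 ep_gap uj uj' lu lu' d d'.
      by rewrite e1 e2 eqxx in ne.
    by apply: filterS (near_not_under h).
  apply: filterS2 (near_fst hk) (near_fst no) => q rq nq.
  have sE : surf q <-> (region x y q.1 /\ q.2 = phi q.1) \/ tentset i j q.
    split=> [[h|[i' [j' [uj' t]]]]|[h|t]]; [by left| |by left|by right; exists i, j].
    have [[e1 e2]|ne] := eqVneq (i', j') (i, j); first by right; rewrite -e1 -e2.
    by case: (nq _ _ ne); exact: tentset_under.
  have zE : (tent_chart k i j q).2 = (0, 0) <-> q.2 = phi q.1.
    have [cc _ ccK _] := homeo_tent_chart k0 uj; split=> [e|e]; last first.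
      by rewrite /tent_chart e !subrr !mul0r addr0 subrr !mul0r.
    move: (ccK q); rewrite /tent_unchart e; move: (tent_base _ _ _ _) => B <- /=.
    by rewrite !mul0r subrr !addr0; case: (phi B).
  have [l0|l0] := eqVneq (lv i q.1) 0; last first.
    rewrite sE /tent_model /= zE rq; split=> [[h|[/eqP]]|[h|[/eqP]]].
    - by left.
    - by rewrite (negbTE l0).
    - by left.
    - by rewrite mulf_eq0 (negbTE k0) (negbTE l0).
  have [sij _ _ _ _] := underP uj; have sv := lval_along sij l0.
  have [dq|dq] := leP `|q.1.1 - mk i j| ep.
    have uq : under_tent i j q.1 by [].
    have rT : region x y q.1 by rewrite rq l0 !mulr0.
    rewrite sE /tent_model /= -zE rT l0 !mulr0 lexx.
    rewrite sv.
    split=> [[[_ h]|[_ _ [c /andP[c0 ct] qE]]]|[[_ h]|[_ [w0 /andP[z1 z2]]]]].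
    - by left.
    - right; have /(tent_fibre k _ uq) := qE; rewrite /= => -[-> ->].
      by split=> //; split=> //; apply/andP; split; lra.
    - by left.
    - right; split=> //; exists (tent (q.1.1 - mk i j) + (tent_chart k i j q).2.1).
        by apply/andP; split; move: z1 z2; rewrite /tent_chart /=; lra.
      apply/(tent_fibre k _ uq); rewrite [LHS]surjective_pairing; congr pair; last exact: w0.
      by rewrite addrAC subrr add0r.
  rewrite sE /tent_model /= -zE rq l0 !mulr0 lexx sv (tent_out ep0 (ltW dq)) oppr0.
  split=> [[[_ h]|[_ d' _]]|[[_ h]|[_ [w0 /andP[z1 z2]]]]].
  - by left.
  - by move: d'; rewrite leNgt dq.
  - by left.
  - left; split=> //; rewrite [LHS]surjective_pairing; congr pair; last exact: w0.
    by apply/eqP; rewrite eq_le z1 z2.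
have [sij _ _ hij _] := underP uj; have [gi oi] := under_tent_onseg ut.
have Mp := (nbhs_singleton hn).1 Sp.
(* The position of [p0] in its fibre: 0 on strand [i], and 1 at the height of strand [j] over the
   crossing. *)
pose c := (tent_chart k i j p0).2.1 + tent (p0.1.1 - mk i j).
have cE : tent_chart k i j p0 = ((p0.1.1 - mk i j, 0), (c - tent (p0.1.1 - mk i j), 0)).
  move: Mp; rewrite /c addrK /tent_model /= lu !mulr0 => Mp.
  rewrite /tent_chart lu mulr0 (lval_along sij lu); congr ((_, _), (_, _)).
  by case: Mp => [[_ [_ ->]]|[_ [-> _]]].
apply: flat_at_near hn _; apply: flat_at_homeo (homeo_tent_chart k0 uj) _.
have tent00 : tent 0 = 1 by rewrite tent_in ?normr0 ?(ltW ep0) // mul0r subr0.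
have cP e : p0.2 = ((ht i p0.1.1).1 + e * (rise i j).1, (ht i p0.1.1).2 + e * (rise i j).2) <-> c = e.
  rewrite (tent_fibre k _ ut) cE /=; split=> [[]|->//]; lra.
have c1 : 0 <= c <= tent (p0.1.1 - mk i j).
  move: Mp; rewrite cE /tent_model /= => -[[_ [h]]|[_ [_]]].
    by apply/andP; split; have := tent_ge0 ep (p0.1.1 - mk i j); lra.
  by move=> /andP[h1 h2]; apply/andP; split; lra.
rewrite cE; apply: tent_model_flat => //.
- exact: cts_tent.
- exact: tent_ge0.
- by case/andP: c1 => h1 h2; apply/andP; split; lra.
apply/idP/idP => [/bE/(curve_tentP ut Sp)[pE|[pX pE]]|].
- have /cP -> : p0.2 = ((ht i p0.1.1).1 + 0 * (rise i j).1, (ht i p0.1.1).2 + 0 * (rise i j).2).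
    by rewrite !mul0r !addr0 -surjective_pairing.
  by rewrite sub0r eqxx.
- have /cP -> : p0.2 = ((ht i p0.1.1).1 + 1 * (rise i j).1, (ht i p0.1.1).2 + 1 * (rise i j).2).
    by rewrite pE pX !mul1r /rise; case: (ht i _) (ht j _) => [a1 a2] [b1 b2] /=; rewrite !subrKC.
  by rewrite pX subrr tent00 subrr normr0 eqxx orbT.
move=> h; apply/bE/(curve_tentP ut Sp); case/orP: h => /eqP h.
  left; have /cP -> : c = 0 by lra.
  by rewrite !mul0r !addr0 -surjective_pairing.
right; have s0 : p0.1.1 - mk i j = 0.
  by apply/eqP; rewrite -normr_eq0 eq_le normr_ge0 andbT; case/andP: c1 => _; lra.
have pX : p0.1.1 = mk i j by apply/eqP; rewrite -subr_eq0 s0.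
split=> //; have /cP -> : c = 1 by move: h; rewrite s0 tent00 normr0; lra.
by rewrite pX !mul1r /rise; case: (ht i _) (ht j _) => [a1 a2] [b1 b2] /=; rewrite !subrKC.
Unshelve. all: by end_near.
Qed.

Lemma surf_charts : (forall p, curve p -> flat_at R true surf p) /\
  (forall p, surf p -> ~ curve p -> flat_at R false surf p).
Proof.
split=> p.
  move=> cp; have Sp := curve_sub_surf cp.
  have [[i [j ut]]|no] := pselect (exists i j, under_tent i j p.1).
    by apply: flat_under ut Sp _.
  have no' i j : ~ under_tent i j p.1 by move=> h; apply: no; exists i, j.
  apply: (flat_not_under (curve_onP cp) no').
  by have [i [oi ->]] := cp; rewrite (phi_not_under oi).
move=> Sp ncp; have [[i [j ut]]|no] := pselect (exists i j, under_tent i j p.1).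
  by apply: flat_under ut Sp _; split.
apply: flat_off_curve => //; apply/negP => /existsP[i oi]; apply: ncp; exists i; split=> //.
case: Sp => [[_ ->]|[i' [j' [uj t]]]]; last by case: no; exists i', j'; exact: tentset_under.
by rewrite (phi_not_under oi) // => j h; apply: no; exists i, j.
Qed.

End Charts.

(** * The triangulated surface *)

Section Lift.
Variables (R : realType) (n : nat) (x y z w : 'I_n -> R).
Hypothesis gp : good_polygon x y z w.
Local Notation ga := (gap x).
Local Notation ht := (height x z w).
Local Notation pt := (R * R)%type.
Local Notation Q4 := ((R * R) * (R * R))%type.
Local Notation lp := (lpt x y).
Local Notation mk := (mark x y).
Local Notation hg := (hg x y z w).
Local Notation under := (under x y z w).
Variable ep : R.
Hypothesis ep0 : 0 < ep.
Hypothesis ep_gap : forall i j k l, mk i j != mk k l -> 3 * ep < `|mk i j - mk k l|.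
Local Notation istri := (is_tri x y ep).
Local Notation tr := (tri x y).
Local Notation sg := (sgs x y).
Local Notation ce := (cen x y).
Local Notation rise := (rise x y z w).
Variable phi : pt -> pt.
Hypothesis cts_phi : continuous phi.
Hypothesis phiE : forall i a b s c0 c1 c2, istri i a b s ->
  0 <= c0 -> 0 <= c1 -> 0 <= c2 -> c0 + c1 + c2 = 1 ->
  phi (comb3 c0 c1 c2 (ce (sg i a b s)) (lp i a) (lp i b)) =
  comb3 c0 c1 c2 (hg (ce (sg i a b s))) (hg (lp i a)) (hg (lp i b)).
Variable L : seq (pt * pt * pt).
Hypothesis L_tri : forall t, t \in L -> exists i a b s, istri i a b s /\ t = tr i a b s.
Hypothesis tri_L : forall i a b s, istri i a b s -> tr i a b s \in L.
Hypothesis L_size : (size L <= 6 * n ^ 2)%N.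
Variables (f : 'rV[R]_4 -> Q4) (g : Q4 -> 'rV[R]_4).
Hypothesis fg : homeo f g.
Hypothesis f_comb : forall a b c A B C, f (a *: A + b *: B + c *: C) =
  (comb3 a b c (f A).1 (f B).1 (f C).1, comb3 a b c (f A).2 (f B).2 (f C).2).

Definition lift v : 'rV[R]_4 := g (v, hg v).

Definition lift3 (t : pt * pt * pt) := (lift t.1.1, lift t.1.2, lift t.2).

(** Lifted by [hg], the first two vertices are feet on strand [i] and the third is the apex on
    strand [j], although all three lie on line [i] in the plane. *)
Definition tent3 i j : pt * pt * pt := (lp i (mk i j - ep), lp i (mk i j + ep), lp i (mk i j)).

Lemma f_lift v : f (lift v) = (v, hg v).
Proof. by case: fg => _ _ _ ->. Qed.

Lemma lift_eq v p : (v == lift p) = ((f v).2 == hg (f v).1) && ((f v).1 == p).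
Proof.
have [_ _ fK gK] := fg; apply/eqP/andP => [->|[/eqP h /eqP <-]].
  by rewrite f_lift !eqxx.
by rewrite /lift -h -surjective_pairing fK.
Qed.

(** Each position has at most one lifted vertex above it, so injectivity of the realization in R^4
    reduces to equality of plane masses. *)
Lemma weight_lift t a b c v :
  weight (lift3 t) a b c v = ((f v).2 == hg (f v).1)%:R * mass3 a b c t.1.1 t.1.2 t.2 (f v).1.
Proof.
rewrite /weight /mass3 !lift_eq /=; case: (_ == hg _) => /=; first by rewrite mul1r.
by rewrite mul0r !mulr0 !addr0.
Qed.

Lemma f_combination t a b c : f (combination (lift3 t) a b c) =
  (comb3 a b c t.1.1 t.1.2 t.2, comb3 a b c (hg t.1.1) (hg t.1.2) (hg t.2)).
Proof. by rewrite /combination f_comb !f_lift. Qed.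

Lemma lift3_uniq t : t.1.1 != t.1.2 -> t.1.1 != t.2 -> t.1.2 != t.2 -> uniq (vertices3 (lift3 t)).
Proof.
move=> h1 h2 h3; have inj p q : p != q -> lift p != lift q.
  by apply: contraNneq => /(congr1 f); rewrite !f_lift => -[->].
by rewrite /= !inE !andbT negb_or !inj.
Qed.

Lemma tri_uniq i a b s : istri i a b s -> uniq (vertices3 (lift3 (tr i a b s))).
Proof.
move=> h; have := tri_cen_pos i h; have [[ab _ _ _] _] := h => /gt_eqF/negbT.
rewrite mulf_eq0 negb_or => /andP[_ c0].
apply: lift3_uniq => /=.
- by apply: contraNneq c0 => ->; rewrite lval_lpt.
- by apply: contraNneq c0 => ->; rewrite lval_lpt.
- by apply/eqP => -[e _]; move: ab; rewrite e ltxx.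
Qed.

Lemma tent_uniq i j : uniq (vertices3 (lift3 (tent3 i j))).
Proof.
have ep_pos := ep0.
by apply: lift3_uniq => /=; apply/eqP => -[e _]; move: e; lra.
Qed.

Lemma comb3_lpt i a b c t t' t'' : a + b + c = 1 ->
  comb3 a b c (lp i t) (lp i t') (lp i t'') = lp i (a * t + b * t' + c * t'').
Proof.
move=> h; rewrite /comb3 /lpt /line /=; congr pair.
have -> : a = 1 - b - c by lra.
ring.
Qed.

Lemma comb3_tent i j a b c : a + b + c = 1 ->
  comb3 a b c (tent3 i j).1.1 (tent3 i j).1.2 (tent3 i j).2 = lp i (mk i j + (b - a) * ep).
Proof.
move=> h; rewrite comb3_lpt //; congr lpt.
have -> : c = 1 - a - b by lra.
ring.
Qed.

Lemma comb3_tent_height i j a b c : under i j -> a + b + c = 1 ->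
  let t := mk i j + (b - a) * ep in
  comb3 a b c (hg (tent3 i j).1.1) (hg (tent3 i j).1.2) (hg (tent3 i j).2) =
  ((ht i t).1 + c * (rise i j).1, (ht i t).2 + c * (rise i j).2).
Proof.
move=> uj h t; have [_ _ _ _ hX] := underP uj; rewrite /= hX.
rewrite !(hg_foot gp ep0 ep_gap uj); [|by right|by left].
have -> : c = 1 - a - b by lra.
by rewrite /rise /comb3 /height /t /=; congr pair; ring.
Qed.

Lemma tent_abs i j a b c (t := mk i j + (b - a) * ep) : under i j ->
  0 <= a -> 0 <= b -> 0 <= c -> a + b + c = 1 -> under_tent x y z w ep i j (lp i t).
Proof.
move=> uj a0 b0 c0 h; split=> //; rewrite lval_lpt /t /=; split=> //.
rewrite addrAC subrr add0r normrM (gtr0_norm ep0) ler_piMl ?(ltW ep0) //.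
by rewrite ler_norml; apply/andP; split; lra.
Qed.

Lemma phi_tri t a b c : t \in L -> 0 <= a -> 0 <= b -> 0 <= c -> a + b + c = 1 ->
  phi (comb3 a b c t.1.1 t.1.2 t.2) = comb3 a b c (hg t.1.1) (hg t.1.2) (hg t.2).
Proof. by move=> /L_tri[i [a' [b' [s [h ->]]]]] a0 b0 c0 abc; exact: phiE. Qed.

(** A tent point on the graph satisfies c' = 1 - |b' - a'|, so it lies on one of the two upper
    sides. Such a side is an outer side of a graph triangle, to which [tri_inj] applies. *)
Lemma tri_tent_mass t i j a b c a' b' c' : t \in L -> under i j ->
  0 <= a -> 0 <= b -> 0 <= c -> a + b + c = 1 ->
  0 <= a' -> 0 <= b' -> 0 <= c' -> a' + b' + c' = 1 ->
  let s := tent3 i j in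
  comb3 a b c t.1.1 t.1.2 t.2 = comb3 a' b' c' s.1.1 s.1.2 s.2 ->
  comb3 a b c (hg t.1.1) (hg t.1.2) (hg t.2) = comb3 a' b' c' (hg s.1.1) (hg s.1.2) (hg s.2) ->
  mass3 a b c t.1.1 t.1.2 t.2 =1 mass3 a' b' c' s.1.1 s.1.2 s.2.
Proof.
move=> tL uj a0 b0 c0 abc a0' b0' c0' abc' s e1 e2; have ep_pos := ep0.
have ut := tent_abs uj a0' b0' c0' abc'.
have [sij gi gj hij hgX] := underP uj; have [el1 el2] := el_tent ep0 ep_gap sij.
have gfoot e : `|e| <= ep -> ga i (mk i j + e) <= 0.
  move=> he; apply: ltW; apply: (gap_tent ep0 ep_gap gi).
  by rewrite addrAC subrr add0r; lra.
have g1 : ga i (mk i j - ep) <= 0 by apply: gfoot; rewrite normrN gtr0_norm.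
have g2 : ga i (mk i j + ep) <= 0 by apply: gfoot; rewrite gtr0_norm.
have g0 : ga i (mk i j) <= 0 by exact: ltW.
have small : `|(b' - a') * ep| <= ep.
  by case: ut => _ [_]; rewrite /= addrAC subrr add0r.
have := phi_tri tL a0 b0 c0 abc; rewrite e2 comb3_tent_height // e1 comb3_tent //.
rewrite (phi_under gp ep0 ep_gap phiE uj); last by rewrite addrAC subrr add0r; lra.
have -> : mk i j + (b' - a') * ep - mk i j = (b' - a') * ep by rewrite addrAC subrr add0r.
rewrite -/(rise i j) (tent_in ep0 small) normrM (gtr0_norm ep0) mulfK ?gt_eqF //.
rewrite -[(ht j _).1 - _]/((rise i j).1) -[(ht j _).2 - _]/((rise i j).2) => -[/addrI h1 /addrI h2].
have cE : c' = 1 - `|b' - a'|.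
  have N0 := rise_norm uj; apply: (mulIf N0).
  by rewrite !expr2 !mulrDr !mulrA h1 h2.
have [i' [u [v [r [ht_ tE]]]]] := L_tri tL.
have foot0 : a' = 0 \/ b' = 0.
  by move: cE; case: (ger0P (b' - a')) => ? ?; [left|right]; lra.
case: foot0 => z0.
  have [r' hr'] := tri_of_segment gp ep0 el2 g0 g2.
  have e : comb3 0 c' b' (ce (sg i (mk i j) (mk i j + ep) r')) (lp i (mk i j)) (lp i (mk i j + ep)) =
           comb3 a' b' c' s.1.1 s.1.2 s.2.
    by rewrite /comb3 /= z0 !mul0r; congr pair; ring.
  have m : mass3 a b c t.1.1 t.1.2 t.2 =1
      mass3 0 c' b' (ce (sg i (mk i j) (mk i j + ep) r')) (lp i (mk i j)) (lp i (mk i j + ep)).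
    rewrite tE; apply: (tri_inj ht_ hr') => //; first by rewrite -abc' z0; ring.
    by rewrite e -e1 tE.
  by move=> q; rewrite m /mass3 /= z0 !mul0r; ring.
have [r' hr'] := tri_of_segment gp ep0 el1 g1 g0.
have e : comb3 0 a' c' (ce (sg i (mk i j - ep) (mk i j) r')) (lp i (mk i j - ep)) (lp i (mk i j)) =
         comb3 a' b' c' s.1.1 s.1.2 s.2.
  by rewrite /comb3 /= z0 !mul0r; congr pair; ring.
have m : mass3 a b c t.1.1 t.1.2 t.2 =1
    mass3 0 a' c' (ce (sg i (mk i j - ep) (mk i j) r')) (lp i (mk i j - ep)) (lp i (mk i j)).
  rewrite tE; apply: (tri_inj ht_ hr') => //; first by rewrite -abc' z0; ring.
  by rewrite e -e1 tE.
by move=> q; rewrite m /mass3 /= z0 !mul0r; ring.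
Qed.

(** By [under_same] both points lie in one tent; the abscissa then fixes [b - a] and the height
    fixes [c]. *)
Lemma tent_tent_mass i j i' j' a b c a' b' c' : under i j -> under i' j' ->
  0 <= a -> 0 <= b -> 0 <= c -> a + b + c = 1 ->
  0 <= a' -> 0 <= b' -> 0 <= c' -> a' + b' + c' = 1 ->
  let t := tent3 i j in let s := tent3 i' j' in
  comb3 a b c t.1.1 t.1.2 t.2 = comb3 a' b' c' s.1.1 s.1.2 s.2 ->
  comb3 a b c (hg t.1.1) (hg t.1.2) (hg t.2) = comb3 a' b' c' (hg s.1.1) (hg s.1.2) (hg s.2) ->
  mass3 a b c t.1.1 t.1.2 t.2 =1 mass3 a' b' c' s.1.1 s.1.2 s.2.
Proof.
move=> uj uj' a0 b0 c0 abc a0' b0' c0' abc' t s; have ep_pos := ep0.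
rewrite !comb3_tent // => e; rewrite !comb3_tent_height // => eh.
have [_ [l1 d1]] := tent_abs uj a0 b0 c0 abc.
have [_ [l2 d2]] := tent_abs uj' a0' b0' c0' abc'.
rewrite -e in l2 d2; have [ii jj] := under_same gp ep0 ep_gap uj uj' l1 l2 d1 d2.
move: e eh; rewrite /t /s -ii -jj => -[e _].
have {}e : b - a = b' - a'.
  by apply: (mulIf (lt0r_neq0 ep0)); apply: (addrI (mk i j)).
rewrite e => -[/addrI h1 /addrI h2].
have cE : c = c'.
  have N0 := rise_norm uj; apply: (mulIf N0).
  by rewrite !expr2 !mulrDr !mulrA h1 h2.
have aE : a = a' by lra.
have bE : b = b' by lra.
by rewrite aE bE cE.
Qed.

Definition tents := [seq tent3 q.1 q.2 | q <- enum [pred q : 'I_n * 'I_n | under q.1 q.2]].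

Lemma tentsP t : t \in tents -> exists i j, under i j /\ t = tent3 i j.
Proof. by move=> /mapP[[i j]]; rewrite mem_enum inE => /= uj ->; exists i, j. Qed.

Definition surface_triangles := map lift3 (L ++ tents).

Lemma size_surface_triangles : (size surface_triangles <= 7 * n ^ 2)%N.
Proof.
rewrite size_map size_cat size_map -cardE.
rewrite (_ : 7 * n ^ 2 = 6 * n ^ 2 + n * n)%N; last by rewrite -mulnn; lia.
by apply: leq_add L_size _; apply: leq_trans (max_card _) _; rewrite card_prod !card_ord.
Qed.

Lemma surface_complex : exists m (p : 'I_m -> 'rV[R]_4) (F : {set {set 'I_m}}),
  [/\ triangle_complex p F, carrier p F = tri_union surface_triangles &
      (#|F| <= size surface_triangles)%N].
Proof.
apply: complex_of_list.
  move=> t /mapP[t' + ->]; rewrite mem_cat => /orP[/L_tri[i [a [b [s [h ->]]]]]|/tentsP[i [j [_ ->]]]].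
    exact: tri_uniq h.
  exact: tent_uniq.
move=> _ _ a b c a' b' c' /mapP[t tT ->] /mapP[t' tT' ->] a0 b0 c0 abc a0' b0' c0' abc' e.
move/(congr1 f): e; rewrite !f_combination => -[e1 e1' e2 e2'].
have {e1 e1'}e1 : comb3 a b c t.1.1 t.1.2 t.2 = comb3 a' b' c' t'.1.1 t'.1.2 t'.2.
  by rewrite /comb3 e1 e1'.
have {e2 e2'}e2 : comb3 a b c (hg t.1.1) (hg t.1.2) (hg t.2) =
    comb3 a' b' c' (hg t'.1.1) (hg t'.1.2) (hg t'.2) by rewrite /comb3 e2 e2'.
move=> v; rewrite !weight_lift; congr (_ * _).
move: tT tT'; rewrite !mem_cat => /orP[tL|/tentsP[i [j [uj tE]]]] /orP[tL'|/tentsP[i' [j' [uj' tE']]]].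
- have [i [u [u' [s [h tE]]]]] := L_tri tL; have [i' [r [r' [s' [h' tE']]]]] := L_tri tL'.
  rewrite tE tE'; apply: (tri_inj h h') => //.
  by rewrite tE tE' in e1.
- by rewrite tE' in e1 e2 *; exact: (tri_tent_mass tL uj').
- rewrite tE in e1 e2 *; apply: esym.
  by apply: (tri_tent_mass tL' uj) => //; rewrite ?e1 ?e2.
- by rewrite tE tE' in e1 e2 *; exact: (tent_tent_mass uj uj').
Qed.

Lemma surface_union : tri_union surface_triangles = f @^-1` surf x y z w ep phi.
Proof.
have ep_pos := ep0; have [_ _ fK gK] := fg.
have hullP t v : tri_hull (lift3 t) v <-> exists a b c, [/\ 0 <= a, 0 <= b, 0 <= c, a + b + c = 1 &
    f v = (comb3 a b c t.1.1 t.1.2 t.2, comb3 a b c (hg t.1.1) (hg t.1.2) (hg t.2))].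
  split=> -[a [b [c [a0 b0 c0 abc vE]]]]; exists a, b, c; split=> //.
    by rewrite vE f_combination.
  by rewrite -[v]fK vE -f_combination fK.
apply/seteqP; split=> v.
  move=> [_ /mapP[t + ->]] /hullP[a [b [c [a0 b0 c0 abc vE]]]].
  rewrite mem_cat /surf /= vE => /orP[tL|/tentsP[i [j [uj tE]]]] /=.
    left; split; last by rewrite -phi_tri.
    have : union3 L (comb3 a b c t.1.1 t.1.2 t.2) by exists t => //; exists a, b, c.
    by rewrite -(region_union3 gp L_tri tri_L).
  right; exists i, j; split=> //; rewrite tE.
  have [_ [l d]] := tent_abs uj a0 b0 c0 abc.
  rewrite comb3_tent // comb3_tent_height //; split=> //=.
  exists c => //; rewrite addrAC subrr add0r tent_in ?c0 //=; last first.
    by move: d; rewrite /= addrAC subrr add0r.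
  rewrite normrM (gtr0_norm ep0) mulfK ?gt_eqF //.
  by case: (ger0P (b - a)); lra.
case=> [[rv vE]|[i [j [uj [lu d [c /andP[c0 ct] vE]]]]]].
  have : union3 L (f v).1 by rewrite -(region_union3 gp L_tri tri_L).
  move=> [t tL [a [b [c [a0 b0 c0 abc uE]]]]]; exists (lift3 t).
    by apply: map_f; rewrite mem_cat tL.
  apply/hullP; exists a, b, c; split=> //.
  by rewrite -(phi_tri tL) // -uE -vE -surjective_pairing.
exists (lift3 (tent3 i j)).
  apply: map_f; rewrite mem_cat; apply/orP; right.
  by apply/mapP; exists (i, j); rewrite ?mem_enum ?inE.
set s := (f v).1.1 - mk i j in d ct; rewrite (tent_in ep0 d) in ct.
have se : `|s / ep| <= 1 - c by rewrite normrM normfV (gtr0_norm ep0); lra.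
move: se; rewrite ler_norml => /andP[s1 s2].
(* The apex has weight [c]; the weights of the feet have sum [1 - c] and difference [s / ep]. *)
apply/hullP; exists ((1 - c - s / ep) / 2), ((1 - c + s / ep) / 2), c.
have sum : (1 - c - s / ep) / 2 + (1 - c + s / ep) / 2 + c = 1 by field; rewrite gt_eqF.
split=> //; [lra|lra|].
have tE : mk i j + ((1 - c + s / ep) / 2 - (1 - c - s / ep) / 2) * ep = (f v).1.1.
  by rewrite /s; field; rewrite gt_eqF.
rewrite comb3_tent // comb3_tent_height // tE -vE -(lval0 lu).
exact: surjective_pairing.
Qed.

Lemma surface_exists : exists m (p : 'I_m -> 'rV[R]_4) (F : {set {set 'I_m}}),
  [/\ triangle_complex p F, compact_surface (carrier p F),
      manifold_boundary (carrier p F) = f @^-1` curve x y z w,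
      locally_flat (carrier p F) & (#|F| <= 7 * n ^ 2)%N].
Proof.
have [m [p [F [cF FE sF]]]] := surface_complex.
have [c1 c2] := surf_charts gp ep0 ep_gap cts_phi phiE.
have [s1 s2 s3] : [/\ compact_surface (carrier p F),
    manifold_boundary (carrier p F) = f @^-1` curve x y z w & locally_flat (carrier p F)].
  apply: surface_of_charts.
  - by rewrite FE; exact: compact_tri_union.
  - by move=> v cv; rewrite FE surface_union; apply: flat_at_homeo fg _; exact: c1.
  - move=> v; rewrite FE surface_union => Sv ncv; apply: flat_at_homeo fg _.
    exact: c2.
by exists m, p, F; split=> //; apply: leq_trans sF size_surface_triangles.
Qed.

End Lift.

(** * Linear coordinates adapted to the projection *)

Section Coordinates.
Variables (R : realType) (q : 'cV[R]_4 * 'cV[R]_4).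
Local Notation Q4 := ((R * R) * (R * R))%type.
Let Dq := q.1 0 0 * q.2 1 0 - q.2 0 0 * q.1 1 0.
Hypothesis D0 : Dq != 0.

(** The plane projection completed by the last two coordinates of R^4, which serve as heights; [Dq]
    is the determinant of this linear map. *)
Definition proj_coords (X : 'rV[R]_4) : Q4 := ((pr X q.1, pr X q.2), (X 0 2, X 0 3)).

Definition coords_proj (p : Q4) : 'rV[R]_4 :=
  let s := p.1.1 - p.2.1 * q.1 2 0 - p.2.2 * q.1 3 0 in
  let t := p.1.2 - p.2.1 * q.2 2 0 - p.2.2 * q.2 3 0 in
  \matrix_(i < 1, j < 4)
    [:: (s * q.2 1 0 - t * q.1 1 0) / Dq; (q.1 0 0 * t - q.2 0 0 * s) / Dq; p.2.1; p.2.2]`_j.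

Lemma prE (X : 'rV[R]_4) (c : 'cV[R]_4) :
  pr X c = X 0 0 * c 0 0 + X 0 1 * c 1 0 + X 0 2 * c 2 0 + X 0 3 * c 3 0.
Proof.
rewrite /pr mxE !big_ord_recl big_ord0 addr0 !addrA.
by congr (_ + X 0 _ * c _ 0 + X 0 _ * c _ 0 + X 0 _ * c _ 0); apply: val_inj.
Qed.

Lemma homeo_proj_coords : homeo proj_coords coords_proj.
Proof.
split.
- have c k : continuous (fun X : 'rV[R]_4 => pr X k).
    rewrite (_ : pr (R:=R)^~ k = fun X : 'rV[R]_4 => X 0 0 * k 0 0 + X 0 1 * k 1 0 + X 0 2 * k 2 0 + X 0 3 * k 3 0).
      by cts; exact: cts_id.
    by apply: funext => X; exact: prE.
  by rewrite /proj_coords; cts; solve [exact: c|exact: cts_id].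
- have c j : continuous (fun p : Q4 => coords_proj p 0 j).
    rewrite /coords_proj.
    case: j => -[|[|[|[|//]]]] lt.
    + rewrite (_ : (fun p => _) = fun p : Q4 => ((p.1.1 - p.2.1 * q.1 2 0 - p.2.2 * q.1 3 0) * q.2 1 0 -
        (p.1.2 - p.2.1 * q.2 2 0 - p.2.2 * q.2 3 0) * q.1 1 0) / Dq); first by cts.
      by apply: funext => p; rewrite mxE.
    + rewrite (_ : (fun p => _) = fun p : Q4 => (q.1 0 0 * (p.1.2 - p.2.1 * q.2 2 0 - p.2.2 * q.2 3 0) -
        q.2 0 0 * (p.1.1 - p.2.1 * q.1 2 0 - p.2.2 * q.1 3 0)) / Dq); first by cts.
      by apply: funext => p; rewrite mxE.
    + rewrite (_ : (fun p => _) = fun p : Q4 => p.2.1); first by cts.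
      by apply: funext => p; rewrite mxE.
    + rewrite (_ : (fun p => _) = fun p : Q4 => p.2.2); first by cts.
      by apply: funext => p; rewrite mxE.
  have := cts_mx (fun (_ : 'I_1) (j : 'I_4) => c j).
  rewrite (_ : (fun x => _) = coords_proj) //.
  by apply: funext => p; apply/matrixP => i j; rewrite mxE ord1.
- move=> X; apply/matrixP => i j; rewrite ord1 mxE /= !prE.
  have o (k k' : 'I_4) : nat_of_ord k = k' -> X 0 k = X 0 k' by move=> e; congr (X 0 _); exact: val_inj.
  case: j => -[|[|[|[|//]]]] lt /=.
  + rewrite /Dq (o (Ordinal lt) 0) //; field; exact: D0.
  + rewrite /Dq (o (Ordinal lt) 1) //; field; exact: D0.
  + exact: o.
  + exact: o.
- move=> [[s t] [a b]]; rewrite /proj_coords !prE !mxE /=.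
  by rewrite /Dq; congr ((_, _), (_, _)); field; exact: D0.
Qed.

Lemma proj_coords_comb a b c A B C : proj_coords (a *: A + b *: B + c *: C) =
  (comb3 a b c (proj_coords A).1 (proj_coords B).1 (proj_coords C).1,
   comb3 a b c (proj_coords A).2 (proj_coords B).2 (proj_coords C).2).
Proof. by rewrite /proj_coords /comb3 /= !prD !prZ !mxE. Qed.

End Coordinates.

(** In the adapted coordinates an edge is the graph of its line and height over its abscissas, so
    the conditions on the plane polygon translate into those on edge parameters. *)
Lemma good_polygon_of_curve (R : realType) (n : nat) (v : 'I_n -> 'rV[R]_4) :
  (forall i j (s t : R), 0 <= s < 1 -> 0 <= t < 1 ->
     edge_point v i s = edge_point v j t -> i = j /\ s = t) ->
  exists (x y z w : 'I_n -> R) (f : 'rV[R]_4 -> (R * R) * (R * R)) g, [/\ good_polygon x y z w, homeo f g,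
    forall a b c A B C, f (a *: A + b *: B + c *: C) =
      (comb3 a b c (f A).1 (f B).1 (f C).1, comb3 a b c (f A).2 (f B).2 (f C).2) &
    [set X | exists i, exists2 t : R, 0 <= t <= 1 & X = edge_point v i t] =
      f @^-1` curve x y z w].
Proof.
move=> v_inj; pose e i := v (ordS i) - v i.
have [q [D0 e0 cross]] := generic_projection v_inj (fun i => erefl : e i = _).
pose f := proj_coords q; pose g := coords_proj q.
have fg : homeo f g := homeo_proj_coords D0.
have [_ _ fK _] := fg.
pose x i := (f (v i)).1.1; pose y i := (f (v i)).1.2.
pose z i := (f (v i)).2.1; pose w i := (f (v i)).2.2.
have dx i : x (ordS i) - x i = pr (e i) q.1 by rewrite /x /f /e prD prN.
have dy i : y (ordS i) - y i = pr (e i) q.2 by rewrite /y /f /e prD prN.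
have dx0 i : x (ordS i) - x i != 0 by rewrite dx.
pose ab i s := x i + s * (x (ordS i) - x i).
have fE i s : f (edge_point v i s) = (lpt x y i (ab i s), height x z w i (ab i s)).
  rewrite /f /edge_point /proj_coords !prD !prZ !mxE /lpt /line /height /slope /ab.
  have dx0' := dx0 i.
  congr ((_, _), (_, _)).
  - by rewrite /x /=; ring.
  - by rewrite addrAC subrr add0r mulrA mulrAC divfK // /y /=; ring.
  - by rewrite addrAC subrr add0r mulrA mulrAC divfK // /z /=; ring.
  - by rewrite addrAC subrr add0r mulrA mulrAC divfK // /w /=; ring.
have gapE i s : gap x i (ab i s) = s * (s - 1) * (x (ordS i) - x i) ^+ 2.
  by rewrite /gap /ab; ring.
have sq i : 0 < (x (ordS i) - x i) ^+ 2 by rewrite lt_neqAle eq_sym sqrf_eq0 dx0 sqr_ge0.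
have gap_le i s : (gap x i (ab i s) <= 0) = (0 <= s <= 1).
  rewrite gapE pmulr_lle0 //; apply/idP/andP => [h|[h1 h2]]; last by nra.
  by split; nra.
have param i t : gap x i t <= 0 -> exists2 s, 0 <= s <= 1 & t = ab i s.
  move=> h; have tE : t = ab i ((t - x i) / (x (ordS i) - x i)) by rewrite /ab divfK // subrKC.
  by exists ((t - x i) / (x (ordS i) - x i)) => //; rewrite -(gap_le i) -tE.
have ab0 i : ab i 0 = x i by rewrite /ab mul0r addr0.
have ab1 i : ab i 1 = x (ordS i) by rewrite /ab mul1r subrKC.
have ep1 i : edge_point v i 1 = edge_point v (ordS i) 0.
  by rewrite /edge_point subrr subr0 !scale0r !scale1r add0r addr0.
have lt1 (s : R) : 0 <= s <= 1 -> s = 1 \/ 0 <= s < 1.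
  by move=> /andP[s0 s1]; have [->|s1'] := eqVneq s 1; [left|right; rewrite s0 lt_neqAle s1'].
have z01 : 0 <= (0 : R) < 1 by rewrite lexx ltr01.
(* With closed parameter intervals a vertex has two names, parameter 1 on one edge and 0 on the
   next; hence the two extra cases. *)
have meet i j s t : 0 <= s <= 1 -> 0 <= t <= 1 -> edge_point v i s = edge_point v j t ->
    [\/ i = j, j = ordS i /\ t = 0 | i = ordS j /\ s = 0].
  move=> /lt1[->|s1] /lt1[->|t1].
  - by rewrite !ep1 => /(v_inj _ _ _ _ z01 z01)[/ordS_inj ->]; constructor 1.
  - by rewrite ep1 => /(v_inj _ _ _ _ z01 t1)[-> <-]; constructor 2.
  - by rewrite ep1 => /(v_inj _ _ _ _ s1 z01)[-> ->]; constructor 3.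
  - by move=> /(v_inj _ _ _ _ s1 t1)[-> _]; constructor 1.
exists x, y, z, w, f, g; split=> //; last first.
- apply/seteqP; split=> X.
    move=> [i [s s01 ->]]; exists i; rewrite fE; split=> //.
    by rewrite onseg_lpt gap_le.
  move=> [i [oi hX]]; have [s s01 sE] := param i _ (onseg_ga oi).
  exists i, s => //; apply: (can_inj fK); rewrite fE -sE.
  by rewrite [LHS]surjective_pairing hX -(lval0 (onseg_lv oi)).
- exact: proj_coords_comb.
split.
- by move=> i; rewrite eq_sym -subr_eq0.
- move=> i j t /param[s s01 tE] /param[s' s01' tE'] hl hh.
  have : edge_point v i s = edge_point v j s'.
    by apply: (can_inj fK); rewrite !fE -tE -tE' hh /lpt hl.
  case/(meet _ _ _ _ s01 s01') => [e_|[e_ s0]|[e_ s0]]; first by constructor 1.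
    by constructor 2; rewrite {1}tE' s0 ab0.
  by constructor 3; rewrite {1}tE s0 ab0.
move=> i j t /param[s s01 tE] /param[s' s01' tE'] hl hh.
have ne : edge_point v i s != edge_point v j s'.
  by apply: contraNneq hh => /(congr1 f); rewrite !fE -tE -tE' => h; apply/eqP; exact: (congr1 (fun u : (R * R) * (R * R) => u.2) h).
have p1 k r : pr (edge_point v k r) q.1 = ab k r by exact: (congr1 (fun u : (R * R) * (R * R) => u.1.1) (fE k r)).
have p2 k r : pr (edge_point v k r) q.2 = line x y k (ab k r).
  exact: (congr1 (fun u : (R * R) * (R * R) => u.1.2) (fE k r)).
have [] := cross i j s s' s01 s01' ne; rewrite ?p1 ?p2 -?tE -?tE' //.
move=> /andP[s0 s1] /andP[s0' s1'] det only; split.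
- by rewrite tE gapE pmulr_llt0 // pmulr_rlt0 // subr_lt0.
- by rewrite tE' gapE pmulr_llt0 // pmulr_rlt0 // subr_lt0.
- apply: contraNneq det; rewrite /slope /det2 !dx !dy => h.
  have := e0 i; have := e0 j => j0 i0.
  rewrite -(divfK i0 (pr (e i) q.2)) h -subr_eq0 subr0; apply/eqP; field; exact: j0.
move=> k gk lk; have [r r01 rE] := param k t gk.
by apply: (only k r r01); rewrite ?p1 ?p2 -rE.
Qed.

Theorem mainTheorem7 (R : realType) (n : nat) (P : set 'rV[R]_4)
    (hP : closed_polygonal_curve n P) :
  exists (m : nat) (p : 'I_m -> 'rV[R]_4) (F : {set {set 'I_m}}),
    [/\ triangle_complex p F,
        compact_surface (carrier p F),
        manifold_boundary (carrier p F) = P,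
        locally_flat (carrier p F)
      & (#|F| <= 24 * n ^ 2)%N].
Proof.
have [v [_ v_inj ->]] := hP.
have [x [y [z [w [f [g [gp fg f_comb ->]]]]]]] := good_polygon_of_curve v_inj.
pose J : finType := ('I_n * 'I_n * ('I_n * 'I_n))%type.
(* The division by 3 provides the spacing required in [ep_gap]. *)
pose dist (q : J) := `|mark x y q.1.1 q.1.2 - mark x y q.2.1 q.2.2| / 3.
have [ep ep0 dist_ep] := lower_bound_pos dist.
have ep_gap i j k l : mark x y i j != mark x y k l -> 3 * ep < `|mark x y i j - mark x y k l|.
  rewrite -subr_eq0 -normr_gt0 => h; have := dist_ep ((i, j), (k, l)).
  by rewrite /dist /=; lra.
have [L [L_size L_tri tri_L]] := tri_list x y ep0.
(* The two height coordinates are interpolated and extended separately. *)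
have [phi1 [c1 phi1E]] := graph_function L_tri tri_L (fun u => (hg x y z w u).1).
have [phi2 [c2 phi2E]] := graph_function L_tri tri_L (fun u => (hg x y z w u).2).
pose phi u := (phi1 u, phi2 u).
have cts_phi : continuous phi by rewrite /phi; cts.
have [|m [p [F [h1 h2 h3 h4 h5]]]] :=
  @surface_exists _ _ _ _ _ _ gp _ ep0 ep_gap phi cts_phi _ _ L_tri tri_L L_size _ _ fg f_comb.
  move=> i a b s d0 d1 d2 h q0 q1 q2 sum.
  by rewrite /phi (phi1E _ _ _ _ _ _ _ h) // (phi2E _ _ _ _ _ _ _ h).
exists m, p, F; split=> //; apply: leq_trans h5 _.
by rewrite leq_mul2r orbT.
Qed.
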